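(* Let $I=[0,2\pi]$, let $G:I\to\mathbb R$, $G\in C(I)$, $G(0)=G(2\pi)$, and let $F:\mathbb R\times I\to\mathbb R$ satisfy Assumption (A) of the context with constants $k,l>0$ and function $h$, and $F(u,0)=F(u,2\pi)$ for all $u\in\mathbb R$. Let $b\in\mathbb R$, $b\neq0$, and $a\ge0$. Consider the problem $$-\frac{d^4u}{dx^4}+b\frac{du}{dx}+au+\int_{0}^{2\pi}G(x-y)F(u(y),y)\,dy=0,\quad x\in I, \qquad (P)$$ and, for given $v$, the auxiliary equation for $u$ $$\frac{d^4u}{dx^4}-b\frac{du}{dx}-au=\int_{0}^{2\pi}G(x-y)F(v(y),y)\,dy,\quad x\in I. \qquad (Q)$$ I) If $a>0$ and $2\sqrt{\pi}\,\mathcal N_{a,b}\,l<1$, then equation (Q) defines a map $\tau_{a,b}:H^4(I)\to H^4(I)$, $\tau_{a,b}v=u$, which has a unique fixed point $v_{a,b}$, and $v_{a,b}$ is the only solution of (P) in $H^4(I)$. II) If $a=0$, $\int_0^{2\pi}G(x)\,dx=0$ and $2\sqrt{\pi}\,\mathcal N_{0,b}\,l<1$, then equation (Q) with $a=0$ defines a map $\tau_{0,b}:H^4_0(I)\to H^4_0(I)$, $\tau_{0,b}v=u$, which has a unique fixed point $v_{0,b}$, and $v_{0,b}$ is the only solution of (P) with $a=0$ in $H_0^4(I)$. In both cases I) and II), the fixed point $v_{a,b}$ is not identically zero on $I$ provided that the Fourier coefficients satisfy $G_nF(0,x)_n\neq0$ for some $n\in\mathbb Z$.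
   Context: All functions in physical space are real valued. Kernels on $I=[0,2\pi]$ with equal endpoint values are extended $2\pi$-periodically to $\mathbb R$, so that $G(x-y)$ makes sense for $x,y\in I$. Function spaces: $H^4(I)=\{u:I\to\mathbb R \mid u,u''''\in L^2(I),\ u(0)=u(2\pi),\ u'(0)=u'(2\pi),\ u''(0)=u''(2\pi),\ u'''(0)=u'''(2\pi)\}$ with norm $\|u\|_{H^4(I)}^2=\|u\|_{L^2(I)}^2+\|u''''\|_{L^2(I)}^2$, and its closed subspace $H^4_0(I)=\{u\in H^4(I)\mid \int_0^{2\pi}u(x)\,dx=0\}$ with the same norm. Assumption (A): $F:\mathbb R\times I\to\mathbb R$ satisfies the Carathéodory condition ($F(u,x)$ is measurable in $x$ for every $u$ and continuous in $u$ for almost every $x$), and there are constants $k>0$, $l>0$ and a nonnegative function $h\in L^2(I)$ such that $|F(u,x)|\le k|u|+h(x)$ for all $u\in\mathbb R$, $x\in I$, and $|F(u_1,x)-F(u_2,x)|\le l|u_1-u_2|$ for all $u_1,u_2\in\mathbb R$, $x\in I$. Fourier coefficients: $G_n:=\int_0^{2\pi}G(x)\frac{e^{-inx}}{\sqrt{2\pi}}\,dx$, $n\in\mathbb Z$; $F(0,x)_n$ denotes the $n$-th Fourier coefficient (same formula) of $x\mapsto F(0,x)$. For $a\ge0$, $b\in\mathbb R$, $b\neq0$: $$\mathcal N_{a,b}:=\max\left\{\left\|\frac{G_n}{n^4-a-ibn}\right\|_{l^\infty},\ \left\|\frac{n^4G_n}{n^4-a-ibn}\right\|_{l^\infty}\right\},$$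 where $l^\infty$ norms are over $n\in\mathbb Z$. When $a=0$, at $n=0$ a quotient of the form $0/0$ is interpreted as $0$. *)

(* Defs.v *)
From HB Require Import structures.
From mathcomp Require Import all_boot all_order all_algebra.
From mathcomp Require Import all_classical all_reals all_analysis.
From mathcomp Require Import complex.
Set Implicit Arguments.
Unset Strict Implicit.
Unset Printing Implicit Defensive.
Import Order.TTheory GRing.Theory Num.Theory.
Import numFieldNormedType.Exports.
Local Open Scope ring_scope.
Local Open Scope classical_set_scope.

(** World: MathComp-Analysis.
    A function on I = [0, 2 pi] is represented by a total
    function R -> R, of which only the values on I matter; accordingly, two
    such functions are the same when they agree on I, [{in I2pi R, u =1 w}].

    Measurability and integrals are with respect to the completed Lebesgue
    measure, so that "measurable" means Lebesgue measurable and not just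
    Borel. *)

Definition I2pi (R : realType) : set R := `[0, 2 * pi].
Arguments I2pi R : clear implicits.

Notation leb R := (@completed_lebesgue_measure R).

(** R with the domain sigma-algebra of [leb R]. *)
Notation lebesgueType R := (caratheodory_type (@wlength R idfun)^*%mu).

Definition L2I (R : realType) (f : R -> R) : Prop :=
  f \_ (I2pi R) \in Lfun (leb R) 2%:E.

Definition abs_cont_oo (R : realType) (a b : R) (f : R -> R) : Prop :=
  forall e : R, 0 < e -> exists2 d : R, 0 < d &
    forall (n : nat) (s t : 'I_n -> R),
      (forall i, [/\ a < s i, s i <= t i & t i < b]) ->
      trivIset [set: 'I_n] (fun i => `]s i, t i[%classic) ->
      \sum_(i < n) (t i - s i) < d ->
      \sum_(i < n) `|f (t i) - f (s i)| < e.

(** H^4(I), through the continuous representative: u has three classical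
    derivatives on the open interval, u''' is absolutely continuous there, and
    u'''', which is the almost everywhere derivative of u''', is in L^2(I).
    The almost everywhere differentiability required below always holds for an
    absolutely continuous function; it makes explicit that [derive1n 4 u] is a
    genuine derivative, [derive1n] being a total operator.  The values of u',
    u'', u''' at 0 and 2 pi are their one-sided limits, since the two-sided
    derivative at an endpoint would depend on values of u outside I. *)
Definition H4 (R : realType) (u : R -> R) : Prop :=
  {within I2pi R, continuous u} /\
  (forall k, (k < 3)%N ->
     {in `]0, 2 * pi[, forall x, derivable (derive1n k u) x 1}) /\
  abs_cont_oo 0 (2 * pi) (derive1n 3 u) /\
  {ae leb R, forall x, x \in I2pi R -> derivable (derive1n 3 u) x 1} /\
  L2I u /\ L2I (derive1n 4 u) /\
  u 0 = u (2 * pi) /\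
  (forall k, (1 <= k <= 3)%N -> exists c : R,
     (derive1n k u x @[x --> 0^'+] --> c) /\
     (derive1n k u x @[x --> (2 * pi)^'-] --> c)).

Definition H40 (R : realType) (u : R -> R) : Prop :=
  H4 u /\ \int[leb R]_(x in I2pi R) u x = 0.

(** 2 pi-periodic extension of the restriction of G to I. *)
Definition perext (R : realType) (G : R -> R) (x : R) : R :=
  G (x - 2 * pi * (Num.floor (x / (2 * pi)))%:~R).

Definition assumptionA (R : realType) (F : R -> R -> R) (k l : R) (h : R -> R)
    : Prop :=
  (forall u, measurable_fun (I2pi R : set (lebesgueType R))
     (F u : lebesgueType R -> R)) /\
  {ae leb R, forall x, x \in I2pi R -> continuous (fun u => F u x)} /\
  0 < k /\ 0 < l /\
  {in I2pi R, forall x, 0 <= h x} /\ L2I h /\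
  (forall u, {in I2pi R, forall x, `|F u x| <= k * `|u| + h x}) /\
  (forall u1 u2,
     {in I2pi R, forall x, `|F u1 x - F u2 x| <= l * `|u1 - u2|}).

Definition convGF (R : realType) (G : R -> R) (F : R -> R -> R) (v : R -> R)
    (x : R) : R :=
  \int[leb R]_(y in I2pi R) (perext G (x - y) * F (v y) y).

Definition solvesP (R : realType) (G : R -> R) (F : R -> R -> R) (a b : R)
    (u : R -> R) : Prop :=
  {ae leb R, forall x, x \in I2pi R ->
     - derive1n 4 u x + b * derive1n 1 u x + a * u x + convGF G F u x = 0}.

Definition solvesQ (R : realType) (G : R -> R) (F : R -> R -> R) (a b : R)
    (v u : R -> R) : Prop :=
  {ae leb R, forall x, x \in I2pi R ->
     derive1n 4 u x - b * derive1n 1 u x - a * u x = convGF G F v x}.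

(** The equation [E v u] for u defines the map [tau] from X to itself. *)
Definition defines_map (R : realType) (X : (R -> R) -> Prop)
    (E : (R -> R) -> (R -> R) -> Prop) (tau : (R -> R) -> R -> R) : Prop :=
  forall v, X v ->
    [/\ X (tau v), E v (tau v) &
        forall u, X u -> E v u -> {in I2pi R, u =1 tau v}].

Definition Cint (R : realType) (f : R -> R[i]) : R[i] :=
  Complex (\int[leb R]_(x in I2pi R) complex.Re (f x))
          (\int[leb R]_(x in I2pi R) complex.Im (f x)).

Definition expi (R : realType) (t : R) : R[i] := Complex (cos t) (sin t).

Definition fourier (R : realType) (f : R -> R) (n : int) : R[i] :=
  Cint (fun x => (f x)%:C%C * (expi (- (n%:~R * x)) / (Num.sqrt (2 * pi))%:C%C)).

(** n^4 - a - i b n *)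
Definition symb (R : realType) (a b : R) (n : int) : R[i] :=
  Complex (n%:~R ^+ 4 - a) (- (b * n%:~R)).

(** Extended-real valued, as an l^oo norm may be infinite.  For a = 0 the
    quotient 0 / 0 at n = 0 is 0 by the convention z / 0 = 0. *)
Definition linf (R : realType) (c : int -> R[i]) : \bar R :=
  ereal_sup [set (Normc.normc (c n))%:E | n in [set: int]].

Definition Nab (R : realType) (G : R -> R) (a b : R) : \bar R :=
  maxe (linf (fun n => fourier G n / symb a b n))
       (linf (fun n => n%:~R ^+ 4 * fourier G n / symb a b n)).

(* Main.v *)
Require Import Defs.
From HB Require Import structures.
From mathcomp Require Import all_boot all_order all_algebra.
From mathcomp Require Import all_classical all_reals all_analysis.
From mathcomp Require Import complex.
From mathcomp Require Import measurable_realfun.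
From mathcomp Require Import ring lra.
Import Order.TTheory GRing.Theory Num.Theory.
Import numFieldNormedType.Exports.
Set Implicit Arguments.
Unset Strict Implicit.
Unset Printing Implicit Defensive.
Local Open Scope ring_scope.
Local Open Scope classical_set_scope.

(** Write L u = u'''' - b u' - a u and let P be the periodic extension of G.
    Since b is not 0, the characteristic polynomial of L has no purely
    imaginary root except 0, which is a simple root when a = 0.  Solving a
    first-order equation for each root gives a periodic function Gamma of class
    C^4 with L Gamma = P ([periodic_resolvent]); the root 0 is dealt with by
    the mean value condition on G.  Then tau v := Gamma * F (v, .), where * is
    convolution over a period, satisfies L (tau v) = P * F (v, .), which is
    (Q), and it is a classical solution because all derivatives fall on Gamma.

    The Fourier coefficients of Gamma are G_n / (n^4 - a - i b n), so that they
    are bounded by N = N_{a,b} ([energy_resolvent], [resolvent_energy_bound]).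
    By the Parseval identity ([conv_L2_le]), convolution with Gamma has L^2 norm
    at most sqrt (2 pi) N, and tau is Lipschitz in the L^2 norm with constant
    sqrt (2 pi) N l <= 2 sqrt pi N l < 1.  The contraction thus takes place in
    L^2 and not in H^4.  As Gamma * f is bounded by a multiple of the L^2 norm
    of f, the iterates converge uniformly to a bounded measurable fixed point
    ([L2_contraction]), which is in H^4 as a value of tau.

    The Parseval identity is needed as an upper bound on the integral of u^2
    for a Lipschitz function u ([Parseval_le]).  This integral is the value at 0
    of the autocorrelation of u, whose Fourier series has the squared moduli of
    the coefficients of u as coefficients and converges at 0 by the argument of
    Dirichlet ([Dirichlet_at0]), with the Riemann-Lebesgue lemma coming from
    the Bessel inequality.

    In (Q), u'''' is only an almost everywhere derivative, so that uniqueness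
    requires more than calculus ([periodic_ode_unique]).  Let d be the
    difference of two solutions and D a primitive of d.  The function
    d''' - b d - a D is locally absolutely continuous with zero derivative
    almost everywhere, hence constant ([abs_cont_derive0_cst]).  This makes d a
    classical solution, for which an energy with derivative (b d')^2 takes the
    same value at 0 and 2 pi.  So d' = 0 and then a d = 0.  As a fixed point of
    tau is the same thing as a solution of (P), uniqueness in (P) follows from
    uniqueness of the fixed point.

    Finally, if v = 0 is the fixed point then Gamma * F (0, .) = 0, whose n-th
    coefficient is proportional to G_n F(0, x)_n / (n^4 - a - i b n); all the
    products G_n F(0, x)_n are therefore 0. *)

(** * Integration over one period *)

Section integral_on_I.
Variable R : realType.
Implicit Types (f g : R -> R) (x : R).
Local Notation I := (I2pi R : set (lebesgueType R)).
Local Notation mu := (leb R).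

Definition intI f : R := \int[leb R]_(x in I2pi R) f x.
Definition measI f : Prop := measurable_fun I (f : lebesgueType R -> R).

Lemma twopi_gt0 : 0 < 2 * pi :> R.
Proof. by rewrite mulr_gt0// pi_gt0. Qed.

Lemma in_I x : (x \in I2pi R) = (0 <= x <= 2 * pi).
Proof. by rewrite /I2pi mem_setE in_itv. Qed.

Lemma borel_lebesgue (A : set R) :
  measurable (A : set (measurableTypeR R)) ->
  measurable (A : set (lebesgueType R)).
Proof. exact: sub_caratheodory. Qed.

Lemma measurable_I : measurable I.
Proof. by apply: borel_lebesgue; exact: measurable_itv. Qed.
Local Hint Resolve measurable_I : core.

Lemma leb_borel (A : set R) : mu A = lebesgue_measure A.
Proof. by []. Qed.

Lemma leb_I : mu I = (2 * pi)%:E.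
Proof.
rewrite leb_borel /I2pi lebesgue_measure_itv /= lte_fin twopi_gt0.
by rewrite -EFinB subr0.
Qed.

Lemma leb_I_lty : (mu I < +oo)%E.
Proof. by rewrite leb_I ltry. Qed.

Lemma borel_measI f :
  measurable_fun (I2pi R : set (measurableTypeR R)) f -> measI f.
Proof.
move=> mf _ B mB; apply: borel_lebesgue.
by apply: mf => //; exact: measurable_itv.
Qed.

Lemma within_continuous_measI f : {within I2pi R, continuous f} -> measI f.
Proof.
move=> cf; apply: borel_measI; apply: subspace_continuous_measurable_fun => //.
exact: measurable_itv.
Qed.

Lemma continuous_measI f : continuous f -> measI f.
Proof. by move=> cf; apply: within_continuous_measI; exact: continuous_subspaceT. Qed.

Lemma bounded_integrable f M : measI f ->
  (forall x, x \in I2pi R -> `|f x| <= M) -> mu.-integrable I (EFin \o f).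
Proof.
move=> mf fM; apply: measurable_bounded_integrable => //.
  exact: leb_I_lty.
exists M; split; first by rewrite num_real.
move=> M' MM' x Ix /=; apply: le_trans (ltW MM'); apply: fM; exact/mem_set.
Qed.

Lemma continuous_bounded_I f : continuous f ->
  exists M, 0 <= M /\ forall x, x \in I2pi R -> `|f x| <= M.
Proof.
move=> cf.
have cn : {within `[0, 2 * pi], continuous (fun x => `|f x|)}.
  apply: continuous_subspaceT => x.
  by apply: cvg_norm; exact: cf.
have [c _ cmax] := EVT_max (ltW twopi_gt0) cn.
exists `|f c|; split => // x; rewrite in_I => xI.
by apply: cmax; rewrite in_itv.
Qed.

Lemma continuous_integrable_I f : continuous f -> mu.-integrable I (EFin \o f).
Proof.
move=> cf; have [M [_ fM]] := continuous_bounded_I cf.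
exact: bounded_integrable (continuous_measI cf) fM.
Qed.

(** Square integrability as integrability of the square, the form in which
    products and linear combinations of integrands are handled. *)
Definition sqI f : Prop :=
  measI f /\ mu.-integrable I (EFin \o (fun x => f x ^+ 2)).

Lemma bounded_sqI f M : measI f -> (forall x, x \in I2pi R -> `|f x| <= M) ->
  sqI f.
Proof.
move=> mf fM; split => //; apply: (@bounded_integrable _ (M ^+ 2)).
  exact: measurable_funX.
by move=> x xI; rewrite normrX lerXn2r ?nnegrE ?(le_trans _ (fM x xI)) ?fM.
Qed.

Lemma continuous_sqI f : continuous f -> sqI f.
Proof.
move=> cf; have [M [_ fM]] := continuous_bounded_I cf.
exact: bounded_sqI (continuous_measI cf) fM.
Qed.

(** |f g| <= f^2 + g^2 dominates the product. *)
Lemma sqI_mul f g : sqI f -> sqI g ->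
  mu.-integrable I (EFin \o (fun x => f x * g x)).
Proof.
move=> [mf if2] [mg ig2].
have i2 := integrableD measurable_I if2 ig2.
apply: le_integrable i2 => //.
  by apply/measurable_EFinP; exact: measurable_funM.
move=> x Ix /=; rewrite lee_fin normrM [leRHS]ger0_norm ?addr_ge0 ?sqr_ge0//.
rewrite -(real_normK (num_real (f x))) -(real_normK (num_real (g x))).
have := sqr_ge0 (`|f x| - `|g x|).
have : 0 <= `|f x| * `|g x| by rewrite mulr_ge0.
by nra.
Qed.

Lemma sqI_integrable f : sqI f -> mu.-integrable I (EFin \o f).
Proof.
move=> sf; have s1 : sqI (cst 1) by apply: continuous_sqI; exact: cst_continuous.
have := sqI_mul sf s1; apply: eq_integrable => //.
by move=> x _ /=; rewrite mulr1.
Qed.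

Lemma sqID f g : sqI f -> sqI g -> sqI (fun x => f x + g x).
Proof.
move=> sf sg; have [mf if2] := sf; have [mg ig2] := sg.
split; first exact: measurable_funD.
have i2 := integrableD measurable_I (integrableD measurable_I if2 ig2)
  (integrableZl measurable_I 2 (sqI_mul sf sg)).
apply: eq_integrable i2 => // x _ /=; rewrite -!EFinM -!EFinD; congr EFin; ring.
Qed.

Lemma sqIZ a f : sqI f -> sqI (fun x => a * f x).
Proof.
move=> [mf if2]; split; first by apply: measurable_funM => //; exact: measurable_cst.
apply: eq_integrable (integrableZl measurable_I (a ^+ 2) if2) => //.
by move=> x _ /=; rewrite -EFinM exprMn.
Qed.

Lemma eq_sqI f g : (forall x, x \in I2pi R -> f x = g x) -> sqI f -> sqI g.
Proof.
move=> fg [mf if2]; split; first exact: eq_measurable_fun mf.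
by apply: eq_integrable if2 => // x xI /=; rewrite fg.
Qed.

Lemma sqIB f g : sqI f -> sqI g -> sqI (fun x => f x - g x).
Proof.
move=> sf sg; apply: eq_sqI (sqID sf (sqIZ (-1) sg)) => x _.
by rewrite mulN1r.
Qed.

Lemma sqI_dom f g : measI f -> sqI g ->
  (forall x, x \in I2pi R -> `|f x| <= g x) -> sqI f.
Proof.
move=> mf [mg ig2] fg; split => //.
apply: le_integrable ig2 => //.
  by apply/measurable_EFinP; exact: measurable_funX.
move=> x Ix /=; rewrite lee_fin !normrX lerXn2r ?nnegrE ?normr_ge0//.
by apply: le_trans (ler_norm _); apply: fg; rewrite inE.
Qed.

Lemma L2I_sqI f : L2I f -> sqI f.
Proof.
move=> /[dup] + /Lfun2_integrable_sqr i2.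
rewrite /L2I inE => /andP[/[!inE]/= mf _]; split.
  by apply/(measurable_restrictT _ _).2.
have : mu.-integrable I (EFin \o (fun x => (f \_ (I2pi R)) x ^+ 2)).
  by apply: integrableS i2 => //; exact: measurableT.
apply: eq_integrable => // x xI /=.
by rewrite patchE xI.
Qed.

(** The converse of L2I_sqI for bounded functions; it puts the continuous
    derivatives of the solutions in L^2. *)
Lemma bounded_L2I f (M : R) : measI f -> (forall x, x \in I2pi R -> `|f x| <= M) ->
  L2I f.
Proof.
move=> mf fM.
have m2 : measurable_fun setT ((f \_ (I2pi R)) : lebesgueType R -> R).
  by apply: (measurable_restrictT _ _).1; [exact: measurable_I|].
rewrite /L2I inE; apply/andP; split; first by rewrite inE.
rewrite inE /= /finite_norm unlock /Lnorm.
have [_ /integrableP [_ i2]] := bounded_sqI mf fM.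
apply: poweR_lty; apply: le_lt_trans i2.
rewrite [leRHS]integral_mkcond.
rewrite le_eqVlt; apply/orP; left; apply/eqP; apply: eq_integral => x _.
rewrite /= !patchE; case: ifP => _; last first.
  by rewrite (_ : point = 0)// normr0 powR0.
by rewrite powR_mulrn// normrX.
Qed.

Lemma eq_intI f g : (forall x, x \in I2pi R -> f x = g x) -> intI f = intI g.
Proof. by move=> fg; apply: eq_Rintegral. Qed.

Lemma intI_cst a : intI (fun=> a) = a * (2 * pi).
Proof. rewrite /intI Rintegral_cst//; congr (_ * _). by rewrite [X in fine X]leb_I. Qed.

Lemma intID f g : mu.-integrable I (EFin \o f) -> mu.-integrable I (EFin \o g) ->
  intI (fun x => f x + g x) = intI f + intI g.
Proof. exact: RintegralD. Qed.

Lemma intIB f g : mu.-integrable I (EFin \o f) -> mu.-integrable I (EFin \o g) ->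
  intI (fun x => f x - g x) = intI f - intI g.
Proof. exact: RintegralB. Qed.

Lemma intIZ a f : mu.-integrable I (EFin \o f) ->
  intI (fun x => a * f x) = a * intI f.
Proof. by move=> fi; rewrite /intI RintegralZl. Qed.

Lemma intI_ge0 f : (forall x, x \in I2pi R -> 0 <= f x) -> 0 <= intI f.
Proof. by move=> f0; apply: Rintegral_ge0 => x Ix; apply: f0; rewrite inE. Qed.

Lemma le_intI f g : mu.-integrable I (EFin \o f) -> mu.-integrable I (EFin \o g) ->
  (forall x, x \in I2pi R -> f x <= g x) -> intI f <= intI g.
Proof.
by move=> fi gi fg; apply: le_Rintegral => // x Ix; apply: fg; rewrite inE.
Qed.

Lemma normr_intI f : mu.-integrable I (EFin \o f) ->
  `|intI f| <= intI (fun x => `|f x|).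
Proof. by move=> fi; exact: le_normr_Rintegral. Qed.

(** Calculus is available for the Lebesgue measure on Borel sets; completing
    that measure changes no integral of a continuous function. *)
Lemma intI_lebesgue f : continuous f ->
  intI f = \int[lebesgue_measure]_(x in I2pi R) f x.
Proof.
move=> cf; congr fine.
have mid : measurable_fun setT (idfun : lebesgueType R -> measurableTypeR R).
  by move=> _ A mA; rewrite setTI; exact: borel_lebesgue.
have mf : measurable_fun setT (EFin \o f : measurableTypeR R -> \bar R).
  by apply/measurable_EFinP; exact: continuous_measurable_fun.
have := @integral_pushforward _ _ (lebesgueType R) (measurableTypeR R) R idfun mid mu (I2pi R) (EFin \o f) mf
  (continuous_integrable_I cf) (measurable_itv _).
move=> <-; apply: eq_measure_integral => A mA _.
by [].
Qed.

Lemma intI_FTC F f : continuous f -> (forall x, is_derive x 1 F (f x)) ->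
  intI f = F (2 * pi) - F 0.
Proof.
move=> cf dF; rewrite intI_lebesgue//.
have cF : continuous F.
  move=> x; apply: differentiable_continuous; apply/derivable1_diffP.
  by have [] := dF x.
rewrite /Rintegral (@continuous_FTC2 _ f F)//.
- exact: twopi_gt0.
- exact: continuous_subspaceT.
- split => [x _||]; first by have [] := dF x.
  + by apply: cvg_at_right_filter; exact: cF.
  + by apply: cvg_at_left_filter; exact: cF.
- by move=> x _; rewrite derive1E; have [_ ->] := dF x.
Qed.

End integral_on_I.
Arguments measurable_I {R}.

(** * Convolution with an integrable function *)

Section convolution.
Variable R : realType.
Implicit Types (f g : R -> R) (x y : R).
Local Notation I := (I2pi R : set (lebesgueType R)).
Local Notation mu := (leb R).
Local Hint Resolve measurable_I : core.

Lemma is_derive_mul f g (x df dg : R) : is_derive x 1 f df ->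
  is_derive x 1 g dg -> is_derive x 1 (fun z => f z * g z) (df * g x + f x * dg).
Proof.
move=> df' dg'; apply: (is_derive_eq (is_deriveM df' dg')).
by rewrite addrC [df * _]mulrC.
Qed.

Lemma is_derive_add f g (x df dg : R) : is_derive x 1 f df ->
  is_derive x 1 g dg -> is_derive x 1 (fun z => f z + g z) (df + dg).
Proof. by move=> df' dg'; exact: is_deriveD. Qed.

Lemma is_derive_sub f g (x df dg : R) : is_derive x 1 f df ->
  is_derive x 1 g dg -> is_derive x 1 (fun z => f z - g z) (df - dg).
Proof. by move=> df' dg'; exact: is_deriveB. Qed.

Lemma is_derive_scale f (c x df : R) : is_derive x 1 f df ->
  is_derive x 1 (fun z => c * f z) (c * df).
Proof.
move=> df'; apply: (is_derive_eq (is_derive_mul (is_derive_cst c x 1) df')).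
by rewrite mul0r add0r.
Qed.

Lemma is_derive_shift p (x a d : R) : is_derive (x + a) 1 p d ->
  is_derive x 1 (fun z => p (z + a)) d.
Proof.
by move=> dp; apply: is_derive_eq; rewrite addr0 mulr1.
Qed.

Lemma is_derive_continuous f (x df : R) : is_derive x 1 f df -> {for x, continuous f}.
Proof.
by move=> [dfx _]; apply: differentiable_continuous; exact/derivable1_diffP.
Qed.

Definition conv (p f : R -> R) (x : R) : R := intI (fun y => p (x - y) * f y).
Definition has_bound (p : R -> R) : Prop := exists M : R, forall x, `|p x| <= M.

Lemma bounded_mul_integrable p f (M : R) : measI p ->
  (forall x, x \in I2pi R -> `|p x| <= M) ->
  mu.-integrable I (EFin \o f) -> mu.-integrable I (EFin \o (fun y => p y * f y)).
Proof.
move=> mp pM fi; have /integrableP[mf _] := fi.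
apply: le_integrable (integrableZl measurable_I M fi) => //.
  by apply/measurable_EFinP; apply: measurable_funM => //; exact/measurable_EFinP.
move=> x Ix /=; rewrite lee_fin !normrM; apply: ler_wpM2r => //.
by apply: le_trans (ler_norm _); apply: pM; rewrite inE.
Qed.

Lemma continuous_shift (p : R -> R) x : continuous p -> continuous (fun y => p (x - y)).
Proof.
move=> cp y; apply: (@continuous_comp _ _ _ (fun y => x - y) p); last exact: cp.
by apply: cvgB; [exact: cvg_cst|exact: cvg_id].
Qed.

Lemma conv_integrable p f x : continuous p -> has_bound p ->
  mu.-integrable I (EFin \o f) ->
  mu.-integrable I (EFin \o (fun y => p (x - y) * f y)).
Proof.
move=> cp [M pM]; apply: (@bounded_mul_integrable (fun y => p (x - y)) f M).
  by apply: continuous_measI; exact: continuous_shift.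
by move=> y _; exact: pM.
Qed.

Lemma conv_continuous p f : continuous p -> has_bound p ->
  mu.-integrable I (EFin \o f) -> continuous (conv p f).
Proof.
move=> cp [M pM] fi x.
have xI : x \in (`]x - 1, x + 1[ : set R) by rewrite inE /= in_itv /=; lra.
have gi : mu.-integrable I (EFin \o (fun y => M * `|f y|)).
  by apply: (integrableZl measurable_I M (integrable_abse fi)); exact: measurable_I.
apply: (@continuity_under_integral R _ (lebesgueType R) mu
  (fun x y => p (x - y) * f y) I measurable_I (x - 1) (x + 1) _ _ _ gi) => //.
- by move=> z _; apply: conv_integrable => //; exists M.
- apply: aeW => y _ z _ ; apply: cvgM; last exact: cvg_cst.
  apply: (@continuous_comp _ _ _ (fun z => z - y) p); last exact: cp.
  by apply: cvgB; [exact: cvg_id|exact: cvg_cst].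
- move=> z _; apply: aeW => y _; rewrite normrM; apply: ler_wpM2r => //.
Qed.

(** The kernel alone carries the regularity: f is merely integrable, and the
    differentiated integrand is dominated by a multiple of |f|. This is what
    makes the solutions of (Q) classical, although their right-hand sides are
    built from a measurable function. *)
Lemma conv_derive p q f x : continuous p -> has_bound p -> has_bound q ->
  (forall x, is_derive x 1 p (q x)) ->
  mu.-integrable I (EFin \o f) -> is_derive x 1 (conv p f) (conv q f x).
Proof.
move=> cp bp [M qM] dp fi.
have M0 : 0 <= M by apply: le_trans (qM 0).
have xI : (`]x - 1, x + 1[ : set R) x by rewrite /= in_itv /=; lra.
have gi : mu.-integrable I (EFin \o (fun y => M * `|f y|)).
  by apply: (integrableZl measurable_I M (integrable_abse fi)); exact: measurable_I.
have dF (z y : R) : is_derive z 1 (fun z => p (z - y) * f y) (q (z - y) * f y).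
  by apply: is_derive_eq; rewrite /GRing.scale /=; ring.
have dE z y : partial1of2 (fun z y => p (z - y) * f y) z y = q (z - y) * f y.
  by rewrite partial1of2E; have [_ ->] := dF z y.
have dcv : h^-1 *: (conv p f (h + x) - conv p f x) @[h --> 0^'] -->
    \int[mu]_(y in I) partial1of2 (fun z y => p (z - y) * f y) x y.
  apply: (@cvg_differentiation_under_integral R _ (lebesgueType R) mu
    (fun x y => p (x - y) * f y) I measurable_I x (x - 1) (x + 1) xI _ _
    (fun y => M * `|f y|) _ gi) => //.
  - by move=> z _; exact: conv_integrable.
  - by move=> y; rewrite mulr_ge0.
  - by move=> z y _ _; rewrite dE normrM; apply: ler_wpM2r.
have cE : \int[mu]_(y in I) partial1of2 (fun z y => p (z - y) * f y) x y = conv q f x.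
  by apply: eq_Rintegral => y _; rewrite dE.
rewrite cE in dcv; apply: DeriveDef.
  by apply/cvg_ex; exists (conv q f x); under eq_fun do rewrite scaler1.
by rewrite -derive1E; apply/cvg_lim.
Qed.

Lemma integral_patch g : mu.-integrable I (EFin \o g) ->
  (\int[mu]_x ((g \_ (I2pi R)) x)%:E)%E = (intI g)%:E.
Proof.
move=> gi; rewrite /intI /Rintegral fineK; last exact: integrable_fin_num.
rewrite [RHS]integral_mkcond; apply: eq_integral => x _.
by rewrite !patchE; case: ifP.
Qed.

(** The functions are extended by zero so as to integrate over the whole plane;
    |p| <= M leaves the product of two integrable functions as a bound. *)
Lemma conv_fubini p f c : continuous p -> has_bound p -> continuous c ->
  mu.-integrable I (EFin \o f) ->
  intI (fun x => conv p f x * c x) =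
  intI (fun y => f y * intI (fun x => p (x - y) * c x)).
Proof.
move=> cp bp cc fi; have [M pM] := bp.
have ci := continuous_integrable_I cc.
pose H (z : lebesgueType R * lebesgueType R) : \bar R :=
  (p (z.1 - z.2) * (c \_ (I2pi R)) z.1 * (f \_ (I2pi R)) z.2)%:E.
have mT g : mu.-integrable I (EFin \o g) ->
    measurable_fun setT ((g \_ (I2pi R)) : lebesgueType R -> R).
  move=> /integrableP[/measurable_EFinP mg _].
  by apply: (measurable_restrictT _ _).1 => //; exact: measurable_I.
have mH : measurable_fun setT H.
  apply/measurable_EFinP; apply: measurable_funM; last first.
    exact: measurableT_comp (mT _ fi) _.
  apply: measurable_funM; last exact: measurableT_comp (mT _ ci) _.
  apply: (measurableT_comp (continuous_measurable_fun cp)).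
  apply: measurable_funB.
    move=> _ A mA; apply: (@measurable_fst _ _ (lebesgueType R) (lebesgueType R)).
      exact: measurableT.
    exact: borel_lebesgue.
  move=> _ A mA; apply: (@measurable_snd _ _ (lebesgueType R) (lebesgueType R)).
    exact: measurableT.
  exact: borel_lebesgue.
have fI := integral_patch fi.
have abs_i g : mu.-integrable I (EFin \o g) ->
    mu.-integrable I (EFin \o (fun x => `|g x|)).
  by move=> gi; exact: (integrable_abse gi).
have patchM (g1 g2 : R -> R) x : g1 x * (g2 \_ (I2pi R)) x =
    ((fun x => g1 x * g2 x) \_ (I2pi R)) x.
  by rewrite !patchE; case: ifP => // _; rewrite (_ : point = 0)// mulr0.
have patchN (g : R -> R) x : `|(g \_ (I2pi R)) x| =
    ((fun x => `|g x|) \_ (I2pi R)) x.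
  by rewrite !patchE; case: ifP => // _; rewrite (_ : point = 0)// normr0.
have iH : (mu \x mu)%E.-integrable setT H.
  apply/integrable12ltyP => //.
  apply: (@le_lt_trans _ _ (\int[mu]_x
     (((fun x => M * intI (fun y => `|f y|) * `|c x|) \_ (I2pi R)) x)%:E)%E).
    apply: ge0_le_integral.
    - exact: measurableT.
    - by move=> x _; apply: integral_ge0 => y _.
    - apply: (@measurable_fun_fubini_tonelli_F _ _ _ _ _ mu (abse \o H)).
        exact: measurableT_comp.
      by move=> z; exact: abse_ge0.
    - apply/measurable_EFinP; apply: (mT (fun x => M * intI (fun y => `|f y|) * `|c x|)).
      exact: (integrableZl measurable_I _ (abs_i _ ci)).
    - move=> x _.
      have gi : mu.-integrable I (EFin \o (fun y => M * `|(c \_ (I2pi R)) x| * `|f y|)).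
        exact: (integrableZl measurable_I _ (abs_i _ fi)).
      have -> : ((fun x => M * intI (fun y => `|f y|) * `|c x|) \_ (I2pi R)) x =
          intI (fun y => M * `|(c \_ (I2pi R)) x| * `|f y|).
        rewrite intIZ; last exact: abs_i.
        by rewrite -patchM -patchN; ring.
      rewrite -(integral_patch gi).
      apply: ge0_le_integral.
      + exact: measurableT.
      + by move=> y _; exact: abse_ge0.
      + apply: measurableT_comp; first exact: abse_measurable.
        exact: measurableT_comp mH (pair1_measurable x).
      + by apply/measurable_EFinP; exact: (mT _ gi).
      + move=> y _; rewrite /H /= lee_fin -patchM -patchN !normrM.
        by rewrite ler_wpM2r// ler_wpM2r.
  rewrite [ltLHS]integral_patch ?ltry//.
  exact: (integrableZl measurable_I _ (abs_i _ ci)).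
have ti x : mu.-integrable I (EFin \o (fun y => (c \_ (I2pi R)) x * (p (x - y) * f y))).
  exact: (integrableZl measurable_I _ (conv_integrable x cp bp fi)).
have sy y : mu.-integrable I (EFin \o (fun x => p (x - y) * c x)).
  apply: (@bounded_mul_integrable (fun x => p (x - y)) c M) => //.
  apply: continuous_measI => x; apply: (@continuous_comp _ _ _ (fun x => x - y) p).
    by apply: cvgB; [exact: cvg_id|exact: cvg_cst].
  exact: cp.
have pcv : mu.-integrable I (EFin \o (fun x => conv p f x * c x)).
  apply: continuous_integrable_I => x; apply: cvgM; last exact: cc.
  exact: conv_continuous.
have pcg : mu.-integrable I (EFin \o (fun y => f y * intI (fun x => p (x - y) * c x))).
  have cpN : continuous (fun z : R => p (- z)).
    move=> z; apply: (@continuous_comp _ _ _ -%R p); last exact: cp.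
    exact: opp_continuous.
  have cg : continuous (fun y => intI (fun x => p (x - y) * c x)).
    have bN : has_bound (fun z => p (- z)) by exists M.
    rewrite (_ : (fun y => _) = conv (fun z => p (- z)) c).
      exact: conv_continuous.
    by apply/funext => y; apply: eq_intI => x _; rewrite opprB.
  have [N [_ gN]] := continuous_bounded_I cg.
  have := bounded_mul_integrable (continuous_measI cg) gN fi.
  by apply: eq_integrable => // y _ /=; rewrite mulrC.
have := Fubini iH.
rewrite (_ : (\int[_]_x \int[_]_y H (x, y) = (intI (fun x => conv p f x * c x))%:E)%E); last first.
  rewrite -integral_patch//; apply: eq_integral => x _.
  transitivity (intI (fun y => (c \_ (I2pi R)) x * (p (x - y) * f y)))%:E.
    rewrite -(integral_patch (ti x)); apply: eq_integral => y _.
    by rewrite /H /= -!patchM; congr EFin; ring.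
  rewrite intIZ; last exact: conv_integrable.
  by rewrite -patchM mulrC.
rewrite (_ : (\int[_]_y \int[_]_x H (x, y) =
    (intI (fun y => f y * intI (fun x => p (x - y) * c x)))%:E)%E); last first.
  rewrite -integral_patch//; apply: eq_integral => y _.
  transitivity (intI (fun x => (f \_ (I2pi R)) y * (p (x - y) * c x)))%:E.
    rewrite -(integral_patch (integrableZl measurable_I ((f \_ (I2pi R)) y) (sy y))); apply: eq_integral => x _.
    by rewrite /H /= -!patchM; congr EFin; ring.
  rewrite intIZ//.
  by rewrite !patchE; case: ifP => // _; rewrite (_ : point = 0)// mul0r.
by move=> -[].
Qed.

End convolution.

(** * Primitives and periodic functions *)

Section periodic.
Variable R : realType.
Implicit Types (p : R -> R) (x y : R).

(** Near a point x the oriented integral from 0 differs by a constant from the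
    integral from a point a below both 0 and x, to which the fundamental theorem
    of calculus applies. *)
Lemma primitive_exists p : continuous p ->
  exists P : R -> R, forall x, is_derive x 1 P (p x).
Proof.
move=> cp.
pose P x := if 0 <= x then (\int[@lebesgue_measure R]_(t in `]0, x]) p t)%R
            else - (\int[lebesgue_measure]_(t in `]x, 0]) p t)%R.
have ip a b : lebesgue_measure.-integrable `[a, b] (EFin \o p).
  apply: continuous_compact_integrable; first exact: segment_compact.
  exact: continuous_subspaceT.
pose Q a x := (\int[@lebesgue_measure R]_(t in [set` `[a, x]]) p t)%R.
have PQ a x : a < 0 -> a < x -> P x = Q a x - Q a 0.
  move=> a0 ax; rewrite /P; case: leP => x0.
    rewrite /Q -(Rintegral_itvB (ip a x)) ?bnd_simp//.
    by rewrite ltW.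
  rewrite /Q -(Rintegral_itvB (ip a 0)) ?bnd_simp ?opprB// ltW//.
exists P => x.
pose a : R := - `|x| - 1.
have ax : a < x by have := ler_norm (- x); rewrite normrN /a; lra.
have a0 : a < 0 by have := normr_ge0 x; rewrite /a; lra.
have [dQ Qx] := @continuous_FTC1_closed R p a x (x + 1) (ltr_pwDr ltr01 (lexx x)) (ip _ _) ax (cp x).
have dP : is_derive x 1 (fun x => Q a x - Q a 0) (p x).
  have dQx : is_derive x 1 (Q a) (p x) by apply: DeriveDef; [exact: dQ|rewrite -derive1E; exact: Qx].
  by apply: is_derive_eq; rewrite subr0.
apply: (near_eq_is_derive _ dP).
near=> z; rewrite -PQ//; near: z.
by apply: (cvgr_gt x) => //; exact: cvg_id.
Unshelve. all: by end_near. Qed.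

Lemma periodic_int p : (forall x, p (x + 2 * pi) = p x) ->
  forall (k : int) x, p (x + k%:~R * (2 * pi)) = p x.
Proof.
move=> pp.
have pn (n : nat) : forall x, p (x + n%:R * (2 * pi)) = p x.
  elim: n => [|n IH] x; first by rewrite mul0r addr0.
  by rewrite -natr1 mulrDl mul1r addrA pp IH.
case=> [n|n] x; first exact: pn.
by rewrite -[LHS](pn n.+1) NegzE mulrNz mulNr subrK.
Qed.

Lemma periodic_rep p : (forall x, p (x + 2 * pi) = p x) ->
  forall x, exists2 y, y \in I2pi R & p x = p y.
Proof.
move=> pp x; pose k := Num.floor (x / (2 * pi)).
exists (x + (- k)%:~R * (2 * pi)); last by rewrite periodic_int.
have := floor_le (x / (2 * pi)); have := floorD1_gt (x / (2 * pi)).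
rewrite intrD1 -/k ler_pdivlMr ?twopi_gt0// ltr_pdivrMr ?twopi_gt0// => h1 h2.
by rewrite in_I mulrNz mulNr subr_ge0 h2 /= lerBlDl; lra.
Qed.

Lemma periodic_has_bound p : continuous p -> (forall x, p (x + 2 * pi) = p x) -> has_bound p.
Proof.
move=> cp pp; have [M [_ pM]] := continuous_bounded_I cp.
by exists M => x; have [y yI ->] := periodic_rep pp x; exact: pM.
Qed.

(** As a function of z, the integral of p over the period starting at - z has
    derivative p (- z) - p (2 pi - z) = 0. *)
Lemma intI_shift p y : continuous p -> (forall x, p (x + 2 * pi) = p x) ->
  intI (fun x => p (x - y)) = intI p.
Proof.
move=> cp pp; have [P dP] := primitive_exists cp.
have E z : intI (fun x => p (x - z)) = P (2 * pi - z) - P (- z).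
  have cpz : continuous (fun x => p (x - z)).
    move=> x; apply: (@continuous_comp _ _ _ (fun x => x - z) p); last exact: cp.
    by apply: cvgB; [exact: cvg_id|exact: cvg_cst].
  have dPz x : is_derive x 1 (fun x => P (x - z)) (p (x - z)).
    exact: is_derive_shift (dP _).
  by rewrite (intI_FTC cpz dPz) sub0r.
have -> : intI p = intI (fun x => p (x - 0)).
  by apply: eq_intI => x _; rewrite subr0.
rewrite !E.
apply: (@is_derive_0_is_cst R (fun z => P (2 * pi - z) - P (- z))) => z.
have d1 := dP (2 * pi - z); have d2 := dP (- z).
apply: is_derive_eq.
rewrite (_ : p (2 * pi - z) = p (- z)); last by rewrite addrC pp.
by ring.
Qed.

Lemma intI_opp p : continuous p -> (forall x, p (x + 2 * pi) = p x) ->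
  intI (fun x => p (- x)) = intI p.
Proof.
move=> cp pp; have [P dP] := primitive_exists cp.
have cpN : continuous (fun x => p (- x)).
  move=> z; apply: (@continuous_comp _ _ _ -%R p); last exact: cp.
  exact: opp_continuous.
have cpz : continuous (fun x => p (x - 2 * pi)).
  move=> x; apply: (@continuous_comp _ _ _ (fun x => x - 2 * pi) p); last exact: cp.
  by apply: cvgB; [exact: cvg_id|exact: cvg_cst].
rewrite -(intI_shift (2 * pi) cp pp).
have dPz x : is_derive x 1 (fun x => P (x - 2 * pi)) (p (x - 2 * pi)).
  exact: is_derive_shift (dP _).
rewrite (intI_FTC cpz dPz).
have dPN x : is_derive x 1 (fun x => - P (- x)) (p (- x)).
  have d := dP (- x); apply: is_derive_eq.
  by rewrite mulrN1 opprK.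
by rewrite (intI_FTC cpN dPN) oppr0 subrr sub0r opprK addrC.
Qed.

End periodic.

(** * Fourier coefficients and the Bessel inequality *)

Section fourier_series.
Variable R : realType.
Implicit Types (f g p q : R -> R) (x : R) (n m : nat).

Lemma intI_primitive F f (v : R) : continuous f ->
  (forall x, is_derive x 1 F (f x)) -> F (2 * pi) - F 0 = v -> intI f = v.
Proof. by move=> cf dF <-; exact: intI_FTC. Qed.

Definition cosn (n : nat) (x : R) : R := cos (n%:R * x).
Definition sinn (n : nat) (x : R) : R := sin (n%:R * x).
Definition fcos f (n : nat) : R := intI (fun x => f x * cosn n x).
Definition fsin f (n : nat) : R := intI (fun x => f x * sinn n x).

Lemma fsin0 f : fsin f 0 = 0.
Proof.
rewrite /fsin (@eq_intI _ _ (fun=> 0)) ?intI_cst ?mul0r// => x _.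
by rewrite /sinn mul0r sin0 mulr0.
Qed.

Lemma fcos0 f : fcos f 0 = intI f.
Proof. by apply: eq_intI => x _; rewrite /cosn mul0r cos0 mulr1. Qed.

Lemma is_derive_cosn n x : is_derive x 1 (cosn n) (- n%:R * sinn n x).
Proof. by apply: is_derive_eq; rewrite /GRing.scale /= /sinn; ring. Qed.

Lemma is_derive_sinn n x : is_derive x 1 (sinn n) (n%:R * cosn n x).
Proof. by apply: is_derive_eq; rewrite /GRing.scale /= /cosn; ring. Qed.

Lemma continuous_cosn n : continuous (cosn n).
Proof. by move=> x; exact: is_derive_continuous (is_derive_cosn n x). Qed.

Lemma continuous_sinn n : continuous (sinn n).
Proof. by move=> x; exact: is_derive_continuous (is_derive_sinn n x). Qed.

Lemma cosn_periodic n x : cosn n (x + 2 * pi) = cosn n x.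
Proof.
rewrite /cosn -[RHS](periodicn (@cosD2pi R) n); congr cos.
by rewrite mulrDr; congr (_ + _); rewrite mulr_natl [2 * _]mulr_natl.
Qed.

Lemma sinn_periodic n x : sinn n (x + 2 * pi) = sinn n x.
Proof.
rewrite /sinn -[RHS](periodicn (@sinD2pi R) n); congr sin.
by rewrite mulrDr; congr (_ + _); rewrite mulr_natl [2 * _]mulr_natl.
Qed.

Lemma cosn0 n : cosn n 0 = 1. Proof. by rewrite /cosn mulr0 cos0. Qed.

Lemma sinn0 n : sinn n 0 = 0. Proof. by rewrite /sinn mulr0 sin0. Qed.

Lemma cosn2pi n : cosn n (2 * pi) = 1.
Proof. by rewrite -[2 * pi]add0r cosn_periodic cosn0. Qed.

Lemma sinn2pi n : sinn n (2 * pi) = 0.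
Proof. by rewrite -[2 * pi]add0r sinn_periodic sinn0. Qed.

Lemma contM f g : continuous f -> continuous g -> continuous (fun x => f x * g x).
Proof. by move=> cf cg x; apply: cvgM; [exact: cf|exact: cg]. Qed.

Lemma contD f g : continuous f -> continuous g -> continuous (fun x => f x + g x).
Proof. by move=> cf cg x; apply: cvgD; [exact: cf|exact: cg]. Qed.

Lemma contZ c f : continuous f -> continuous (fun x => c * f x).
Proof. by move=> cf; apply: contM => // x; exact: cvg_cst. Qed.

Lemma continuous_cc n m : continuous (fun x => cosn n x * cosn m x).
Proof. by apply: contM; exact: continuous_cosn. Qed.

Lemma continuous_ss n m : continuous (fun x => sinn n x * sinn m x).
Proof. by apply: contM; exact: continuous_sinn. Qed.

Lemma continuous_sc n m : continuous (fun x => sinn n x * cosn m x).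
Proof. by apply: contM; [exact: continuous_sinn|exact: continuous_cosn]. Qed.

Lemma natr_sqr_neq n m : n != m -> (n%:R ^+ 2 - m%:R ^+ 2 != 0 :> R).
Proof.
move=> nm; rewrite subr_sqr mulf_neq0//.
  by rewrite subr_eq0 eqr_nat.
by rewrite -natrD pnatr_eq0 addn_eq0; case: n m nm => [|n] [|m].
Qed.

(** The orthogonality relations are read off explicit primitives: n^2 - m^2
    times the integrand is the derivative of a function with equal values at 0
    and 2 pi. *)
Lemma int_cc n m : n != m -> intI (fun x => cosn n x * cosn m x) = 0.
Proof.
move=> /natr_sqr_neq nm; apply: (mulfI nm); rewrite mulr0.
rewrite -intIZ; last by apply: continuous_integrable_I; exact: continuous_cc.
have cZ := contZ (c := n%:R ^+ 2 - m%:R ^+ 2) (@continuous_cc n m).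
apply: (@intI_primitive (fun x => n%:R * (sinn n x * cosn m x) - m%:R * (sinn m x * cosn n x)) _ _ cZ); last first.
  by rewrite /= !(sinn2pi, sinn0) !(mul0r, mulr0) subrr.
move=> x; have d1 := is_derive_cosn n x; have d2 := is_derive_cosn m x.
have d3 := is_derive_sinn n x; have d4 := is_derive_sinn m x.
by apply: is_derive_eq; rewrite /GRing.scale /=; ring.
Qed.

Lemma int_ss n m : n != m -> intI (fun x => sinn n x * sinn m x) = 0.
Proof.
move=> /natr_sqr_neq nm; apply: (mulfI nm); rewrite mulr0.
rewrite -intIZ; last by apply: continuous_integrable_I; exact: continuous_ss.
have cZ := contZ (c := n%:R ^+ 2 - m%:R ^+ 2) (@continuous_ss n m).
apply: (@intI_primitive (fun x => m%:R * (sinn n x * cosn m x) - n%:R * (sinn m x * cosn n x)) _ _ cZ); last first.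
  by rewrite /= !(sinn2pi, sinn0) !(mul0r, mulr0) subrr.
move=> x; have d1 := is_derive_cosn n x; have d2 := is_derive_cosn m x.
have d3 := is_derive_sinn n x; have d4 := is_derive_sinn m x.
by apply: is_derive_eq; rewrite /GRing.scale /=; ring.
Qed.

Lemma int_sc n m : intI (fun x => sinn n x * cosn m x) = 0.
Proof.
have csc := @continuous_sc n m.
have [<-|/natr_sqr_neq nm] := eqVneq n m.
  have [->|n0] := eqVneq n 0%N.
    transitivity (intI (fun=> 0 : R)); last by rewrite intI_cst mul0r.
    by apply: eq_intI => x _; rewrite /sinn mul0r sin0 mul0r.
  have n0' : (2 * n%:R != 0 :> R) by rewrite -natrM pnatr_eq0 muln_eq0.
  apply: (mulfI n0'); rewrite mulr0 -intIZ; last by apply: continuous_integrable_I; exact: continuous_sc.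
  have cZ := contZ (c := 2 * n%:R) (@continuous_sc n n).
  apply: (@intI_primitive (fun x => sinn n x * sinn n x) _ _ cZ); last first.
    by rewrite /= !(sinn2pi, sinn0) subrr.
  move=> x; have d3 := is_derive_sinn n x.
  by apply: is_derive_eq; rewrite /GRing.scale /=; ring.
apply: (mulfI nm); rewrite mulr0 -intIZ; last by apply: continuous_integrable_I.
have cZ := contZ (c := n%:R ^+ 2 - m%:R ^+ 2) csc.
apply: (@intI_primitive (fun x => - (n%:R * (cosn n x * cosn m x) + m%:R * (sinn n x * sinn m x))) _ _ cZ); last first.
  by rewrite /= !(sinn2pi, sinn0, cosn2pi, cosn0) subrr.
move=> x; have d1 := is_derive_cosn n x; have d2 := is_derive_cosn m x.
have d3 := is_derive_sinn n x; have d4 := is_derive_sinn m x.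
by apply: is_derive_eq; rewrite /GRing.scale /=; ring.
Qed.

Lemma int_cc_eq n : (0 < n)%N -> intI (fun x => cosn n x * cosn n x) = pi.
Proof.
move=> n0; have n0' : (n%:R != 0 :> R) by rewrite pnatr_eq0 -lt0n.
apply: (@intI_primitive (fun x => x / 2 + (2 * n%:R)^-1 * (sinn n x * cosn n x)) _ _ (@continuous_cc n n)); last first.
  by rewrite /= !(sinn2pi, sinn0); field.
move=> x; have d1 := is_derive_cosn n x.
have d3 := is_derive_sinn n x.
have e : cosn n x * cosn n x + sinn n x * sinn n x = 1 by rewrite -!expr2 cos2Dsin2.
apply: is_derive_eq; rewrite /GRing.scale /=.
rewrite (_ : sinn n x * (- n%:R * sinn n x) = - n%:R * (1 - cosn n x * cosn n x)).
  by field; rewrite n0' /=.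
by rewrite -e; ring.
Qed.

Lemma int_ss_eq n : (0 < n)%N -> intI (fun x => sinn n x * sinn n x) = pi.
Proof.
move=> n0.
have e : intI (fun x => cosn n x * cosn n x + sinn n x * sinn n x) = 2 * pi.
  rewrite -[RHS]mul1r -intI_cst; apply: eq_intI => x _.
  by rewrite -!expr2 cos2Dsin2.
rewrite intID in e; last 2 first.
- by apply: continuous_integrable_I; exact: continuous_cc.
- by apply: continuous_integrable_I; exact: continuous_ss.
by rewrite int_cc_eq// in e; lra.
Qed.

(** One Gram-Schmidt step: removing from r its component along e lowers the
    integral of the square by the expected amount and leaves unchanged the
    coefficients against functions orthogonal to e. *)
Lemma project_out (r e : R -> R) (c : R) : sqI r -> continuous e -> 0 < c ->
  intI (fun x => e x * e x) = c ->
  exists r', [/\ sqI r',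
    intI (fun x => r' x ^+ 2) = intI (fun x => r x ^+ 2) - intI (fun x => r x * e x) ^+ 2 / c &
    forall g, continuous g -> intI (fun x => e x * g x) = 0 ->
      intI (fun x => r' x * g x) = intI (fun x => r x * g x)].
Proof.
move=> sr ce c0 ee; set a := intI (fun x => r x * e x).
have se := continuous_sqI ce.
have er := sqI_mul sr se; have [_ ir2] := sr; have iee := sqI_mul se se.
exists (fun x => r x - (a / c) * e x); split.
- exact: sqIB sr (sqIZ _ se).
- rewrite (@eq_intI _ _ (fun x => (r x ^+ 2 - (2 * a / c) * (r x * e x)) + (a / c) ^+ 2 * (e x * e x))); last first.
    by move=> x _; ring.
  rewrite intID ?intIB ?intIZ//.
  + by rewrite ee -/a; field; rewrite gt_eqF.
  + exact: (integrableZl measurable_I _ er).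
  + exact: (integrableB measurable_I ir2 (integrableZl measurable_I _ er)).
  + exact: (integrableZl measurable_I _ iee).
- move=> g cg eg; have sg := continuous_sqI cg.
  have irg := sqI_mul sr sg; have ieg := sqI_mul se sg.
  rewrite (@eq_intI _ _ (fun x => r x * g x - (a / c) * (e x * g x))); last first.
    by move=> x _; ring.
  rewrite intIB ?intIZ// ?eg ?mulr0 ?subr0//.
  exact: (integrableZl measurable_I _ ieg).
Qed.

(** Up to the factor 2 pi, the squared modulus of the complex Fourier
    coefficients of index n and - n. *)
Definition energy f n : R := fcos f n ^+ 2 + fsin f n ^+ 2.

Lemma eq_energy f g n : (forall x, x \in I2pi R -> f x = g x) -> energy f n = energy g n.
Proof.
by move=> fg; rewrite /energy /fcos /fsin; congr (_ ^+ 2 + _ ^+ 2);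
  apply: eq_intI => x xI; rewrite fg.
Qed.

Lemma energy_ge0 f n : 0 <= energy f n.
Proof. by rewrite addr_ge0// sqr_ge0. Qed.

(** Partial sums of the series in the Parseval identity: index 0 has weight 1 /
    (2 pi) and the others 1 / pi, as the integral of cos^2 (n x) is 2 pi for n =
    0 and pi for n > 0. *)
Definition parseval_sum (c : nat -> R) N : R := c 0%N / (2 * pi) + (\sum_(1 <= n < N.+1) c n) / pi.

(** The residual of the partial Fourier sum. The coefficients above N are kept
    in the statement because the induction removes them next. *)
Lemma fourier_residual f N : sqI f -> exists r, [/\ sqI r,
  intI (fun x => r x ^+ 2) = intI (fun x => f x ^+ 2) - parseval_sum (energy f) N,
  forall m, (N < m)%N -> fcos r m = fcos f m &
  forall m, (N < m)%N -> fsin r m = fsin f m].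
Proof.
move=> sf; elim: N => [|N [r [sr r2 rc rs]]].
  have c00 : intI (fun x => cosn 0 x * cosn 0 x) = 2 * pi.
    rewrite -[RHS]mul1r -intI_cst; apply: eq_intI => x _.
    by rewrite /cosn mul0r cos0 mulr1.
  have [r [sr r2 rg]] := project_out sf (@continuous_cosn 0) (twopi_gt0 R) c00.
  exists r; split => //.
  - by rewrite r2 /parseval_sum big_geq// mul0r addr0 /energy fsin0 expr0n addr0.
  - move=> m m0; apply: rg; first exact: continuous_cosn.
    by apply: int_cc; rewrite eq_sym -lt0n.
  - move=> m m0; apply: rg; first exact: continuous_sinn.
    rewrite -[RHS](int_sc m 0); apply: eq_intI => x _; exact: mulrC.
have [q [sq q2 qg]] := project_out sr (@continuous_cosn N.+1) (pi_gt0 R) (int_cc_eq (ltn0Sn N)).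
have [p [sp p2 pg]] := project_out sq (@continuous_sinn N.+1) (pi_gt0 R) (int_ss_eq (ltn0Sn N)).
have qs m : intI (fun x => q x * sinn m x) = intI (fun x => r x * sinn m x).
  apply: qg; first exact: continuous_sinn.
  by rewrite -[RHS](int_sc m N.+1); apply: eq_intI => x _; exact: mulrC.
have pc m : intI (fun x => p x * cosn m x) = intI (fun x => q x * cosn m x).
  apply: pg; first exact: continuous_cosn.
  exact: int_sc.
exists p; split => //.
- rewrite p2 q2 r2 qs -/(fsin r N.+1) -/(fcos r N.+1) rc// rs//.
  rewrite /parseval_sum [in RHS]big_nat_recr//= /energy; ring.
- move=> m Nm; rewrite -rc ?(ltn_trans _ Nm)// /fcos pc qg//; first exact: continuous_cosn.
  by apply: int_cc; rewrite ltn_eqF.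
- move=> m Nm; rewrite -rs ?(ltn_trans _ Nm)// /fsin -qs pg//; first exact: continuous_sinn.
  by apply: int_ss; rewrite ltn_eqF.
Qed.

Lemma Bessel f N : sqI f -> parseval_sum (energy f) N <= intI (fun x => f x ^+ 2).
Proof.
move=> sf; have [r [_ r2 _ _]] := fourier_residual N sf.
by rewrite -subr_ge0 -r2; apply: intI_ge0 => x _; exact: sqr_ge0.
Qed.

(** The Riemann-Lebesgue lemma for square-integrable functions: the energies are
    summable. *)
Lemma energy_cvg0 f : sqI f -> energy f n @[n --> \oo] --> 0.
Proof.
move=> sf.
have pi0 := pi_gt0 R.
have cs : cvgn (series (energy f)).
  apply: nondecreasing_is_cvgn.
    by apply: nondecreasing_series => i _ _; exact: energy_ge0.
  exists (intI (fun x => f x ^+ 2) * (2 * pi)) => _ [n _ <-].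
  apply: le_trans (_ : series (energy f) n.+1 <= _).
    by rewrite /series /= big_nat_recr//= lerDl energy_ge0.
  rewrite -ler_pdivrMr ?twopi_gt0//; apply: le_trans (Bessel n sf).
  rewrite /parseval_sum /series /= big_ltn// mulrDl lerD2l.
  rewrite ler_wpM2l ?sumr_ge0// => [i _|]; first exact: energy_ge0.
  by rewrite lef_pV2 ?posrE ?mulr_gt0//; lra.
exact: cvg_series_cvg_0.
Qed.

End fourier_series.

(** * Convergence of Fourier series at a point *)

Section dirichlet.
Variable R : realType.
Implicit Types (f p q : R -> R) (x : R) (n : nat).
Local Notation mu := (leb R).

(** A lower bound on sin (x / 2) which turns the Lipschitz bound on p into a
    bound on (p x - p 0) / sin (x / 2). *)
Lemma half_le_sin (t : R) : 0 <= t <= pi / 2 -> t / 2 <= sin t.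
Proof.
move=> /andP[t0 t1].
have sc (s : R) : 0 <= s <= pi / 2 -> s * cos s <= sin s.
  move=> /andP[]; rewrite le_eqVlt => /predU1P[<-|s0] s1; first by rewrite mul0r sin0.
  have cs : {within `[0, s], continuous (@sin R)}.
    by apply: continuous_subspaceT; exact: continuous_sin.
  have [c c1] := @MVT _ (@sin R) (@cos R) 0 s s0 (fun x _ => is_derive_sin x) cs.
  rewrite sin0 !subr0 => ->; rewrite mulrC ler_wpM2r ?ltW//.
  move: c1; rewrite in_itv /= => /andP[c0 c1].
  have pi0 := pi_gt0 R.
  by rewrite ltr_cos ?in_itv /=; lra.
have pi0 := pi_gt0 R.
have tE : t = t / 2 + t / 2 by field.
have st : sin t = 2 * (sin (t / 2) * cos (t / 2)) by rewrite {1}tE sinD; ring.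
have ct : cos t = 2 * cos (t / 2) ^+ 2 - 1.
  by rewrite {1}tE cosD; have := cos2Dsin2 (t / 2); rewrite -!expr2; lra.
have c0 : 0 <= cos t by apply: cos_ge0_pihalf; lra.
have c2 : 0 <= cos (t / 2) by apply: cos_ge0_pihalf; lra.
have h : t / 2 * cos (t / 2) <= sin (t / 2) by apply: sc; lra.
rewrite st; move: ct h c0 c2; set c := cos (t / 2); set s := sin (t / 2) => ct h c0 c2.
have h2 := ler_wpM2r c2 h.
nra.
Qed.

(** The closed form of the Dirichlet kernel is multiplied by sin (x / 2), to
    remain valid where the sine vanishes. *)
Lemma Dirichlet_kernel N (x : R) :
  sin (x / 2) * (1 + 2 * \sum_(1 <= n < N.+1) cosn n x) =
  sin (x / 2) * cosn N x + cos (x / 2) * sinn N x.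
Proof.
elim: N => [|N IH].
  by rewrite big_geq// mulr0 addr0 /cosn /sinn mul0r sin0 cos0 mulr0 addr0.
rewrite big_nat_recr//=.
rewrite (_ : 1 + _ = (1 + 2 * \sum_(1 <= n < N.+1) cosn n x) + 2 * cosn N.+1 x); last by ring.
have NE : N.+1%:R = N%:R + 1 :> R by rewrite natr1.
rewrite mulrDr IH /cosn /sinn NE [(_ + 1) * x]mulrDl mul1r.
set t := x / 2; have -> : N%:R * x + x = N%:R * x + (t + t) by rewrite /t; field.
rewrite !(cosD, sinD).
set c := cos t; set s := sin t; set C := cos _; set S := sin _.
have cs : 1 - c ^+ 2 - s ^+ 2 = 0 by rewrite /s /c sin2cos2; ring.
apply/eqP; rewrite -subr_eq0; apply/eqP.
transitivity ((s * C + c * S) * (1 - c ^+ 2 - s ^+ 2)); last by rewrite cs mulr0.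
by ring.
Qed.

(** The partial Fourier sums of a Lipschitz function p converge to p 0 at 0. By
    the closed form of the Dirichlet kernel, 2 pi times their difference with p
    0 is a sine coefficient of q = (p - p 0) cos (x / 2) / sin (x / 2) plus a
    cosine coefficient of p - p 0. As q is bounded, both coefficients tend to 0. *)
Lemma Dirichlet_at0 p (L K : R) : continuous p ->
  (forall x, p (x + 2 * pi) = p x) -> (forall x, `|p x - p 0| <= L * `|x|) ->
  (forall N, parseval_sum (fcos p) N <= K) -> p 0 <= K.
Proof.
move=> cp pp pL pK.
have pi0 := pi_gt0 R.
have pin0 : pi != 0 :> R by rewrite gt_eqF.
have L0 : 0 <= L by have := pL 1; rewrite normr1 mulr1; exact: le_trans.
have cd : continuous (fun x => p x - p 0).
  by move=> x; apply: cvgB; [exact: cp|exact: cvg_cst].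
have dsin x : x \in I2pi R -> `|p x - p 0| <= 4 * L * sin (x / 2).
  rewrite in_I => /andP[x0 x1]; have [xpi|xpi] := leP x pi.
    apply: le_trans (pL x) _; rewrite ger0_norm//.
    have := @half_le_sin (x / 2); nra.
  have -> : p x = p (x - 2 * pi) by rewrite -[RHS]pp subrK.
  apply: le_trans (pL _) _; rewrite ler0_norm; last lra.
  have := @half_le_sin (pi - x / 2).
  have -> : sin (pi - x / 2) = sin (x / 2).
    by rewrite addrC sinDpi sinN opprK.
  have : x - 2 * pi <= 0 by lra.
  nra.
pose q x := (p x - p 0) * cos (x / 2) / sin (x / 2).
have mq : measI q.
  apply: borel_measI; apply: (@measurable_fun_itv_cc _ _ _ false true).
  apply: open_continuous_measurable_fun; first exact: itv_open.
  move=> x; rewrite inE /= in_itv /= => x0.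
  apply: cvgM; last first.
    apply: cvgV.
      by rewrite gt_eqF// sin_gt0_pi//; lra.
    apply: (@continuous_comp _ _ _ (fun x => x / 2) sin); last exact: continuous_sin.
    by apply: cvgM; [exact: cvg_id|exact: cvg_cst].
  apply: cvgM; first exact: cd.
  apply: (@continuous_comp _ _ _ (fun x => x / 2) cos); last exact: continuous_cos.
  by apply: cvgM; [exact: cvg_id|exact: cvg_cst].
have sin0 x : x \in I2pi R -> 0 <= sin (x / 2).
  by rewrite in_I => x0; apply: sin_ge0_pi; lra.
have sq : sqI q.
  apply: (@bounded_sqI _ _ (4 * L)) => // x xI.
  rewrite /q normrM normfV; have [->|s0] := eqVneq (sin (x / 2)) 0.
    by rewrite normr0 invr0 mulr0 mulr_ge0.
  rewrite (ger0_norm (sin0 x xI)) ler_pdivrMr ?lt_def ?s0 ?sin0//.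
  rewrite normrM; apply: le_trans (dsin x xI).
  by rewrite -[leRHS]mulr1 ler_wpM2l// ler_norml cos_geN1 cos_le1.
have sd := continuous_sqI cd.
have qE N x : x \in I2pi R ->
    (p x - p 0) * (1 + 2 * \sum_(1 <= n < N.+1) cosn n x) =
    q x * sinn N x + (p x - p 0) * cosn N x.
  move=> xI; have [s0|s0] := eqVneq (sin (x / 2)) 0.
    have -> : p x - p 0 = 0.
      by apply/eqP; rewrite -normr_le0; have := dsin x xI; rewrite s0 mulr0.
    by rewrite /q s0 invr0; ring.
  apply: (mulfI s0); rewrite mulrCA Dirichlet_kernel /q; field.
  by [].
have pI := continuous_sqI cp.
have E N : 2 * pi * parseval_sum (fcos p) N - 2 * pi * p 0 = fsin q N + fcos (fun x => p x - p 0) N.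
  rewrite [in RHS]/fsin [in RHS]/fcos -intID; last 2 first.
  - exact: (sqI_mul sq (continuous_sqI (@continuous_sinn R N))).
  - exact: (sqI_mul sd (continuous_sqI (@continuous_cosn R N))).
  rewrite -(eq_intI (qE N)).
  have dn n : intI (fun x => (p x - p 0) * cosn n x) =
      fcos p n - p 0 * intI (fun x => cosn n x * cosn 0 x).
    rewrite -intIZ; last by apply: continuous_integrable_I; exact: continuous_cc.
    rewrite -intIB; last 2 first.
    - exact: (sqI_mul pI (continuous_sqI (@continuous_cosn R n))).
    - by apply: continuous_integrable_I; apply: contZ; exact: continuous_cc.
    by apply: eq_intI => x _; rewrite /(cosn 0) mul0r cos0; ring.
  elim: N => [|N IH].
    transitivity (intI (fun x => (p x - p 0) * cosn 0 x)).
      rewrite dn /parseval_sum big_geq// mul0r addr0.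
      have -> : intI (fun x => cosn 0 x * cosn 0 x) = 2 * pi.
        rewrite -[RHS]mul1r -intI_cst; apply: eq_intI => x _.
        by rewrite /cosn mul0r cos0 mulr1.
      by move: pin0; move: (pi : R) => P P0; field; rewrite ?P0.
    by apply: eq_intI => x _; rewrite big_geq// mulr0 addr0 /cosn mul0r cos0.
  have si n : mu.-integrable (I2pi R) (EFin \o (fun x => (p x - p 0) * cosn n x)).
    exact: (sqI_mul sd (continuous_sqI (@continuous_cosn R n))).
  transitivity (intI (fun x => (p x - p 0) * (1 + 2 * \sum_(1 <= n < N.+1) cosn n x)) +
     2 * intI (fun x => (p x - p 0) * cosn N.+1 x)).
    rewrite -IH dn int_cc// mulr0 subr0 /parseval_sum big_nat_recr//=.
    by move: pin0; move: (pi : R) => P P0; field; rewrite ?P0.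
  rewrite -intIZ; last exact: si.
  rewrite -intID; last 2 first.
  - have := integrableD measurable_I (sqI_mul sq (continuous_sqI (@continuous_sinn R N))) (si N).
    apply: eq_integrable; first exact: measurable_I.
    by move=> x xI /=; rewrite qE// EFinD.
  - exact: (integrableZl measurable_I _ (si N.+1)).
  by apply: eq_intI => x _; rewrite [in RHS]big_nat_recr//=; ring.
apply/ler_addgt0Pr => e e0.
have e20 : 0 < e ^+ 2 by rewrite exprn_gt0.
have /cvgrPdist_le /(_ _ e20) [N1 _ h1] := energy_cvg0 sq.
have /cvgrPdist_le /(_ _ e20) [N2 _ h2] := energy_cvg0 sd.
pose N := maxn N1 N2.
have small f : `|0 - energy f N| <= e ^+ 2 -> `|fcos f N| <= e /\ `|fsin f N| <= e.
  rewrite sub0r normrN ger0_norm ?energy_ge0// /energy => h.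
  by split; rewrite -ler_sqr ?nnegrE ?normr_ge0 ?(ltW e0)// real_normK ?num_real//;
    apply: le_trans h; rewrite ?lerDl ?lerDr sqr_ge0.
have [_ s1] := small q (h1 N (leq_maxl _ _)).
have [s2 _] := small _ (h2 N (leq_maxr _ _)).
have EN := E N; have KN := pK N.
have pi1 := pi_ge2 R.
move: s1 s2; rewrite !ler_norml => /andP[s1 s1'] /andP[s2 s2'].
have : 2 * pi * (p 0 - parseval_sum (fcos p) N) <= 2 * e by lra.
nra.
Qed.

End dirichlet.

(** * Fourier coefficients of convolutions *)

Section convolution_fourier.
Variable R : realType.
Implicit Types (f p u v : R -> R) (x y : R) (n m : nat).
Local Notation I := (I2pi R : set (lebesgueType R)).
Local Notation mu := (leb R).
Local Hint Resolve measurable_I : core.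

(** Translating a periodic function by y rotates its n-th pair of coefficients
    by the angle n y. *)
Lemma fourier_translate p f n (y : R) : continuous p -> (forall x, p (x + 2 * pi) = p x) ->
  intI (fun x => p (x - y) * cosn n x) = fcos p n * cosn n y - fsin p n * sinn n y /\
  intI (fun x => p (x - y) * sinn n x) = fsin p n * cosn n y + fcos p n * sinn n y.
Proof.
move=> cp pp; have sp := continuous_sqI cp.
have sc := sqI_mul sp (continuous_sqI (@continuous_cosn R n)).
have ss := sqI_mul sp (continuous_sqI (@continuous_sinn R n)).
have cN : cosn n (- y) = cosn n y by rewrite /cosn mulrN cosN.
have sN : sinn n (- y) = - sinn n y by rewrite /sinn mulrN sinN.
have ca x : cosn n (x + y) = cosn n x * cosn n y - sinn n x * sinn n y.
  by rewrite /cosn mulrDr cosD.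
have sa x : sinn n (x + y) = sinn n x * cosn n y + cosn n x * sinn n y.
  by rewrite /sinn mulrDr sinD.
have cshift (c : R -> R) : continuous c -> continuous (fun x => p x * c (x + y)).
  move=> cc; apply: contM => // x.
  apply: (@continuous_comp _ _ _ (fun x => x + y) c); last exact: cc.
  by apply: cvgD; [exact: cvg_id|exact: cvg_cst].
have per (c : R -> R) : (forall x, c (x + 2 * pi) = c x) ->
    forall x, p (x + 2 * pi) * c (x + 2 * pi + y) = p x * c (x + y).
  by move=> cper x; rewrite pp addrAC cper.
split.
  transitivity (intI (fun x => p x * cosn n (x + y))).
    rewrite -[RHS](intI_shift y (cshift _ (@continuous_cosn R n)) (per _ (@cosn_periodic R n))).
    by apply: eq_intI => x _ /=; rewrite subrK.
  transitivity (intI (fun x => cosn n y * (p x * cosn n x) - sinn n y * (p x * sinn n x))).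
    by apply: eq_intI => x _; rewrite ca; ring.
  rewrite intIB ?intIZ//; first by rewrite /fcos /fsin; ring.
    exact: (integrableZl measurable_I _ sc).
  exact: (integrableZl measurable_I _ ss).
transitivity (intI (fun x => p x * sinn n (x + y))).
  rewrite -[RHS](intI_shift y (cshift _ (@continuous_sinn R n)) (per _ (@sinn_periodic R n))).
  by apply: eq_intI => x _ /=; rewrite subrK.
transitivity (intI (fun x => cosn n y * (p x * sinn n x) + sinn n y * (p x * cosn n x))).
  by apply: eq_intI => x _; rewrite sa; ring.
rewrite intID ?intIZ//; first by rewrite /fcos /fsin; ring.
  exact: (integrableZl measurable_I _ ss).
exact: (integrableZl measurable_I _ sc).
Qed.

(** With the pairs (fcos, fsin) read as complex numbers fcos + i fsin,
    convolution becomes multiplication. *)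
Lemma fourier_conv p f n : continuous p -> (forall x, p (x + 2 * pi) = p x) ->
  sqI f ->
  fcos (conv p f) n = fcos p n * fcos f n - fsin p n * fsin f n /\
  fsin (conv p f) n = fsin p n * fcos f n + fcos p n * fsin f n.
Proof.
move=> cp pp sf; have bp := periodic_has_bound cp pp.
have fi := sqI_integrable sf.
have sc := sqI_mul sf (continuous_sqI (@continuous_cosn R n)).
have ss := sqI_mul sf (continuous_sqI (@continuous_sinn R n)).
split.
  rewrite {1}/fcos (conv_fubini cp bp (@continuous_cosn R n) fi).
  transitivity (intI (fun y => fcos p n * (f y * cosn n y) - fsin p n * (f y * sinn n y))).
    apply: eq_intI => y _; have [-> _] := @fourier_translate p f n y cp pp; ring.
  rewrite intIB ?intIZ//.
    exact: (integrableZl measurable_I _ sc).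
  exact: (integrableZl measurable_I _ ss).
rewrite {1}/fsin (conv_fubini cp bp (@continuous_sinn R n) fi).
transitivity (intI (fun y => fsin p n * (f y * cosn n y) + fcos p n * (f y * sinn n y))).
  apply: eq_intI => y _; have [_ ->] := @fourier_translate p f n y cp pp; ring.
rewrite intID ?intIZ//.
  exact: (integrableZl measurable_I _ sc).
exact: (integrableZl measurable_I _ ss).
Qed.

Lemma energy_conv p f n : continuous p -> (forall x, p (x + 2 * pi) = p x) ->
  sqI f -> energy (conv p f) n = energy p n * energy f n.
Proof.
move=> cp pp sf; have [ec es] := fourier_conv n cp pp sf.
by rewrite /energy ec es; ring.
Qed.

Lemma conv_periodic p f : (forall x, p (x + 2 * pi) = p x) ->
  forall x, conv p f (x + 2 * pi) = conv p f x.
Proof.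
by move=> pp x; apply: eq_intI => y _; rewrite addrAC pp.
Qed.

Lemma conv_lipschitz p f (L : R) : continuous p -> has_bound p -> sqI f ->
  (forall x y, `|p x - p y| <= L * `|x - y|) ->
  forall x y, `|conv p f x - conv p f y| <= L * intI (fun z => `|f z|) * `|x - y|.
Proof.
move=> cp bp sf pL x y.
have fi := sqI_integrable sf.
have ci z := conv_integrable z cp bp fi.
have afi : mu.-integrable I (EFin \o (fun x => `|f x|)) := integrable_abse fi.
rewrite /conv -intIB//.
have di := integrableB measurable_I (ci x) (ci y).
apply: le_trans (normr_intI di) _.
rewrite mulrAC -intIZ//; apply: le_intI.
- exact: (integrable_abse di).
- exact: (integrableZl measurable_I _ afi).
move=> z _; rewrite -mulrBl normrM ler_wpM2r//.
by apply: le_trans (pL _ _) _; rewrite (_ : x - z - (y - z) = x - y)//; ring.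
Qed.

(** The half of the Parseval identity that the Bessel inequality does not give.
    The integral of u^2 is the value at 0 of the autocorrelation v * u, where v
    x = u (- x). Its cosine coefficients are the energies of u, and the Fourier
    series of this Lipschitz function converges at 0. *)
Lemma Parseval_le u (L K : R) : continuous u -> (forall x, u (x + 2 * pi) = u x) ->
  (forall x y, `|u x - u y| <= L * `|x - y|) ->
  (forall N, parseval_sum (energy u) N <= K) -> intI (fun x => u x ^+ 2) <= K.
Proof.
move=> cu pu uL uK.
pose v x := u (- x).
have cv : continuous v.
  move=> z; apply: (@continuous_comp _ _ _ -%R u); last exact: cu.
  exact: opp_continuous.
have pv x : v (x + 2 * pi) = v x.
  by rewrite /v -[LHS]pu opprD subrK.
have vL x y : `|v x - v y| <= L * `|x - y|.
  by apply: le_trans (uL _ _) _; rewrite -opprD normrN.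
have su := continuous_sqI cu.
have bv := periodic_has_bound cv pv.
have v0 : conv v u 0 = intI (fun x => u x ^+ 2).
  by apply: eq_intI => x _; rewrite /v sub0r opprK expr2.
have coef n : fcos v n = fcos u n /\ fsin v n = - fsin u n.
  split.
    rewrite -[RHS](intI_opp (contM cu (@continuous_cosn R n))).
      by apply: eq_intI => x _; rewrite /v /cosn mulrN cosN.
    by move=> x; rewrite pu cosn_periodic.
  rewrite -[RHS]mulN1r -intIZ; last first.
    exact: (sqI_mul su (continuous_sqI (@continuous_sinn R n))).
  have cus := contZ (c := -1) (contM cu (@continuous_sinn R n)).
  rewrite -[RHS](intI_opp cus).
    by apply: eq_intI => x _; rewrite /v /sinn mulrN sinN; ring.
  by move=> x; rewrite pu sinn_periodic.
rewrite -v0.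
apply: (@Dirichlet_at0 _ _ (L * intI (fun z => `|u z|))).
- exact: conv_continuous cv bv (sqI_integrable su).
- exact: conv_periodic.
- by move=> x; have := conv_lipschitz cv bv su vL x 0; rewrite subr0.
- move=> N; apply: le_trans (uK N).
  have E n : fcos (conv v u) n = energy u n.
    have [-> _] := fourier_conv n cv pv su; have [-> ->] := coef n.
    by rewrite /energy; ring.
  rewrite /parseval_sum E (eq_big_nat _ _ (F2 := energy u))// => i _; exact: E.
Qed.

(** A Fourier multiplier bounded by M does not increase the L^2 norm by more
    than sqrt M: Parseval on the convolution, Bessel on f. *)
Lemma conv_L2_le p f (L M : R) : continuous p -> (forall x, p (x + 2 * pi) = p x) ->
  (forall x y, `|p x - p y| <= L * `|x - y|) -> sqI f -> 0 <= M ->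
  (forall n, energy p n <= M) ->
  intI (fun x => conv p f x ^+ 2) <= M * intI (fun x => f x ^+ 2).
Proof.
move=> cp pp pL sf M0 pM; have bp := periodic_has_bound cp pp.
apply: (Parseval_le (L := L * intI (fun z => `|f z|))).
- exact: conv_continuous cp bp (sqI_integrable sf).
- exact: conv_periodic.
- exact: conv_lipschitz.
move=> N; apply: le_trans (_ : M * parseval_sum (energy f) N <= _); last first.
  by rewrite ler_wpM2l// Bessel.
have pi0 := pi_gt0 R.
rewrite /parseval_sum [leRHS]mulrDr 2![M * (_ / _)]mulrA; apply: lerD.
  apply: ler_wpM2r; first by rewrite invr_ge0 ltW// twopi_gt0.
  by rewrite energy_conv// ler_wpM2r ?energy_ge0.
apply: ler_wpM2r; first by rewrite invr_ge0 ltW.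
rewrite mulr_sumr; apply: ler_sum => i _.
by rewrite energy_conv// ler_wpM2r ?energy_ge0.
Qed.

(** Cauchy-Schwarz against the constant 1, as positivity of the variance of |f|. *)
Lemma normr_intI_sqr_le f : sqI f ->
  intI (fun x => `|f x|) ^+ 2 <= 2 * pi * intI (fun x => f x ^+ 2).
Proof.
move=> sf; have t0 := twopi_gt0 R.
have fi := sqI_integrable sf; have [_ f2] := sf.
have afi : mu.-integrable I (EFin \o (fun x => `|f x|)) := integrable_abse fi.
set A := intI _; pose m := A / (2 * pi).
have : 0 <= intI (fun x => f x ^+ 2 - 2 * m * `|f x| + m ^+ 2).
  apply: intI_ge0 => x _; rewrite -(real_normK (num_real (f x))).
  by rewrite (_ : _ + _ = (`|f x| - m) ^+ 2) ?sqr_ge0//; ring.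
have mi := integrableZl measurable_I (2 * m) afi.
rewrite intID; last 2 first.
- exact: (integrableB measurable_I f2 mi).
- by apply: continuous_integrable_I => x; exact: cvg_cst.
rewrite intIB// intIZ// intI_cst -/A.
have AE : A = m * (2 * pi) by rewrite /m divfK// gt_eqF.
rewrite AE; move: t0; move: (2 * pi : R) => T T0 h.
have := mulr_ge0 (ltW T0) h; lra.
Qed.

(** Convolution maps L^2 to bounded functions; convergence in L^2 of the
    iterates is thereby turned into uniform convergence. *)
Lemma conv_sup_le p f (S : R) x : continuous p -> (forall x, `|p x| <= S) -> sqI f ->
  `|conv p f x| ^+ 2 <= S ^+ 2 * (2 * pi) * intI (fun x => f x ^+ 2).
Proof.
move=> cp pS sf.
have S0 : 0 <= S by apply: le_trans (pS 0).
have fi := sqI_integrable sf.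
have afi : mu.-integrable I (EFin \o (fun x => `|f x|)) := integrable_abse fi.
have bp : has_bound p by exists S.
have ci := conv_integrable x cp bp fi.
have le1 : `|conv p f x| <= S * intI (fun x => `|f x|).
  apply: le_trans (normr_intI ci) _; rewrite -intIZ//; apply: le_intI.
  - exact: (integrable_abse ci).
  - exact: (integrableZl measurable_I _ afi).
  - by move=> y _; rewrite normrM ler_wpM2r.
apply: le_trans (_ : (S * intI (fun x => `|f x|)) ^+ 2 <= _).
  by rewrite lerXn2r ?nnegrE// (le_trans _ le1).
by rewrite exprMn -mulrA ler_wpM2l ?sqr_ge0// normr_intI_sqr_le.
Qed.

End convolution_fourier.

(** * Periodic solutions of first-order equations *)

Section periodic_ode.
Variable R : realType.
Implicit Types (f g p q : R -> R) (x : R).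

Lemma periodic_of_derive0 p : (forall x, is_derive x 1 (fun x => p (x + 2 * pi) - p x) 0) ->
  p (2 * pi) = p 0 -> forall x, p (x + 2 * pi) = p x.
Proof.
move=> d0 p0 x; apply/eqP; rewrite -subr_eq0; apply/eqP.
rewrite (is_derive_0_is_cst x 0 d0) add0r p0; exact: subrr.
Qed.

Lemma primitive_periodic g : continuous g -> (forall x, g (x + 2 * pi) = g x) ->
  intI g = 0 ->
  exists p : R -> R, (forall x, p (x + 2 * pi) = p x) /\ (forall x, is_derive x 1 p (g x)).
Proof.
move=> cg gp g0; have [P dP] := primitive_exists cg; exists P; split => //.
apply: periodic_of_derive0 => [x|]; last first.
  by apply/eqP; rewrite -subr_eq0 -(intI_FTC cg dP) g0.
have d1 := is_derive_shift (dP (x + 2 * pi)); have d2 := dP x.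
by apply: is_derive_eq; rewrite gp subrr.
Qed.

(** The real and imaginary parts of w' = (al + i be) w + g. Variation of
    constants gives all solutions. The initial value (k1, k2) for which w (2 pi)
    = w 0 exists because exp (2 pi (al + i be)) differs from 1 when al is not 0.
    Then w (x + 2 pi) - w x solves the homogeneous equation and vanishes at 0,
    hence everywhere. *)
Lemma solve_first_order (al be : R) (g1 g2 : R -> R) : al != 0 ->
  continuous g1 -> continuous g2 ->
  (forall x, g1 (x + 2 * pi) = g1 x) -> (forall x, g2 (x + 2 * pi) = g2 x) ->
  exists p q : R -> R,
    [/\ forall x, p (x + 2 * pi) = p x, forall x, q (x + 2 * pi) = q x,
      forall x, is_derive x 1 p (al * p x - be * q x + g1 x) &
      forall x, is_derive x 1 q (be * p x + al * q x + g2 x)].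
Proof.
move=> al0 cg1 cg2 pg1 pg2.
have lin (a x : R) : is_derive x 1 (fun z => a * z) a.
  by have := is_derive_scale a (is_derive_id x 1); rewrite mulr1.
have dE (a x : R) : is_derive x 1 (fun z => expR (a * z)) (a * expR (a * x)).
  by have := lin a x => dl; apply: is_derive_eq; rewrite mulrC.
have dC (a x : R) : is_derive x 1 (fun z => cos (a * z)) (- a * sin (a * x)).
  by have := lin a x => dl; apply: is_derive_eq; rewrite mulrC mulrN mulNr.
have dS (a x : R) : is_derive x 1 (fun z => sin (a * z)) (a * cos (a * x)).
  by have := lin a x => dl; apply: is_derive_eq; rewrite mulrC.
have cE (a : R) : continuous (fun z => expR (a * z)) by move=> x; exact: is_derive_continuous (dE a x).
have cC (a : R) : continuous (fun z => cos (a * z)) by move=> x; exact: is_derive_continuous (dC a x).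
have cS (a : R) : continuous (fun z => sin (a * z)) by move=> x; exact: is_derive_continuous (dS a x).
pose h1 z := expR (- al * z) * (cos (be * z) * g1 z + sin (be * z) * g2 z).
pose h2 z := expR (- al * z) * (cos (be * z) * g2 z + - 1 * (sin (be * z) * g1 z)).
have ch1 : continuous h1 by apply: contM => //; apply: contD; exact: contM.
have ch2 : continuous h2.
  by apply: contM => //; apply: contD; [exact: contM|apply: contZ; exact: contM].
have [J1' dJ1'] := primitive_exists ch1.
have [J2' dJ2'] := primitive_exists ch2.
pose J1 x := J1' x - J1' 0. pose J2 x := J2' x - J2' 0.
have dJ1 x : is_derive x 1 J1 (h1 x) by have := dJ1' x => d; apply: is_derive_eq; rewrite subr0.
have dJ2 x : is_derive x 1 J2 (h2 x) by have := dJ2' x => d; apply: is_derive_eq; rewrite subr0.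
have J10 : J1 0 = 0 by rewrite /J1 subrr.
have J20 : J2 0 = 0 by rewrite /J2 subrr.
clearbody J1 J2.
pose P k1 k2 x := expR (al * x) * (cos (be * x) * (k1 + J1 x) - sin (be * x) * (k2 + J2 x)).
pose Q k1 k2 x := expR (al * x) * (sin (be * x) * (k1 + J1 x) + cos (be * x) * (k2 + J2 x)).
have EE x : expR (al * x) * expR (- al * x) = 1.
  by rewrite -expRD mulNr subrr expR0.
have dP k1 k2 x : is_derive x 1 (P k1 k2) (al * P k1 k2 x - be * Q k1 k2 x + g1 x).
  have d1 := dE al x; have d2 := dC be x; have d3 := dS be x.
  have d4 := dJ1 x; have d5 := dJ2 x.
  apply: is_derive_eq; rewrite /GRing.scale /= /P /Q /h1 /h2.
  rewrite [X in _ = _ + X](_ : g1 x = (expR (al * x) * expR (- al * x)) *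
    (cos (be * x) ^+ 2 + sin (be * x) ^+ 2) * g1 x); last first.
    by rewrite EE cos2Dsin2 !mul1r.
  ring.
have dQ k1 k2 x : is_derive x 1 (Q k1 k2) (be * P k1 k2 x + al * Q k1 k2 x + g2 x).
  have d1 := dE al x; have d2 := dC be x; have d3 := dS be x.
  have d4 := dJ1 x; have d5 := dJ2 x.
  apply: is_derive_eq; rewrite /GRing.scale /= /P /Q /h1 /h2.
  rewrite [X in _ = _ + X](_ : g2 x = (expR (al * x) * expR (- al * x)) *
    (cos (be * x) ^+ 2 + sin (be * x) ^+ 2) * g2 x); last first.
    by rewrite EE cos2Dsin2 !mul1r.
  ring.
have [k1 [k2 [pk qk]]] : exists k1 k2, P k1 k2 (2 * pi) = P k1 k2 0 /\ Q k1 k2 (2 * pi) = Q k1 k2 0.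
  pose A := expR (al * (2 * pi)) * cos (be * (2 * pi)).
  pose B := expR (al * (2 * pi)) * sin (be * (2 * pi)).
  (* A + i B is exp (2 pi (al + i be)); De is its squared distance to 1. *)
  pose De := (1 - A) ^+ 2 + B ^+ 2.
  have De0 : De != 0.
    apply/negP; rewrite /De paddr_eq0 ?sqr_ge0// => /andP[].
    rewrite !sqrf_eq0 subr_eq0 => /eqP A1 /eqP B0.
    have : A ^+ 2 + B ^+ 2 = expR (al * (2 * pi)) ^+ 2.
      by rewrite /A /B !exprMn -mulrDr cos2Dsin2 mulr1.
    rewrite -A1 B0 expr1n expr0n addr0 => /esym/eqP.
    rewrite sqrf_eq1 => /orP[]; last first.
      by rewrite eq_sym lt_eqF// (lt_trans _ (expR_gt0 _))// oppr_lt0.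
    move=> /eqP e1; have /expR_inj/eqP : expR (al * (2 * pi)) = expR 0 by rewrite e1 expR0.
    by rewrite mulf_eq0 (negPf al0) gt_eqF ?twopi_gt0.
  pose m1 := A * J1 (2 * pi) - B * J2 (2 * pi).
  pose m2 := B * J1 (2 * pi) + A * J2 (2 * pi).
  exists (((1 - A) * m1 - B * m2) / De), ((B * m1 + (1 - A) * m2) / De).
  rewrite /P /Q !mulr0 expR0 cos0 sin0 J10 J20.
  split.
    transitivity (A * (((1 - A) * m1 - B * m2) / De + J1 (2 * pi)) - B * ((B * m1 + (1 - A) * m2) / De + J2 (2 * pi))).
      by rewrite /A /B; ring.
    move: De0; rewrite /De /m1 /m2; clear; move: A B (J1 _) (J2 _) => A B j1 j2 D0.
    by field.
  transitivity (B * (((1 - A) * m1 - B * m2) / De + J1 (2 * pi)) + A * ((B * m1 + (1 - A) * m2) / De + J2 (2 * pi))).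
    by rewrite /A /B; ring.
  move: De0; rewrite /De /m1 /m2; clear; move: A B (J1 _) (J2 _) => A B j1 j2 D0.
  by field.
exists (P k1 k2), (Q k1 k2).
pose z1 x := P k1 k2 (x + 2 * pi) - P k1 k2 x.
pose z2 x := Q k1 k2 (x + 2 * pi) - Q k1 k2 x.
have dz1 x : is_derive x 1 z1 (al * z1 x - be * z2 x).
  have d1 := is_derive_shift (dP k1 k2 (x + 2 * pi)); have d2 := dP k1 k2 x.
  by apply: is_derive_eq; rewrite pg1 /z1 /z2; ring.
have dz2 x : is_derive x 1 z2 (be * z1 x + al * z2 x).
  have d1 := is_derive_shift (dQ k1 k2 (x + 2 * pi)); have d2 := dQ k1 k2 x.
  by apply: is_derive_eq; rewrite pg2 /z1 /z2; ring.
(* |z|^2 grows exactly like exp (2 al x). *)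
have dN x : is_derive x 1 (fun x => expR ((- 2 * al) * x) * (z1 x * z1 x + z2 x * z2 x)) 0.
  have d1 := dE (- 2 * al) x; have d2 := dz1 x; have d3 := dz2 x.
  by apply: is_derive_eq; rewrite /GRing.scale /=; ring.
have z0 x : z1 x = 0 /\ z2 x = 0.
  have := is_derive_0_is_cst x 0 dN.
  have -> : z1 0 = 0 by rewrite /z1 add0r pk subrr.
  have -> : z2 0 = 0 by rewrite /z2 add0r qk subrr.
  rewrite !mulr0 addr0 mulr0 => /eqP.
  rewrite mulf_eq0 gt_eqF ?expR_gt0//= -!expr2 paddr_eq0 ?sqr_ge0// !sqrf_eq0.
  by move=> /andP[/eqP -> /eqP ->].
split => // x.
  by apply/eqP; rewrite -subr_eq0; apply/eqP; exact: (z0 x).1.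
by apply/eqP; rewrite -subr_eq0; apply/eqP; exact: (z0 x).2.
Qed.

(** Componentwise, R[i] serving here as a field to factor polynomials in. *)
Definition cderive (f f' : R -> R[i]) : Prop := forall x,
  is_derive x 1 (fun x => complex.Re (f x)) (complex.Re (f' x)) /\
  is_derive x 1 (fun x => complex.Im (f x)) (complex.Im (f' x)).

Definition ccont (f : R -> R[i]) : Prop :=
  continuous (fun x => complex.Re (f x)) /\ continuous (fun x => complex.Im (f x)).

Definition cper (f : R -> R[i]) : Prop := forall x, f (x + 2 * pi) = f x.

Lemma cderive_cont (f f' : R -> R[i]) : cderive f f' -> ccont f.
Proof.
by move=> df; split=> x; [exact: is_derive_continuous (df x).1|exact: is_derive_continuous (df x).2].
Qed.

Lemma cderiveD (f g f' g' : R -> R[i]) : cderive f f' -> cderive g g' ->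
  cderive (fun x => f x + g x) (fun x => f' x + g' x).
Proof.
move=> df dg x; have [d1 d2] := df x; have [d3 d4] := dg x; split.
  rewrite raddfD /=; under eq_fun do rewrite raddfD /=; exact: is_derive_add.
rewrite raddfD /=; under eq_fun do rewrite raddfD /=; exact: is_derive_add.
Qed.

Lemma cderiveZ (l : R[i]) (f f' : R -> R[i]) : cderive f f' ->
  cderive (fun x => l * f x) (fun x => l * f' x).
Proof.
case: l => a b df x; have [d1 d2] := df x; split.
  have -> : (fun x => complex.Re ((a +i* b)%C * f x)) =
      (fun x => a * complex.Re (f x) - b * complex.Im (f x)).
    by apply/funext => z; case: (f z).
  by apply: is_derive_eq; rewrite /GRing.scale /=; case: (f' x) => c d /=; ring.
have -> : (fun x => complex.Im ((a +i* b)%C * f x)) =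
    (fun x => a * complex.Im (f x) + b * complex.Re (f x)).
  by apply/funext => z; case: (f z).
by apply: is_derive_eq; rewrite /GRing.scale /=; case: (f' x) => c d /=; ring.
Qed.

Lemma csolve (l : R[i]) (g : R -> R[i]) : complex.Re l != 0 -> ccont g -> cper g ->
  exists w, cper w /\ cderive w (fun x => l * w x + g x).
Proof.
case: l => al be /= al0 [cg1 cg2] pg.
have pg1 x : complex.Re (g (x + 2 * pi)) = complex.Re (g x) by rewrite pg.
have pg2 x : complex.Im (g (x + 2 * pi)) = complex.Im (g x) by rewrite pg.
have [p [q [pp pq dp dq]]] := solve_first_order be al0 cg1 cg2 pg1 pg2.
exists (fun x => (p x +i* q x)%C); split => [x|x]; first by rewrite pp pq.
split => /=.
  by apply: (is_derive_eq (dp x)); case: (g x).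
by apply: (is_derive_eq (dq x)); case: (g x) => c d /=; ring.
Qed.

End periodic_ode.

(** * The periodic resolvent kernel *)

Section resolvent.
Variable R : realType.
Implicit Types (f g p q : R -> R) (x y : R).

Lemma quartic_roots (a b : R[i]) : exists l1 l2 l3 l4 : R[i],
  forall x : R[i], x ^+ 4 - b * x - a = (x - l1) * (x - l2) * (x - l3) * (x - l4).
Proof.
pose p : {poly R[i]} := 'X^4 - b *: 'X - a%:P.
have [s ps] := closed_field_poly_normal p.
pose q : {poly R[i]} := - (b *: 'X) - a%:P.
have sp : (size q < 5)%N.
  rewrite /q.
  rewrite (leq_ltn_trans (size_polyD _ _))// gtn_max !size_polyN.
  rewrite (leq_ltn_trans (size_scale_leq _ _)) ?size_polyX//=.
  by rewrite (leq_ltn_trans (size_polyC_leq1 _)).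
have sz : size p = 5%N by rewrite /p -addrA -/q size_polyDl size_polyXn.
have lc : lead_coef p = 1.
  by rewrite /p -addrA -/q lead_coefDl ?size_polyXn// lead_coefXn.
move: ps; rewrite lc scale1r => ps.
have : size s = 4%N.
  by move: sz; rewrite ps size_prod_XsubC => -[].
case: s ps => [|l1 [|l2 [|l3 [|l4 []]]]]// ps _.
exists l1, l2, l3, l4 => x.
have := congr1 (fun r : {poly R[i]} => r.[x]) ps; rewrite /p !big_cons big_nil mulr1.
by rewrite !hornerE => h; exact: h.
Qed.

(** The Vieta formulas, from the values of both sides at 0, 1, - 1 and 2. *)
Lemma quartic_symm (a b l1 l2 l3 l4 : R[i]) :
  (forall x : R[i], x ^+ 4 - b * x - a = (x - l1) * (x - l2) * (x - l3) * (x - l4)) ->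
  [/\ l1 = - (l2 + l3 + l4),
    l1 * l2 + l1 * l3 + l1 * l4 + l2 * l3 + l2 * l4 + l3 * l4 = 0,
    b = l1 * l2 * l3 + l1 * l2 * l4 + l1 * l3 * l4 + l2 * l3 * l4 &
    a = - (l1 * l2 * l3 * l4)].
Proof.
move=> h.
have e4 : a = - (l1 * l2 * l3 * l4).
  have := h 0; rewrite expr0n /= mulr0 subr0 sub0r => /eqP.
  by rewrite eqr_oppLR => /eqP ->; ring.
have h1 := h 1; have hm := h (- 1); have h2 := h 2.
have tn (z : R[i]) : 2 * z = 0 -> z = 0.
  by move=> /eqP; rewrite mulf_eq0 pnatr_eq0 /= => /eqP.
have e2 : l1 * l2 + l1 * l3 + l1 * l4 + l2 * l3 + l2 * l4 + l3 * l4 = 0.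
  apply: tn.
  transitivity ((1 - l1) * (1 - l2) * (1 - l3) * (1 - l4) + (-1 - l1) * (-1 - l2) * (-1 - l3) * (-1 - l4) - 2 - 2 * (l1 * l2 * l3 * l4)); first by ring.
  by rewrite -h1 -hm e4; ring.
have e3' : b = l1 * l2 * l3 + l1 * l2 * l4 + l1 * l3 * l4 + l2 * l3 * l4 + (l1 + l2 + l3 + l4).
  apply/eqP; rewrite -subr_eq0; apply/eqP; apply: tn.
  transitivity (2 * b + ((1 - l1) * (1 - l2) * (1 - l3) * (1 - l4) - (-1 - l1) * (-1 - l2) * (-1 - l3) * (-1 - l4))); first by ring.
  by rewrite -h1 -hm; ring.
have e1 : l1 + l2 + l3 + l4 = 0.
  apply/eqP; have : (6 : R[i]) * (l1 + l2 + l3 + l4) == 0; last first.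
    by rewrite mulf_eq0 pnatr_eq0.
  apply/eqP; transitivity (2 ^+ 4 - 2 * b - a - (2 - l1) * (2 - l2) * (2 - l3) * (2 - l4) +
    4 * (l1 * l2 + l1 * l3 + l1 * l4 + l2 * l3 + l2 * l4 + l3 * l4)).
    by rewrite e3' e4; ring.
  by rewrite -h2 e2; ring.
split => //.
  by apply/eqP; rewrite -addr_eq0 !addrA e1.
by rewrite e3' e1 addr0.
Qed.

(** Solving the four equations w' = l w + g in a chain inverts D^4 - b D - a,
    which is the product of the factors D - l. The defect is a combination of
    the first two elementary symmetric functions of the roots, which vanish. *)
Lemma cderive_combine4 (l1 l2 l3 l4 a b : R[i]) (U W3 W2 W1 G : R -> R[i]) :
  (forall x : R[i], x ^+ 4 - b * x - a = (x - l1) * (x - l2) * (x - l3) * (x - l4)) ->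
  cderive U (fun x => l4 * U x + W3 x) -> cderive W3 (fun x => l3 * W3 x + W2 x) ->
  cderive W2 (fun x => l2 * W2 x + W1 x) -> cderive W1 (fun x => l1 * W1 x + G x) ->
  exists U2 U3 U4, let U1 x := l4 * U x + W3 x in
    [/\ cderive U U1, cderive U1 U2, cderive U2 U3, cderive U3 U4 &
        forall x, U4 x - b * U1 x - a * U x = G x].
Proof.
move=> /quartic_symm[e1 e2 e3 e4] d4 d3 d2 d1.
pose U1 x := l4 * U x + W3 x.
pose V2 x := l3 * W3 x + W2 x. pose V1 x := l2 * W2 x + W1 x. pose V0 x := l1 * W1 x + G x.
pose U2 x := l4 * U1 x + V2 x.
have dU1 : cderive U1 U2 by apply: cderiveD d3; exact: cderiveZ.
pose V3 x := l3 * V2 x + V1 x.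
have dV2 : cderive V2 V3 by apply: cderiveD d2; exact: cderiveZ.
pose U3 x := l4 * U2 x + V3 x.
have dU2 : cderive U2 U3 by apply: cderiveD dV2; exact: cderiveZ.
pose V4 x := l2 * V1 x + V0 x.
have dV1 : cderive V1 V4 by apply: cderiveD d1; exact: cderiveZ.
pose V5 x := l3 * V3 x + V4 x.
have dV3 : cderive V3 V5 by apply: cderiveD dV1; exact: cderiveZ.
pose U4 x := l4 * U3 x + V5 x.
have dU3 : cderive U3 U4 by apply: cderiveD dV3; exact: cderiveZ.
exists U2, U3, U4; split => // x.
rewrite /U4 /U3 /U2 /V5 /V4 /V3 /V2 /V1 /V0 /U1.
pose e := l1 + l2 + l3 + l4.
pose f := l1 * l2 + l1 * l3 + l1 * l4 + l2 * l3 + l2 * l4 + l3 * l4.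
have e0 : e = 0 by rewrite /e e1; ring.
apply/eqP; rewrite -subr_eq0; apply/eqP.
transitivity ((e * l4 ^+ 3 - f * l4 ^+ 2) * U x +
  (e * (l3 ^+ 2 + l3 * l4 + l4 ^+ 2) - f * (l3 + l4)) * W3 x +
  (e * (l2 + l3 + l4) - f) * W2 x + e * W1 x).
  by rewrite e3 e4 /e /f; ring.
by rewrite e0 /f e2; ring.
Qed.

(** At x = i y the imaginary part of x^4 - b x - a is - b y. *)
Lemma root_resonance (a b : R) (x : R[i]) : b != 0 ->
  x ^+ 4 - b%:C%C * x - a%:C%C = 0 -> complex.Re x = 0 -> x = 0 /\ a = 0.
Proof.
case: x => al be b0 + /= al0; rewrite al0 => e.
have [e1 e2] : be ^+ 4 - a = 0 /\ b * be = 0.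
  split.
    transitivity (complex.Re ((0 +i* be)%C ^+ 4 - b%:C%C * (0 +i* be)%C - a%:C%C)).
      by rewrite !exprS expr0 /=; ring.
    by rewrite e.
  transitivity (- complex.Im ((0 +i* be)%C ^+ 4 - b%:C%C * (0 +i* be)%C - a%:C%C)).
    by rewrite !exprS expr0 /=; ring.
  by rewrite e /= oppr0.
move/eqP: e2; rewrite mulf_eq0 (negPf b0) /= => /eqP be0.
by rewrite be0; split => //; move: e1; rewrite be0 expr0n sub0r => /eqP; rewrite oppr_eq0 => /eqP.
Qed.

(** The only possible root with zero real part is 0; it occurs when a = 0, and
    is then simple since the three other roots have product b. It is listed
    first, so that its equation has the given right-hand side and is solved by
    integrating a function of mean zero. *)
Lemma characteristic_roots (a b : R) : b != 0 -> exists l1 l2 l3 l4 : R[i],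
  [/\ forall x : R[i], x ^+ 4 - b%:C%C * x - a%:C%C = (x - l1) * (x - l2) * (x - l3) * (x - l4),
    [/\ complex.Re l2 != 0, complex.Re l3 != 0 & complex.Re l4 != 0] &
    complex.Re l1 != 0 \/ l1 = 0 /\ a = 0].
Proof.
move=> b0.
have nres (l : R[i]) : l ^+ 4 - b%:C%C * l - a%:C%C = 0 -> l != 0 \/ a != 0 -> complex.Re l != 0.
  move=> lr nl; apply/eqP => /(root_resonance b0 lr) [l0 a0].
  by case: nl => /eqP.
have [a0|a0] := eqVneq a 0; last first.
  have [l1 [l2 [l3 [l4 h]]]] := quartic_roots (a%:C%C) (b%:C%C).
  exists l1, l2, l3, l4; split=> //; [split|left];
    (apply: nres; [by rewrite h subrr ?(mul0r, mulr0)|by right]).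
have {}nres (l : R[i]) : l ^+ 4 - b%:C%C * l - a%:C%C = 0 -> l != 0 -> complex.Re l != 0.
  by move=> h1 h2; apply: nres => //; left.
suff [l1 [l2 [l3 [l4 [h l10]]]]] : exists l1 l2 l3 l4 : R[i],
    (forall x : R[i], x ^+ 4 - b%:C%C * x - a%:C%C = (x - l1) * (x - l2) * (x - l3) * (x - l4)) /\
    l1 = 0.
  have [_ _ bE _] := quartic_symm h.
  rewrite l10 !mul0r !add0r in bE.
  have : l2 * l3 * l4 != 0 by rewrite -bE eq_complex /= eqxx andbT.
  rewrite !mulf_eq0 !negb_or => /andP[/andP[l2n l3n] l4n].
  exists l1, l2, l3, l4; split => //; last by right.
  by split; apply: nres => //; rewrite h subrr ?(mul0r, mulr0).
have [l1 [l2 [l3 [l4 h]]]] := quartic_roots (a%:C%C) (b%:C%C).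
have [_ _ _ aE] := quartic_symm h.
have : l1 * l2 * l3 * l4 == 0.
  by rewrite -oppr_eq0 -aE a0.
rewrite !mulf_eq0 => /orP[/orP[/orP[]|]|] /eqP l0.
- by exists l1, l2, l3, l4.
- by exists l2, l1, l3, l4; split=> // x; rewrite h; ring.
- by exists l3, l1, l2, l4; split=> // x; rewrite h; ring.
- by exists l4, l1, l2, l3; split=> // x; rewrite h; ring.
Qed.

(** A periodic function of class C^4 given together with its derivatives: U k
    stands for the k-th derivative of U 0. *)
Definition periodic_jet (U : nat -> R -> R) : Prop :=
  [/\ forall k x, (k <= 4)%N -> U k (x + 2 * pi) = U k x,
    forall k, (k <= 4)%N -> continuous (U k) &
    forall k x, (k < 4)%N -> is_derive x 1 (U k) (U k.+1 x)].

Lemma periodic_jet_bounded (U : nat -> R -> R) k :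
  periodic_jet U -> (k <= 4)%N -> has_bound (U k).
Proof. by move=> [pU cU _] k4; apply: periodic_has_bound (cU k k4) _ => x; exact: pU. Qed.

(** The real part of a complex solution is a solution, a and b being real. When
    a = 0 solutions are determined up to a constant, which is chosen to make the
    mean value zero. *)
Lemma periodic_resolvent (a b : R) (G : R -> R) : b != 0 ->
  continuous G -> (forall x, G (x + 2 * pi) = G x) -> (a = 0 -> intI G = 0) ->
  exists U : nat -> R -> R,
    [/\ periodic_jet U,
      forall x, U 4%N x - b * U 1%N x - a * U 0%N x = G x &
      a = 0 -> intI (U 0%N) = 0].
Proof.
move=> b0 cG pG mG.
have [l1 [l2 [l3 [l4 [h [r2 r3 r4] r1]]]]] := characteristic_roots a b0.
pose g x : R[i] := (G x)%:C%C.
have cg : ccont g by split => //= x; exact: cvg_cst.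
have pg : cper g by move=> x; rewrite /g pG.
have [W1 [pW1 dW1]] : exists w, cper w /\ cderive w (fun x => l1 * w x + g x).
  case: r1 => [r1|[l10 a0]]; first exact: csolve.
  have [p [pp dp]] := primitive_periodic cG pG (mG a0).
  exists (fun x => (p x)%:C%C); split => [x|x]; first by rewrite pp.
  rewrite l10 mul0r add0r; split => /=; first exact: dp.
  exact: is_derive_cst.
have [W2 [pW2 dW2]] := csolve r2 (cderive_cont dW1) pW1.
have [W3 [pW3 dW3]] := csolve r3 (cderive_cont dW2) pW2.
have [W4 [pW4 dW4]] := csolve r4 (cderive_cont dW3) pW3.
have [U2 [U3 [U4 /= [d1 d2 d3 d4 E]]]] := cderive_combine4 h dW4 dW3 dW2 dW1.
pose V (k : nat) (x : R) : R := complex.Re (match k with 0%N => W4 x | 1%N => l4 * W4 x + W3 x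
  | 2 => U2 x | 3 => U3 x | _ => U4 x end).
have dV k x : (k < 4)%N -> is_derive x 1 (V k) (V k.+1 x).
  by case: k => [_|[_|[_|[_|//]]]]; [exact: (d1 x).1|exact: (d2 x).1|exact: (d3 x).1|exact: (d4 x).1].
have EV x : V 4%N x = b * V 1%N x + a * V 0%N x + G x.
  have := congr1 (fun z : R[i] => complex.Re z) (E x); rewrite /V /g.
  case: (U4 x) => u4 ?; case: (_ + W3 x) => u1 ?; case: (W4 x) => u0 ? /=; lra.
have pV k x : (k <= 4)%N -> V k (x + 2 * pi) = V k x.
  elim: k x => [|k IH] x k4; first by rewrite /V pW4.
  have d5 := is_derive_shift (dV _ (x + 2 * pi) k4).
  have [_ <-] := dV _ x k4; have [_ <-] := d5.
  by congr ('D_1 _ x); apply/funext => y; rewrite IH// ltnW.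
have cV k : (k <= 4)%N -> continuous (V k).
  rewrite leq_eqVlt => /predU1P[->|k4 x]; last exact: is_derive_continuous (dV _ _ k4).
  have -> : V 4%N = (fun x => b * V 1%N x + a * V 0%N x + G x) by apply/funext => x; exact: EV.
  have c1 : continuous (V 1%N) by move=> x; exact: is_derive_continuous (dV 1%N x isT).
  have c0 : continuous (V 0%N) by move=> x; exact: is_derive_continuous (dV 0%N x isT).
  by apply: contD => //; apply: contD; exact: contZ.
have [a0|a0] := eqVneq a 0; last first.
  by exists V; split=> // [x|a00]; [rewrite EV; ring|rewrite a00 eqxx in a0].
pose c := intI (V 0%N) / (2 * pi).
exists (fun k x => V k x - (if k == 0%N then c else 0)); split.
- split => [k x k4|k k4 x|k x k4]; first by rewrite pV.
    by apply: cvgB; [exact: cV|exact: cvg_cst].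
  exact: is_derive_sub (dV k x k4) (is_derive_cst _ x 1).
- by move=> x; rewrite /= EV a0; ring.
- move=> _ /=; rewrite intIB; last 2 first.
  + by apply: continuous_integrable_I; exact: cV.
  + by apply: continuous_integrable_I => x; exact: cvg_cst.
  by rewrite intI_cst /c divfK ?subrr// gt_eqF// twopi_gt0.
Qed.

End resolvent.

(** * Absolutely continuous functions with zero derivative *)

Section absolute_continuity.
Variable R : realType.
Implicit Types (p q v : R -> R) (x y : R).
Local Notation mu := (leb R).

(** Successive intervals from x to y. Lists are convenient because the covering
    argument below concatenates them. *)
Fixpoint chain (x : R) (L : seq (R * R)) (y : R) : Prop :=
  if L is p :: L' then [/\ x <= p.1, p.1 <= p.2 & chain p.2 L' y] else x <= y.

Lemma chain_le x L y : chain x L y -> x <= y.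
Proof.
elim: L x => [//|[s t] L IH] x /= [xs st /IH]; exact: le_trans (le_trans xs st).
Qed.

Lemma chain_widen x x' L y : x' <= x -> chain x L y -> chain x' L y.
Proof.
by case: L => [|[s t] L] /= xx'; [exact: le_trans|move=> [xs st c]; split=> //; exact: le_trans xs].
Qed.

Lemma chain_cat x L y L' z : chain x L y -> chain y L' z -> chain x (L ++ L') z.
Proof.
elim: L x => [|[s t] L IH] x /=; first exact: chain_widen.
by move=> [xs st c] c'; split=> //; exact: IH.
Qed.

Lemma chain_in x L y (p : R * R) : chain x L y -> p \in L -> [/\ x <= p.1, p.1 <= p.2 & p.2 <= y].
Proof.
elim: L x => [//|q L IH] x /= [xs st c]; rewrite inE => /predU1P[->|pL].
  by split=> //; exact: chain_le c.
have [h1 h2 h3] := IH _ c pL; split=> //.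
exact: le_trans xs (le_trans st h1).
Qed.

Lemma chain_nth x L y (p0 : R * R) i j : chain x L y -> (i < j < size L)%N ->
  (nth p0 L i).2 <= (nth p0 L j).1.
Proof.
elim: L x i j => [|q L IH] x i j /=; first by rewrite ltn0 andbF.
move=> [xs st c]; case: j => [|j]; first by rewrite ltn0.
case: i => [|i] /=; last by rewrite !ltnS; exact: IH c.
rewrite ltnS => jL; have [] // := chain_in c (mem_nth p0 jL).
Qed.

Lemma chain_measure x L y (U : set R) : open U -> chain x L y ->
  (forall p : R * R, p \in L -> `]p.1, p.2[ `<=` U) ->
  ((\sum_(p <- L) (p.2 - p.1))%:E <= lebesgue_measure (U `&` `]x, y[))%E.
Proof.
move=> oU; elim: L x => [|p L IH] x /=; first by move=> _ _; rewrite big_nil.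
move=> [xs st c] LU; rewrite big_cons EFinD.
have mU (s t : R) : measurable (U `&` `]s, t[).
  by apply: measurableI; [exact: open_measurable|exact: measurable_itv].
apply: (@le_trans _ _ (lebesgue_measure `]p.1, p.2[ + lebesgue_measure (U `&` `]p.2, y[))%E).
  apply: leeD; last by apply: IH c _ => q qL; apply: LU; rewrite inE qL orbT.
  by rewrite lebesgue_measure_itv /= lte_fin; case: ltP => // h; rewrite ?EFinB // lee_fin subr_le0.
rewrite -measureU; last 3 first.
- exact: measurable_itv.
- exact: mU.
- apply/seteqP; split => // z [] /=; rewrite !in_itv /= => /andP[_ z2] [_ /andP[z3 _]].
  by have := lt_trans z2 z3; rewrite ltxx.
apply: le_measure; rewrite ?inE//.
  by apply: measurableU; [exact: measurable_itv|exact: mU].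
  exact: mU.
move=> z [zp|[zU zy]]; split => //.
- by apply: LU zp; rewrite inE eqxx.
- move: zp; rewrite /= !in_itv /= => /andP[z1 z2]; rewrite (le_lt_trans xs z1)/=.
  exact: lt_le_trans z2 (chain_le c).
- move: zy; rewrite /= !in_itv /= => /andP[z1 ->]; rewrite andbT.
  exact: le_lt_trans (le_trans xs st) z1.
Qed.

Lemma derive0_littleo (w : R -> R) (c : R) : is_derive c 1 w 0 -> forall e : R, 0 < e ->
  exists2 r : R, 0 < r & forall y, `|y - c| < r -> `|w y - w c| <= e * `|y - c|.
Proof.
move=> [dwc dw0] e e0.
have : h^-1 *: (w (h + c) - w c) @[h --> 0^'] --> 0.
  have /cvg_ex [l hl] := dwc.
  have l0 : l = 0 by rewrite -dw0; apply/esym/cvg_lim.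
  by move: hl; rewrite l0; under eq_fun do rewrite scaler1.
move=> /cvgrPdist_le /(_ _ e0) [r /= r0 rP]; exists r => // y yr.
have [->|yc] := eqVneq y c; first by rewrite !subrr normr0 mulr0.
have := rP (y - c); rewrite /ball_ /= sub0r normrN subrK sub0r normrN => /(_ yr).
rewrite subr_eq0 => /(_ yc); rewrite /GRing.scale /= normrM normfV mulrC.
by rewrite ler_pdivrMr// normr_gt0 subr_eq0.
Qed.

(** Cover the null set N by an open set U of small measure. Every point c has a
    neighbourhood in which the increment of w from y <= c to z >= c is bounded
    either by e (z - y), when w has derivative 0 at c, or by the increment over
    an interval contained in U. A supremum argument chains these local bounds
    from s to t. The intervals contained in U have a small total length, and
    absolute continuity makes the sum of their increments small. *)
Lemma abs_cont_derive0_cst (A B : R) (w : R -> R) (N : set R) : abs_cont_oo A B w ->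
  ((wlength idfun)^* N = 0)%mu ->
  (forall x, A < x < B -> ~ N x -> is_derive x 1 w 0) ->
  forall s t, A < s -> s <= t -> t < B -> w s = w t.
Proof.
move=> acw N0 dw s t As st tB.
suff H e : 0 < e -> `|w t - w s| <= e * (t - s) + e.
  apply/esym/eqP; rewrite -subr_eq0 -normr_le0; apply/ler_addgt0Pr => e e0; rewrite add0r.
  have ts0 : 0 < t - s + 1 by rewrite ltr_wpDl ?subr_ge0.
  apply: le_trans (H (e / (t - s + 1)) _) _; first by rewrite divr_gt0.
  by rewrite -[X in _ + X]mulr1 -mulrDr divfK// gt_eqF.
move=> e0; have [d d0 acd] := acw _ e0.
have d20 : 0 < d / 2 by rewrite divr_gt0.
have [U [oU NU Ud]] := outer_measure_open_le N d20.
rewrite N0 add0e in Ud.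
(* Q x y bounds the increment from x to y; it is additive and holds locally. *)
pose Q x y := exists2 L : seq (R * R), chain x L y /\
   (forall p : R * R, p \in L -> `]p.1, p.2[ `<=` U) &
   `|w y - w x| <= e * (y - x) + \sum_(p <- L) `|w p.2 - w p.1|.
have Qcat x y z : Q x y -> Q y z -> Q x z.
  move=> [L [cL LU] wL] [L' [cL' LU'] wL']; exists (L ++ L').
    split; first exact: chain_cat cL cL'.
    by move=> p; rewrite mem_cat => /orP[]; [exact: LU|exact: LU'].
  rewrite big_cat /= (_ : w z - w x = (w z - w y) + (w y - w x)); last by ring.
  by apply: le_trans (ler_normD _ _) _; move: wL wL'; lra.
have Qloc c : A < c < B -> exists2 r, 0 < r & forall y z, c - r < y -> y <= c ->
    c <= z -> z < c + r -> Q y z.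
  move=> cAB; have [cN|cN] := pselect (N c).
    have : nbhs c U by apply: open_nbhs_nbhs; split => //; exact: NU.
    move=> /nbhs_ballP[r /= r0 rU]; exists r => // y z ry yc cz zr.
    exists [:: (y, z)].
      split; first by split => //=; [exact: le_trans yc cz].
      move=> p; rewrite inE => /eqP -> v /=; rewrite in_itv /= => /andP[v1 v2].
      by apply: rU; rewrite /ball /= ltr_norml; lra.
    by rewrite big_seq1 /= lerDr mulr_ge0 ?(ltW e0)// subr_ge0 (le_trans yc).
  have [r r0 rP] := derive0_littleo (dw _ cAB cN) e0.
  exists r => // y z ry yc cz zr; exists [::].
    by split => //=; exact: le_trans yc cz.
  rewrite big_nil addr0 (_ : w z - w y = (w z - w c) - (w y - w c)); last by ring.
  apply: le_trans (ler_normB _ _) _.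
  have h1 := rP z; have h2 := rP y.
  rewrite ger0_norm ?subr_ge0// in h1; rewrite ler0_norm ?subr_le0// in h2.
  have {}h1 : `|w z - w c| <= e * (z - c) by apply: h1; lra.
  have {}h2 : `|w y - w c| <= e * - (y - c) by apply: h2; lra.
  lra.
have [L [cL LU] wL] : Q s t.
  pose S := [set x | s <= x <= t /\ Q s x].
  have Ss : S s.
    split; first by rewrite lexx.
    by exists [::]; [split => //=|rewrite big_nil !subrr normr0 mulr0 addr0].
  have hS : has_sup S by split; [exists s|exists t => x [/andP[]]].
  pose c := sup S.
  have sc : s <= c by apply: ub_le_sup => //; exact: hS.2.
  have ct : c <= t by apply: ge_sup; [exists s|move=> x [/andP[]]].
  have [|r r0 rP] := Qloc c; first by rewrite (lt_le_trans As sc) (le_lt_trans ct tB).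
  have [x [/andP[sx xt] Qx] cx] := sup_adherent r0 hS.
  have xc : x <= c by apply: ub_le_sup; [exact: hS.2|split => //; rewrite sx].
  have [ctr|ctr] := ltP t (c + r).
    by apply: (Qcat _ x) => //; exact: rP.
  have Sz : S (c + r / 2).
    split; first by apply/andP; split; lra.
    by apply: (Qcat _ x) => //; apply: rP => //; lra.
  have : c + r / 2 <= c by apply: ub_le_sup => //; exact: hS.2.
  lra.
apply: le_trans wL _; rewrite lerD2l.
apply: ltW; rewrite (big_nth (0, 0)) big_mkord.
have := acd (size L) (fun i => (nth (0, 0) L i).1) (fun i => (nth (0, 0) L i).2).
apply.
- move=> i; have [h1 h2 h3] := chain_in cL (mem_nth (0, 0) (ltn_ord i)).
  split => //; first exact: lt_le_trans h1.
  exact: le_lt_trans tB.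
- apply/trivIsetP => i j _ _ ij; apply/seteqP; split => // z [] /=.
  rewrite !in_itv /= => /andP[z1 z2] /andP[z3 z4].
  have : (i != j :> nat) by [].
  rewrite neq_ltn => /orP[] lt.
    have := @chain_nth _ _ _ (0, 0) i j cL; rewrite lt ltn_ord => /(_ isT) h.
    by have := lt_le_trans z2 (le_trans h (ltW z3)); rewrite ltxx.
  have := @chain_nth _ _ _ (0, 0) j i cL; rewrite lt ltn_ord => /(_ isT) h.
  by have := lt_le_trans z4 (le_trans h (ltW z1)); rewrite ltxx.
- have := chain_measure oU cL LU; rewrite (big_nth (0, 0)) big_mkord => h.
  rewrite -lte_fin; apply: le_lt_trans h _.
  apply: (@le_lt_trans _ _ (lebesgue_measure U)).
    apply: le_measure; rewrite ?inE//.
    + by apply: measurableI; [exact: open_measurable|exact: measurable_itv].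
    + exact: open_measurable.
  apply: le_lt_trans Ud _; rewrite lte_fin; lra.
Qed.

End absolute_continuity.

(** * Uniqueness for the linear periodic problem *)

Section uniqueness.
Variable R : realType.
Implicit Types (f p : R -> R) (x y : R) (n : nat).
Local Notation mu := (leb R).

Lemma abs_cont_lipschitz (A B K : R) f p : abs_cont_oo A B f ->
  (forall x y, A < x -> x <= y -> y < B -> `|p y - p x| <= K * (y - x)) ->
  abs_cont_oo A B (fun x => f x - p x).
Proof.
move=> acf pK e e0.
have e20 : 0 < e / 2 by rewrite divr_gt0.
have [d1 d10 h1] := acf _ e20.
have K0 : 0 < `|K| + 1 by rewrite ltr_wpDl.
pose d2 := e / 2 / (`|K| + 1).
have d20 : 0 < d2 by rewrite divr_gt0.
exists (Num.min d1 d2); first by rewrite lt_min d10.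
move=> n s t st tr; rewrite lt_min => /andP[sd1 sd2].
have h := h1 _ _ _ st tr sd1.
have le_i i : `|f (t i) - p (t i) - (f (s i) - p (s i))| <=
    `|f (t i) - f (s i)| + (`|K| + 1) * (t i - s i).
  have [As si tB] := st i.
  rewrite (_ : _ - _ = (f (t i) - f (s i)) - (p (t i) - p (s i))); last by ring.
  apply: le_trans (ler_normB _ _) _; rewrite lerD2l.
  apply: le_trans (pK _ _ As si tB) _; rewrite ler_wpM2r ?subr_ge0//.
  by apply: le_trans (ler_norm K) _; rewrite lerDl.
apply: le_lt_trans (ler_sum _ (fun i _ => le_i i)) _.
rewrite big_split /= -mulr_sumr (splitr e) ltrD//.
by rewrite -ltr_pdivlMl// mulrC.
Qed.

Lemma derive_cst_oo (A B k x df : R) f : (forall z, A < z < B -> f z = k) ->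
  A < x < B -> is_derive x 1 f df -> df = 0.
Proof.
move=> fk xAB [_ <-].
have dc : is_derive x 1 f 0.
  apply: (near_eq_is_derive _ (is_derive_cst k x 1)).
  have xo : x \in (`]A, B[)%R by rewrite in_itv.
  near=> z; rewrite fk//.
  suff : z \in (`]A, B[)%R by rewrite in_itv.
  by near: z; exact: near_in_itvoo.
by have [_ ->] := dc.
Unshelve. all: by end_near. Qed.

Lemma mean_value_oo (A B : R) f f' : (forall x, A < x < B -> is_derive x 1 f (f' x)) ->
  forall x y, A < x -> x < y -> y < B ->
  exists2 c, x < c < y & f y - f x = f' c * (y - x).
Proof.
move=> df x y Ax xy yB.
have sub z : x <= z <= y -> A < z < B.
  by move=> /andP[z1 z2]; rewrite (lt_le_trans Ax) ?(le_lt_trans z2).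
have cf : {within `[x, y], continuous f}.
  apply: derivable_within_continuous => z; rewrite in_itv => zxy.
  by have [] := df z (sub z zxy).
have [|c cxy E] := @MVT _ f f' x y xy _ cf.
  move=> z; rewrite in_itv /= => /andP[z1 z2]; apply: df; apply: sub.
  by rewrite !ltW.
by exists c => //; move: cxy; rewrite in_itv.
Qed.

Lemma monotone_cst_of_limits (A B l : R) f f' :
  (forall x, A < x < B -> is_derive x 1 f (f' x)) ->
  (forall x, A < x < B -> 0 <= f' x) ->
  f x @[x --> A^'+] --> l -> f x @[x --> B^'-] --> l ->
  forall x, A < x < B -> f' x = 0.
Proof.
move=> df f0 fA fB.
have mono x y : A < x -> x <= y -> y < B -> f x <= f y.
  move=> Ax; rewrite le_eqVlt => /predU1P[->//|xy yB].
  have [c /andP[c1 c2] E] := mean_value_oo df Ax xy yB.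
  rewrite -subr_ge0 E mulr_ge0//; last by rewrite subr_ge0 ltW.
  by apply: f0; rewrite (lt_trans Ax c1) (lt_trans c2).
have fl x : A < x < B -> f x = l.
  move=> /andP[Ax xB]; apply/eqP; rewrite eq_le; apply/andP; split.
    apply: (cvgr_to_ge fB); near=> z; apply: mono => //; near: z.
    by apply: filterS (nbhs_left_gt xB) => z /ltW.
  apply: (cvgr_to_le fA); near=> z; apply: mono => //; near: z.
  by apply: filterS (nbhs_right_lt Ax) => z /ltW.
by move=> x xAB; apply: derive_cst_oo fl xAB (df x xAB).
Unshelve. all: by end_near. Qed.

(** Both one-sided limits of the energy in the next proof. *)
Lemma cvg_ode_energy (F : set_system R) {FF : Filter F} (a b c l0 l1 l2 l : R)
    (d0 d1 d2 D : R -> R) :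
  d0 @ F --> l0 -> d1 @ F --> l1 -> d2 @ F --> l2 -> D @ F --> l ->
  (fun x => - b * (d2 x * d2 x / 2 - b * (d0 x * d1 x) - (a * D x) * d1 x +
     a * (d0 x * d0 x) / 2 - c * d1 x)) @ F -->
  - b * (l2 * l2 / 2 - b * (l0 * l1) - (a * l) * l1 + a * (l0 * l0) / 2 - c * l1).
Proof.
move=> h0 h1 h2 h.
have k (e : R) : (fun=> e) @ F --> e by exact: cvg_cst.
have e1 : (fun x => d2 x * d2 x / 2) @ F --> l2 * l2 / 2.
  exact: (cvgM (cvgM h2 h2) (k 2^-1)).
have e2 : (fun x => b * (d0 x * d1 x)) @ F --> b * (l0 * l1).
  exact: (cvgM (k b) (cvgM h0 h1)).
have e3 : (fun x => (a * D x) * d1 x) @ F --> (a * l) * l1.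
  exact: (cvgM (cvgM (k a) h) h1).
have e4 : (fun x => a * (d0 x * d0 x) / 2) @ F --> a * (l0 * l0) / 2.
  exact: (cvgM (cvgM (k a) (cvgM h0 h0)) (k 2^-1)).
have e5 : (fun x => c * d1 x) @ F --> c * l1 by exact: (cvgM (k c) h1).
exact: (cvgM (k (- b)) (cvgB (cvgD (cvgB (cvgB e1 e2) e3) e4) e5)).
Qed.

(** Here D is a primitive of d 0, and d 3 - b d 0 - a D is locally absolutely
    continuous with derivative 0 outside N, hence a constant c. With d 3
    replaced by b d 0 + a D + c, the function E below has derivative (b d 1)^2.
    The boundary conditions give E the same limits at both ends, so that d 1 =
    0. *)
Lemma periodic_ode_unique (a b : R) (d : nat -> R -> R) (D : R -> R) (N : set R) :
  b != 0 ->
  (forall k x, (k < 3)%N -> 0 < x < 2 * pi -> is_derive x 1 (d k) (d k.+1 x)) ->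
  abs_cont_oo 0 (2 * pi) (d 3%N) -> ((wlength idfun)^* N = 0)%mu ->
  (forall x, 0 < x < 2 * pi -> ~ N x -> is_derive x 1 (d 3%N) (b * d 1%N x + a * d 0%N x)) ->
  (forall k, (k <= 3)%N -> exists c : R,
    d k x @[x --> 0^'+] --> c /\ d k x @[x --> (2 * pi)^'-] --> c) ->
  (forall x, 0 < x < 2 * pi -> is_derive x 1 D (d 0%N x)) ->
  D x @[x --> 0^'+] --> D 0 -> D x @[x --> (2 * pi)^'-] --> D (2 * pi) ->
  forall x, 0 < x < 2 * pi -> d 1%N x = 0 /\ a * d 0%N x = 0.
Proof.
move=> b0 dd acd N0 dN lim dD DA DB.
have pi0 := pi_gt0 R.
pose p x := b * d 0%N x + a * D x.
have dp x : 0 < x < 2 * pi -> is_derive x 1 p (b * d 1%N x + a * d 0%N x).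
  move=> xI; have d1 := dd 0%N x isT xI; have d2 := dD x xI.
  exact: is_derive_add (is_derive_scale b d1) (is_derive_scale a d2).
pose w x := d 3%N x - p x.
have wst (s t : R) : 0 < s -> s <= t -> t < 2 * pi -> w s = w t.
  move=> s0 st t2.
  pose A := s / 2; pose B := (t + 2 * pi) / 2.
  have As : A < s by rewrite /A; lra.
  have A0 : 0 < A by rewrite /A; lra.
  have tB : t < B by rewrite /B; lra.
  have B2 : B < 2 * pi by rewrite /B; lra.
  have sub z : A <= z <= B -> 0 < z < 2 * pi by lra.
  have [K pK] : exists K : R, forall z, A <= z <= B -> `|b * d 1%N z + a * d 0%N z| <= K.
    have cq : {within `[A, B], continuous (fun z => `|b * d 1%N z + a * d 0%N z|)}.
      have cq0 : {within `[A, B], continuous (fun z => b * d 1%N z + a * d 0%N z)}.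
        apply: derivable_within_continuous => z; rewrite in_itv => /sub zI.
        have h0 := dd 0%N z isT zI; have h1 := dd 1%N z isT zI.
        by have [] := is_derive_add (is_derive_scale b h1) (is_derive_scale a h0).
      by move=> z; apply: cvg_norm; exact: cq0.
    have AB : A <= B by lra.
    have [c _ cmax] := EVT_max AB cq.
    by eexists => z zAB; apply: cmax; rewrite in_itv.
  have acAB : abs_cont_oo A B (d 3%N).
    move=> e e0; have [del del0 h] := acd e e0; exists del => // n s' t' st'.
    apply: h => i; have [h1 h2 h3] := st' i; split=> //; lra.
  have acw : abs_cont_oo A B w.
    apply: (@abs_cont_lipschitz _ _ K) => // x y Ax; rewrite le_eqVlt => /predU1P[->|xy] yB.
      by rewrite !subrr normr0 mulr0.
    have dpAB z : A < z < B -> is_derive z 1 p (b * d 1%N z + a * d 0%N z).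
      by move=> zAB; apply: dp; apply: sub; lra.
    have [c cxy ->] := mean_value_oo dpAB Ax xy yB.
    by rewrite normrM [X in _ * X]ger0_norm ?subr_ge0 ?(ltW xy)// ler_wpM2r ?subr_ge0 ?(ltW xy)// pK//; lra.
  apply: (abs_cont_derive0_cst acw N0) => // x xAB Nx.
  have xI : 0 < x < 2 * pi by apply: sub; lra.
  have d1 := dN x xI Nx; have d2 := dp x xI.
  by have := is_derive_sub d1 d2; rewrite subrr.
pose c := w pi.
have wc x : 0 < x < 2 * pi -> w x = c.
  move=> /andP[x0 x2]; rewrite /c; have [xpi|xpi] := leP x pi; first by apply: wst => //; lra.
  by apply/esym; apply: wst => //; lra.
have [l0 [l0A l0B]] := lim 0%N isT. have [l1 [l1A l1B]] := lim 1%N isT.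
have [l2 [l2A l2B]] := lim 2%N isT. have [l3 [l3A l3B]] := lim 3%N isT.
have nA : \forall x \near (0:R)^'+, w x = c.
  near=> x; apply: wc; apply/andP; split; near: x; first exact: nbhs_right_gt.
  exact: nbhs_right_lt (twopi_gt0 R).
have nB : \forall x \near (2 * pi : R)^'-, w x = c.
  near=> x; apply: wc; apply/andP; split; near: x; last exact: nbhs_left_lt.
  exact: nbhs_left_gt (twopi_gt0 R).
have cA : c = l3 - (b * l0 + a * D 0).
  have h : w x @[x --> 0^'+] --> l3 - (b * l0 + a * D 0).
    exact: (cvgB l3A (cvgD (cvgM (cvg_cst _) l0A) (cvgM (cvg_cst _) DA))).
  have hc : w x @[x --> 0^'+] --> c by apply: cvg_near_cst; exact: nA.
  by rewrite -(cvg_lim (@Rhausdorff R) hc); exact: (cvg_lim (@Rhausdorff R) h).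
have cB : c = l3 - (b * l0 + a * D (2 * pi)).
  have h : w x @[x --> (2 * pi)^'-] --> l3 - (b * l0 + a * D (2 * pi)).
    exact: (cvgB l3B (cvgD (cvgM (cvg_cst _) l0B) (cvgM (cvg_cst _) DB))).
  have hc : w x @[x --> (2 * pi)^'-] --> c by apply: cvg_near_cst; exact: nB.
  by rewrite -(cvg_lim (@Rhausdorff R) hc); exact: (cvg_lim (@Rhausdorff R) h).
have aD : a * D (2 * pi) = a * D 0 by lra.
(* - b times the bracket: differentiating d 2^2 / 2 and replacing d 3 leaves
   only - b (d 1)^2 after the cross terms cancel. *)
pose E x := - b * (d 2%N x * d 2%N x / 2 - b * (d 0%N x * d 1%N x) - (a * D x) * d 1%N x +
   a * (d 0%N x * d 0%N x) / 2 - c * d 1%N x).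
have dE x : 0 < x < 2 * pi -> is_derive x 1 E ((b * d 1%N x) ^+ 2).
  move=> xI; have h0 := dd 0%N x isT xI; have h1 := dd 1%N x isT xI; have h2 := dd 2%N x isT xI.
  have hD := dD x xI.
  have wx := wc x xI.
  apply: is_derive_eq; rewrite /GRing.scale /=.
  have -> : d 3%N x = c + p x by rewrite -wx /w subrK.
  by rewrite /p; field.
have lE (DD : R) : a * DD = a * D 0 -> - b * (l2 * l2 / 2 - b * (l0 * l1) - (a * DD) * l1 +
   a * (l0 * l0) / 2 - c * l1) = - b * (l2 * l2 / 2 - b * (l0 * l1) - (a * D 0) * l1 +
   a * (l0 * l0) / 2 - c * l1) by move=> ->.
have EA : E x @[x --> 0^'+] --> - b * (l2 * l2 / 2 - b * (l0 * l1) - (a * D 0) * l1 +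
   a * (l0 * l0) / 2 - c * l1).
  exact: cvg_ode_energy l0A l1A l2A DA.
have EB : E x @[x --> (2 * pi)^'-] --> - b * (l2 * l2 / 2 - b * (l0 * l1) - (a * D 0) * l1 +
   a * (l0 * l0) / 2 - c * l1).
  rewrite -(lE _ aD).
  exact: cvg_ode_energy l0B l1B l2B DB.
have d10 x : 0 < x < 2 * pi -> d 1%N x = 0.
  move=> xI; have /eqP := monotone_cst_of_limits dE (fun x _ => sqr_ge0 _) EA EB xI.
  by rewrite sqrf_eq0 mulf_eq0 (negPf b0) /= => /eqP.
have d20 x : 0 < x < 2 * pi -> d 2%N x = 0.
  by move=> xI; apply: derive_cst_oo d10 xI (dd 1%N x isT xI).
have d30 x : 0 < x < 2 * pi -> d 3%N x = 0.
  by move=> xI; apply: derive_cst_oo d20 xI (dd 2%N x isT xI).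
have pc x : 0 < x < 2 * pi -> p x = - c.
  by move=> xI; rewrite -(wc x xI) /w d30// sub0r opprK.
move=> x xI; split; first exact: d10.
by have := derive_cst_oo pc xI (dp x xI); rewrite d10// mulr0 add0r.
Unshelve. all: by end_near. Qed.

End uniqueness.

(** * Periodic extension and complex Fourier coefficients *)

Section fourier_bridge.
Variable R : realType.
Implicit Types (f g u : R -> R) (x y : R) (n m : nat).
Local Notation I := (I2pi R : set (lebesgueType R)).
Local Notation mu := (leb R).
Local Hint Resolve measurable_I : core.

Lemma perext_periodic G x : perext G (x + 2 * pi) = perext G x.
Proof.
have t0 : 2 * pi != 0 :> R by rewrite gt_eqF// twopi_gt0.
rewrite /perext; have -> : (x + 2 * pi) / (2 * pi) = x / (2 * pi) + 1.
  by rewrite [LHS]mulrDl divff.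
rewrite floorDrz ?rpred1// floor1 intrD1 [X in G (_ - X) = _]mulrDr mulr1.
by rewrite opprD addrACA subrr addr0.
Qed.

(** Both ends of a period are included, thanks to G 0 = G (2 pi); continuity of
    the extension at the multiples of 2 pi comes from the two periods that meet
    there. *)
Lemma perext_block G (m : int) x : G 0 = G (2 * pi) ->
  m%:~R * (2 * pi) <= x <= (m + 1)%:~R * (2 * pi) -> perext G x = G (x - m%:~R * (2 * pi)).
Proof.
move=> G0 /andP[mx]; have t0 := twopi_gt0 R; rewrite le_eqVlt => /predU1P[->|xm]; last first.
  rewrite /perext (_ : Num.floor _ = m); first by rewrite mulrC.
  by apply: floor_def; rewrite ler_pdivlMr// mx ltr_pdivrMr.
have -> : (m + 1)%:~R * (2 * pi) - m%:~R * (2 * pi) = 2 * pi :> R.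
  by rewrite -mulrBl intrD1 [_ + 1 - _]addrAC subrr add0r mul1r.
rewrite -G0 /perext mulfK ?gt_eqF// intrKfloor; congr G.
by rewrite [X in X - _]mulrC; exact: subrr.
Qed.

Lemma perext_I G x : G 0 = G (2 * pi) -> x \in I2pi R -> perext G x = G x.
Proof.
move=> G0; rewrite in_I => xI; rewrite (@perext_block _ 0)//.
  by rewrite mul0r subr0.
by rewrite mul0r add0r mul1r.
Qed.

Lemma perext_continuous G : {within I2pi R, continuous G} -> G 0 = G (2 * pi) ->
  continuous (perext G).
Proof.
move=> cG G0.
have t0 := twopi_gt0 R.
have mE (m : int) : (m + 1)%:~R * (2 * pi) = m%:~R * (2 * pi) + 2 * pi :> R.
  by rewrite intrD1 [LHS]mulrDl mul1r.
have epsI y (e : R) : y \in I2pi R -> 0 < e ->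
    exists2 r : R, 0 < r & forall z, z \in I2pi R -> `|y - z| < r -> `|G y - G z| <= e.
  move=> yI e0; have /subspace_continuousP /(_ y) := cG.
  move: (yI); rewrite inE => Iy /(_ Iy) /cvgrPdist_le /(_ _ e0) [r /= r0 rP].
  by exists r => // z zI yz; apply: rP => //; rewrite inE in zI.
have block (m : int) y (e : R) : m%:~R * (2 * pi) <= y <= (m + 1)%:~R * (2 * pi) -> 0 < e ->
    exists2 r : R, 0 < r & forall z, m%:~R * (2 * pi) <= z <= (m + 1)%:~R * (2 * pi) ->
      `|y - z| < r -> `|perext G y - perext G z| <= e.
  move=> yA e0; have shiftI z : m%:~R * (2 * pi) <= z <= (m + 1)%:~R * (2 * pi) ->
      z - m%:~R * (2 * pi) \in I2pi R.
    by rewrite in_I subr_ge0 lerBlDl -mE.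
  have [r r0 rP] := epsI _ _ (shiftI _ yA) e0.
  exists r => // z zA yz; rewrite !(@perext_block G m)//; apply: rP; first exact: shiftI.
  by rewrite (_ : _ - _ = y - z)//; ring.
move=> x; pose m := Num.floor (x / (2 * pi)).
have mx : m%:~R * (2 * pi) <= x by rewrite -ler_pdivlMr// floor_le.
have xm : x < (m + 1)%:~R * (2 * pi) by rewrite -ltr_pdivrMr// floorD1_gt.
apply/cvgrPdist_le => e e0.
have [|r1 r10 h1] := block m x e _ e0; first by rewrite mx ltW.
have [r2 r20 h2] : exists2 r : R, 0 < r & forall z, z < x -> z < m%:~R * (2 * pi) ->
    `|x - z| < r -> `|perext G x - perext G z| <= e.
  move: mx; rewrite le_eqVlt => /predU1P[mx|mx].
    have [|r r0 h] := block (m - 1) x e _ e0.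
      by rewrite subrK -mx lexx andbT ler_wpM2r ?(ltW t0)// ler_int lerBlDr lerDl.
    exists (Num.min r (2 * pi)); first by rewrite lt_min r0.
    move=> z zx _; rewrite lt_min => /andP[zr zp]; apply: h => //.
    have := mE (m - 1); rewrite subrK mx (ltW zx) andbT.
    by move: zp; rewrite ger0_norm ?subr_ge0 ?(ltW zx)//; lra.
  exists (x - m%:~R * (2 * pi)); first by rewrite subr_gt0.
  move=> z zx zm; rewrite ger0_norm ?subr_ge0 ?(ltW zx)//; lra.
exists (Num.min (Num.min r1 r2) ((m + 1)%:~R * (2 * pi) - x)).
  by rewrite /= !lt_min r10 r20 subr_gt0.
move=> z /=; rewrite !lt_min => /andP[/andP[z1 z2] z3].
have [zm|zm] := ltP z (m%:~R * (2 * pi)).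
  by apply: h2 => //; exact: lt_le_trans zm mx.
apply: h1 => //; rewrite zm /=.
move: z3; rewrite ltr_norml; lra.
Qed.

Lemma normc_sqr (z : R[i]) :
  Normc.normc z ^+ 2 = complex.Re z ^+ 2 + complex.Im z ^+ 2.
Proof. by case: z => a b /=; rewrite sqr_sqrtr// addr_ge0// sqr_ge0. Qed.

(** The sign of n only affects the sign of the sine coefficient. *)
Lemma normc_fourier f (n : int) : sqI f ->
  Normc.normc (fourier f n) ^+ 2 = energy f `|n|%N / (2 * pi).
Proof.
move=> sf; pose r : R := Num.sqrt (2 * pi).
have t0 := twopi_gt0 R.
have r2 : r ^+ 2 = 2 * pi by rewrite sqr_sqrtr// ltW.
have r0 : r != 0 by rewrite gt_eqF// sqrtr_gt0.
pose m := `|n|%N.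
have cE x : cos (- (n%:~R * x)) = cosn m x.
  rewrite cosN /cosn /m; case: n {m} => k //=.
  by rewrite NegzE mulrNz mulNr cosN.
have [s s2 sE] : exists2 s : R, s ^+ 2 = 1 & forall x, sin (- (n%:~R * x)) = s * sinn m x.
  rewrite /sinn /m; case: n {m cE} => k.
    by exists (-1) => [|x]; [rewrite sqrrN expr1n|rewrite sinN mulN1r].
  exists 1 => [|x]; first by rewrite expr1n.
  by rewrite NegzE mulrNz mulNr opprK mul1r.
have sc := sqI_mul sf (continuous_sqI (@continuous_cosn R m)).
have ss := sqI_mul sf (continuous_sqI (@continuous_sinn R m)).
have hE x : (f x)%:C%C * (expi (- (n%:~R * x)) / r%:C%C) =
    ((r^-1 * (f x * cosn m x)) +i* ((s / r) * (f x * sinn m x)))%C.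
  rewrite /expi cE sE -fmorphV /=.
  by apply/eqP; rewrite eq_complex /=; apply/andP; split; apply/eqP; ring.
rewrite normc_sqr /fourier /Cint -/r /=.
have -> : \int[leb R]_(x in I2pi R) complex.Re ((f x)%:C%C * (expi (- (n%:~R * x)) / r%:C%C)) =
    r^-1 * fcos f m.
  by rewrite -intIZ//; apply: eq_intI => x _; rewrite hE.
have -> : \int[leb R]_(x in I2pi R) complex.Im ((f x)%:C%C * (expi (- (n%:~R * x)) / r%:C%C)) =
    (s / r) * fsin f m.
  by rewrite -intIZ//; apply: eq_intI => x _; rewrite hE.
transitivity ((fcos f m ^+ 2 + s ^+ 2 * fsin f m ^+ 2) / r ^+ 2).
  by field.
by rewrite s2 mul1r r2.
Qed.

Lemma normc_symb (a b : R) (n : int) :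
  Normc.normc (symb a b n) ^+ 2 = (n%:~R ^+ 4 - a) ^+ 2 + (b * n%:~R) ^+ 2.
Proof. by rewrite normc_sqr /= sqrrN. Qed.

(** Integration by parts over a period. *)
Lemma fourier_derive u u' (n : nat) : (forall x, is_derive x 1 u (u' x)) -> continuous u' ->
  (forall x, u (x + 2 * pi) = u x) ->
  fcos u' n = n%:R * fsin u n /\ fsin u' n = - n%:R * fcos u n.
Proof.
move=> du cu' pu.
have cu : continuous u by move=> x; exact: is_derive_continuous (du x).
have u2 : u (2 * pi) = u 0 by rewrite -[2 * pi]add0r pu.
have su := continuous_sqI cu; have su' := continuous_sqI cu'.
have sc := continuous_sqI (@continuous_cosn R n).
have ss := continuous_sqI (@continuous_sinn R n).
split; apply/eqP; rewrite -subr_eq0; apply/eqP.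
  rewrite /fcos /fsin -intIZ; last exact: sqI_mul.
  rewrite -intIB; last 2 first.
  - exact: (sqI_mul su' sc).
  - exact: (integrableZl measurable_I _ (sqI_mul su ss)).
  have cf : continuous (fun x => u' x * cosn n x + - n%:R * (u x * sinn n x)).
    apply: contD; first exact: (contM cu' (@continuous_cosn R n)).
    exact: (contZ (c := - n%:R) (contM cu (@continuous_sinn R n))).
  rewrite (eq_intI (g := (fun x => u' x * cosn n x + - n%:R * (u x * sinn n x)))); last first.
    by move=> x _; rewrite mulNr.
  apply: (@intI_primitive R (fun x => u x * cosn n x) _ _ cf); last first.
    by rewrite cosn2pi cosn0 u2 subrr.
  move=> x; have d1 := du x; have d2 := is_derive_cosn n x.
  by apply: is_derive_eq; rewrite /GRing.scale /=; ring.
rewrite /fcos /fsin -intIZ; last exact: sqI_mul.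
rewrite -intIB; last 2 first.
- exact: (sqI_mul su' ss).
- exact: (integrableZl measurable_I _ (sqI_mul su sc)).
have cf : continuous (fun x => u' x * sinn n x + n%:R * (u x * cosn n x)).
  apply: contD; first exact: (contM cu' (@continuous_sinn R n)).
  exact: (contZ (c := n%:R) (contM cu (@continuous_cosn R n))).
rewrite (eq_intI (g := (fun x => u' x * sinn n x + n%:R * (u x * cosn n x)))); last first.
  by move=> x _; rewrite mulNr opprK.
apply: (@intI_primitive R (fun x => u x * sinn n x) _ _ cf); last first.
  by rewrite sinn2pi sinn0 !mulr0 subrr.
move=> x; have d1 := du x; have d2 := is_derive_sinn n x.
by apply: is_derive_eq; rewrite /GRing.scale /=; ring.
Qed.

(** On the n-th Fourier mode D^4 - b D - a is multiplication by n^4 - a - i b n,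
    whose squared modulus is the factor on the right. *)
Lemma energy_resolvent (a b : R) G (U : nat -> R -> R) (n : nat) :
  periodic_jet U ->
  (forall x, U 4%N x - b * U 1%N x - a * U 0%N x = G x) ->
  energy G n = ((n%:R ^+ 4 - a) ^+ 2 + (b * n%:R) ^+ 2) * energy (U 0%N) n.
Proof.
move=> [pU cU dU] E.
have F k : (k < 4)%N -> fcos (U k.+1) n = n%:R * fsin (U k) n /\ fsin (U k.+1) n = - n%:R * fcos (U k) n.
  move=> k4; apply: fourier_derive.
  - by move=> x; exact: dU.
  - exact: cU.
  - by move=> x; rewrite pU// ltnW.
have [c1 s1] := F 0%N isT. have [c2 s2] := F 1%N isT.
have [c3 s3] := F 2%N isT. have [c4 s4] := F 3%N isT.
have sU k : (k <= 4)%N -> sqI (U k) by move=> k4; apply: continuous_sqI; exact: cU.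
have lin (c : R -> R) : continuous c -> intI (fun x => G x * c x) =
    intI (fun x => U 4%N x * c x) - b * intI (fun x => U 1%N x * c x) - a * intI (fun x => U 0%N x * c x).
  move=> cc; have sc := continuous_sqI cc.
  have i k : (k <= 4)%N -> mu.-integrable I (EFin \o (fun x => U k x * c x)).
    by move=> k4; exact: (sqI_mul (sU k k4) sc).
  rewrite -(intIZ b); last exact: i.
  rewrite -(intIZ a); last exact: i.
  rewrite -intIB; last 2 first.
  - exact: i.
  - exact: (integrableZl measurable_I _ (i 1%N isT)).
  rewrite -intIB; last 2 first.
  - exact: (integrableB measurable_I (i 4%N isT) (integrableZl measurable_I b (i 1%N isT))).
  - exact: (integrableZl measurable_I _ (i 0%N isT)).
  by apply: eq_intI => x _; rewrite -E; ring.
have Gc : fcos G n = (n%:R ^+ 4 - a) * fcos (U 0%N) n - b * n%:R * fsin (U 0%N) n.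
  rewrite /fcos (lin _ (@continuous_cosn R n)) -/(fcos (U 4%N) n) -/(fcos (U 1%N) n) -/(fcos (U 0%N) n).
  by rewrite c4 s3 c2 s1 c1; ring.
have Gs : fsin G n = (n%:R ^+ 4 - a) * fsin (U 0%N) n + b * n%:R * fcos (U 0%N) n.
  rewrite /fsin (lin _ (@continuous_sinn R n)) -/(fsin (U 4%N) n) -/(fsin (U 1%N) n) -/(fsin (U 0%N) n).
  by rewrite s4 c3 s2 c1 s1; ring.
by rewrite /energy Gc Gs; ring.
Qed.

End fourier_bridge.

(** * The nonlinearity and membership in H^4 *)

Section admissible.
Variable R : realType.
Implicit Types (f g p q u v : R -> R) (x y : R) (n : nat).
Local Notation I := (I2pi R : set (lebesgueType R)).
Local Hint Resolve measurable_I : core.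

(** The composition is the limit of F (q y) y, where q y is v y rounded down to
    a multiple of 1 / (n + 1). Such a q takes countably many values, on each of
    which F has a fixed first argument. *)
Lemma measurable_Nemytskii (F : R -> R -> R) (l : R) (v : R -> R) :
  0 <= l -> (forall u : R, measI (F u)) ->
  (forall u1 u2 : R, {in I2pi R, forall x, `|F u1 x - F u2 x| <= l * `|u1 - u2|}) ->
  measI v -> measI (fun y => F (v y) y).
Proof.
move=> l0 mF Fl mv.
pose k (n : nat) (y : R) : int := Num.floor (n.+1%:R * v y).
pose q (n : nat) (j : int) : R := j%:~R / n.+1%:R.
apply: (@measurable_fun_cvg _ _ _ I (fun n y => F (q n (k n y)) y)) => [n|y Iy].
  move=> _ B mB.
  rewrite (_ : _ `&` _ = \bigcup_j ((I `&` v @^-1` `[q n j, q n (j + 1)[) `&`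
      (I `&` F (q n j) @^-1` B))); last first.
    have n0 : (0 < n.+1%:R :> R) by [].
    apply/seteqP; split => y /=.
      move=> [Iy By]; exists (k n y) => //; split; split => //=.
      rewrite in_itv /= /q ler_pdivrMr// ltr_pdivlMr//.
      rewrite [v y * _]mulrC; apply/andP; split; first exact: floor_le.
      exact: floorD1_gt.
    move=> [j _ [[Iy vy] [_ By]]]; split => //=.
    suff -> : k n y = j by [].
    move: vy; rewrite /= in_itv /= /q ler_pdivrMr// ltr_pdivlMr// [v y * _]mulrC.
    by move=> /floor_def.
  apply: countable_bigcupT_measurable => // j.
  apply: measurableI; first by apply: mv => //; exact: measurable_itv.
  by apply: mF.
have yI : y \in I2pi R by rewrite inE.
have qc : (fun n => q n (k n y)) @ \oo --> v y.
  apply/cvgrPdist_le => e e0; near=> n.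
  have n0 : (0 < n.+1%:R :> R) by [].
  pose z := n.+1%:R * v y.
  have := floor_le z; have := floorD1_gt z; rewrite intrD1 => z1 z2.
  rewrite (_ : v y - _ = (z - (Num.floor z)%:~R) / n.+1%:R); last first.
    by rewrite mulrBl /z mulrAC divff ?mul1r// lt0r_neq0.
  rewrite normrM normfV [X in _ / X]ger0_norm ?ler_pdivrMr; [|by []..].
  rewrite ger0_norm ?subr_ge0//.
  apply: (@le_trans _ _ 1); first lra.
  rewrite -ler_pdivrMl// mulr1; near: n.
  by exists (Num.truncn e^-1) => // n /= en; apply: ltW; rewrite (lt_le_trans (truncnS_gt _))// ler_nat ltnS.
apply/cvgrPdist_le => e e0.
move/cvgrPdist_le : qc => /(_ (e / (l + 1)))[|N _ NP].
  by rewrite divr_gt0// ltr_wpDl.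
exists N => // n /= /NP; rewrite ler_pdivlMr ?ltr_wpDl// => vq.
apply: le_trans (Fl _ _ _ yI) _.
by apply: le_trans vq; rewrite mulrC ler_wpM2l// lerDl.
Unshelve. all: by end_near. Qed.

Definition Nemytskii (F : R -> R -> R) v : R -> R := fun y => F (v y) y.
(** The functions to which the contraction principle is applied: they include
    H^4 and are stable under uniform limits. *)
Definition bddmeas v : Prop := measI v /\ exists M : R, forall x, x \in I2pi R -> `|v x| <= M.

Lemma convGF_conv G F v x : convGF G F v x = conv (perext G) (Nemytskii F v) x.
Proof. by []. Qed.

Lemma sqI_Nemytskii F k l h v : assumptionA F k l h -> bddmeas v -> sqI (Nemytskii F v).
Proof.
move=> [mF [_ [k0 [l0 [h0 [h2 [Fk Fl]]]]]]] [mv [M vM]].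
have M0 : 0 <= M by apply: le_trans (vM 0 _) => //; rewrite in_I lexx ltW ?twopi_gt0.
have sh := L2I_sqI h2.
have s1 : sqI (cst (k * M)) by apply: continuous_sqI; exact: cst_continuous.
apply: sqI_dom (sqID s1 sh) _.
  exact: measurable_Nemytskii (ltW l0) mF Fl mv.
move=> x xI; apply: le_trans (Fk _ _ xI) _; rewrite lerD2r ler_wpM2l ?(ltW k0)//.
exact: vM.
Qed.

Lemma bddmeas_sqI v : bddmeas v -> sqI v.
Proof. by move=> [mv [M vM]]; exact: bounded_sqI vM. Qed.

Lemma Nemytskii_lipschitz F k l h v w : assumptionA F k l h -> bddmeas v -> bddmeas w ->
  intI (fun x => (Nemytskii F v x - Nemytskii F w x) ^+ 2) <= l ^+ 2 * intI (fun x => (v x - w x) ^+ 2).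
Proof.
move=> A av aw; have [_ [_ [_ [l0 [_ [_ [_ Fl]]]]]]] := A.
have [_ i1] := sqIB (sqI_Nemytskii A av) (sqI_Nemytskii A aw).
have [_ i2] := sqIB (bddmeas_sqI av) (bddmeas_sqI aw).
rewrite -intIZ//; apply: le_intI => //.
  exact: (integrableZl measurable_I _ i2).
move=> x xI; rewrite -exprMn -(real_normK (num_real (_ - _))).
rewrite -[leRHS](real_normK (num_real _)) lerXn2r ?nnegrE// normrM (gtr0_norm l0).
exact: Fl.
Qed.

Lemma convB p f g x : continuous p -> has_bound p -> sqI f -> sqI g ->
  conv p (fun y => f y - g y) x = conv p f x - conv p g x.
Proof.
move=> cp bp sf sg; rewrite /conv -intIB; last 2 first.
- exact: conv_integrable (sqI_integrable sf).
- exact: conv_integrable (sqI_integrable sg).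
by apply: eq_intI => y _; rewrite mulrBr.
Qed.

Lemma lipschitz_of_derive u u' (K : R) : (forall x, is_derive x 1 u (u' x)) ->
  (forall x, `|u' x| <= K) -> forall x y, `|u x - u y| <= K * `|x - y|.
Proof.
move=> du uK.
have H x y : x < y -> `|u y - u x| <= K * (y - x).
  move=> xy.
  have dA z : x - 1 < z < y + 1 -> is_derive z 1 u (u' z) by [].
  have [||c _ ->] := mean_value_oo dA _ xy; [lra|lra|].
  by rewrite normrM [X in _ * X]ger0_norm ?subr_ge0 ?(ltW xy)// ler_wpM2r ?subr_ge0 ?(ltW xy).
move=> x y; have [xy|xy|->] := ltgtP x y.
- by rewrite distrC [X in _ * X]distrC [X in _ * X]ger0_norm ?subr_ge0 ?(ltW xy)// H.
- by rewrite [X in _ * X]ger0_norm ?subr_ge0 ?(ltW xy)// H.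
- by rewrite !subrr normr0 mulr0.
Qed.

(** In particular the third derivative is absolutely continuous because it is
    Lipschitz. *)
Lemma periodic_jet_H4 (V : nat -> R -> R) :
  periodic_jet V ->
  H4 (V 0%N) /\ forall k, (k <= 4)%N -> derive1n k (V 0%N) = V k.
Proof.
move=> jV; have [pV cV dV] := jV.
have D k : (k <= 4)%N -> derive1n k (V 0%N) = V k.
  elim: k => [//|k IH] k4; rewrite derive1nS; apply/funext => x.
  rewrite IH ?(ltnW k4)//.
  by rewrite derive1E; have [_ ->] := dV k x k4.
have V2 k : (k <= 4)%N -> V k (2 * pi) = V k 0 by move=> k4; rewrite -[2 * pi]add0r pV.
split => //; split; first by apply: continuous_subspaceT; exact: cV.
split; first by move=> k k3 x _; rewrite D ?(leq_trans (ltnW k3))//; have [] := dV k x (ltnW k3).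
split.
  rewrite D//; have [K KP] := periodic_jet_bounded jV (leqnn 4).
  have L := lipschitz_of_derive (fun x => dV 3%N x isT) KP.
  have K0 : 0 < `|K| + 1 by rewrite ltr_wpDl.
  move=> e e0; exists (e / (`|K| + 1)); first by rewrite divr_gt0.
  move=> n s t st _; rewrite ltr_pdivlMr// mulrC => h; apply: le_lt_trans h.
  rewrite mulr_sumr; apply: ler_sum => i _; have [_ sti _] := st i.
  apply: le_trans (L _ _) _; rewrite ger0_norm ?subr_ge0// ler_wpM2r ?subr_ge0//.
  by apply: le_trans (ler_norm K) _; rewrite lerDl.
split; first by apply: aeW => x _; rewrite D//; have [] := dV 3%N x isT.
have L2 k : (k <= 4)%N -> L2I (V k).
  move=> k4; have [M [_ VM]] := continuous_bounded_I (cV k k4).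
  exact: bounded_L2I (continuous_measI (cV k k4)) VM.
split; first exact: L2.
split; first by rewrite D//; exact: L2.
split; first by rewrite V2.
move=> k /andP[_ k3]; have k4 : (k <= 4)%N by exact: leq_trans k3 _.
rewrite D//; exists (V k 0); split; first by apply: cvg_at_right_filter; exact: cV.
by rewrite -(V2 k k4); apply: cvg_at_left_filter; exact: cV.
Qed.

Lemma H4_bddmeas u : H4 u -> bddmeas u.
Proof.
move=> [cu _]; split; first exact: within_continuous_measI.
have cn : {within `[0, 2 * pi], continuous (fun x => `|u x|)}.
  by move=> x; apply: cvg_norm; exact: cu.
have [c _ cmax] := EVT_max (ltW (twopi_gt0 R)) cn.
exists `|u c| => x; rewrite in_I => xI.
by apply: cmax; rewrite in_itv.
Qed.

End admissible.

(** * Bounds on the resolvent *)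

Section resolvent_bounds.
Variable R : realType.
Implicit Types (f : R -> R) (x y : R) (n : nat).
Local Notation I := (I2pi R : set (lebesgueType R)).
Local Notation mu := (leb R).
Local Hint Resolve measurable_I : core.

(** As l > 0, the strict inequality excludes an infinite norm. *)
Lemma Nab_finite (G : R -> R) (a b l : R) : 0 < l ->
  ((2 * Num.sqrt pi)%:E * Nab G a b * l%:E < 1)%E ->
  exists N : R, [/\ 0 <= N, 4 * pi * (N ^+ 2) * l ^+ 2 < 1 &
    forall n, Normc.normc (fourier G n / symb a b n) <= N].
Proof.
move=> l0 hN.
have s0 : 0 < 2 * Num.sqrt pi :> R by rewrite mulr_gt0// sqrtr_gt0 pi_gt0.
have ub n : ((Normc.normc (fourier G n / symb a b n))%:E <= Nab G a b)%E.
  by rewrite /Nab le_max; apply/orP; left; apply: ereal_sup_ubound; exists n.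
have N0 : (0%:E <= Nab G a b)%E.
  by apply: le_trans (ub 0); rewrite lee_fin; case: (_ / _) => x y /=; rewrite sqrtr_ge0.
move: N0 ub hN; case: (Nab G a b) => [N N0 ub hN|_ _|//]; last first.
  by rewrite gt0_muley ?lte_fin// gt0_mulye ?lte_fin.
rewrite lee_fin in N0; exists N; split => //.
rewrite -!EFinM lte_fin in hN.
have -> : 4 * pi * N ^+ 2 * l ^+ 2 = (2 * Num.sqrt pi * N * l) ^+ 2.
  by rewrite !exprMn sqr_sqrtr ?(ltW (pi_gt0 R))// -natrX.
by rewrite expr_lt1// !mulr_ge0 ?(ltW l0)// ?sqrtr_ge0.
Qed.

(** Where the symbol does not vanish, the coefficient of U 0 is that of G
    divided by the symbol. It vanishes only for n = 0 and a = 0, where the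
    coefficient of U 0 is its mean value. *)
Lemma resolvent_energy_bound (a b : R) (G : R -> R) (N : R) (U : nat -> R -> R) :
  b != 0 -> sqI G ->
  (forall n, energy G n = ((n%:R ^+ 4 - a) ^+ 2 + (b * n%:R) ^+ 2) * energy (U 0%N) n) ->
  (a = 0 -> intI (U 0%N) = 0) ->
  (forall n, Normc.normc (fourier G n / symb a b n) <= N) ->
  forall n, energy (U 0%N) n <= 2 * pi * N ^+ 2.
Proof.
move=> b0 sG EG i0 GN n.
have N0 : 0 <= N.
  by apply: le_trans (GN 0); case: (_ / _) => x y /=; rewrite sqrtr_ge0.
have tp := twopi_gt0 R.
have r0 : 0 <= 2 * pi * N ^+ 2 by rewrite mulr_ge0 ?(ltW tp)// sqr_ge0.
have := normc_symb a b n; rewrite -pmulrn => Es.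
have [s0|s0] := eqVneq ((n%:R ^+ 4 - a) ^+ 2 + (b * n%:R) ^+ 2) 0.
  move/eqP: s0; rewrite paddr_eq0 ?sqr_ge0// !sqrf_eq0 mulf_eq0 (negbTE b0)/= pnatr_eq0.
  move=> /andP[/eqP h /eqP n0]; move: h; rewrite n0 expr0n/= sub0r => /eqP.
  rewrite oppr_eq0 => /eqP a0.
  by rewrite /energy fsin0 fcos0 i0// expr0n addr0.
have z0 : symb a b n != 0.
  by apply: contra_neq s0 => s0; rewrite -Es s0 normc_sqr/= expr0n addr0.
have q0 : 0 <= Normc.normc (fourier G n / symb a b n).
  by case: (_ / _) => x y /=; rewrite sqrtr_ge0.
have GN2 := lerXn2r 2 q0 N0 (GN n).
have E1 : Normc.normc (fourier G n / symb a b n) ^+ 2 * Normc.normc (symb a b n) ^+ 2 =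
    energy G n / (2 * pi).
  by rewrite -exprMn -Normc.normcM divfK// normc_fourier.
rewrite Es EG in E1.
have -> : energy (U 0%N) n = 2 * pi * (Normc.normc (fourier G n / symb a b n) ^+ 2).
  by apply: (mulfI s0); rewrite [RHS]mulrCA [X in _ = _ * X]mulrC E1 [RHS]mulrC divfK ?gt_eqF.
by rewrite ler_wpM2l// ltW.
Qed.

Lemma conv_jet (U : nat -> R -> R) f : periodic_jet U -> sqI f ->
  periodic_jet (fun k => conv (U k) f).
Proof.
move=> jU sf; have [pU cU dU] := jU; have sI := sqI_integrable sf.
split => [k x k4|k k4|k x k4].
- by apply: conv_periodic => y; exact: pU.
- by apply: conv_continuous => //; [exact: cU|exact: periodic_jet_bounded jU k4].
- have k4' := ltnW k4; have b1 := periodic_jet_bounded jU k4'.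
  have b2 := periodic_jet_bounded jU k4.
  by apply: conv_derive => //; [exact: cU|move=> y; exact: dU].
Qed.

Lemma conv_ode (U : nat -> R -> R) (a b : R) P f : periodic_jet U ->
  (forall x, U 4%N x - b * U 1%N x - a * U 0%N x = P x) -> sqI f ->
  forall x, conv (U 4%N) f x - b * conv (U 1%N) f x - a * conv (U 0%N) f x = conv P f x.
Proof.
move=> jU eU sf x; have sI := sqI_integrable sf; have [_ cU _] := jU.
have iU k : (k <= 4)%N -> mu.-integrable I (EFin \o (fun y => U k (x - y) * f y)).
  move=> k4; apply: conv_integrable => //; first exact: cU.
  exact: periodic_jet_bounded jU k4.
have iZ k c : (k <= 4)%N -> mu.-integrable I (EFin \o (fun y => c * (U k (x - y) * f y))).
  by move=> k4; exact: (integrableZl measurable_I _ (iU k k4)).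
rewrite /conv -!intIZ ?iU// -!intIB ?iU ?iZ//.
- by apply: eq_intI => y _; rewrite -eU; ring.
- exact: (integrableB measurable_I (iU 4%N isT) (iZ 1%N b isT)).
Qed.

End resolvent_bounds.

(** * Uniqueness for the auxiliary equation in H^4 *)

Section h4_uniqueness.
Variable R : realType.
Implicit Types (f q u : R -> R) (x y : R).
Local Notation mu := (leb R).

Lemma constant_closure_I q (c : R) : continuous q -> (forall x, 0 < x < 2 * pi -> q x = c) ->
  forall x, x \in I2pi R -> q x = c.
Proof.
move=> cq qc; have tp := twopi_gt0 R.
have e0 : q 0 = c.
  have h1 : q x @[x --> 0^'+] --> q 0 by apply: cvg_at_right_filter; exact: cq.
  have h2 : q x @[x --> 0^'+] --> c.
    apply: cvg_near_cst; near=> x; apply: qc; apply/andP; split.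
      by near: x; exact: nbhs_right_gt.
    by near: x; exact: nbhs_right_lt.
  exact: cvg_unique h1 h2.
have e1 : q (2 * pi) = c.
  have h1 : q x @[x --> (2 * pi)^'-] --> q (2 * pi) by apply: cvg_at_left_filter; exact: cq.
  have h2 : q x @[x --> (2 * pi)^'-] --> c.
    apply: cvg_near_cst; near=> x; apply: qc; apply/andP; split.
      by near: x; exact: nbhs_left_gt.
    by near: x; exact: nbhs_left_lt.
  exact: cvg_unique h1 h2.
move=> x; rewrite in_I !le_eqVlt => /andP[/orP[/eqP<-//|x0]] /orP[/eqP->//|x1].
by apply: qc; rewrite x0 x1.
Unshelve. all: by end_near.
Qed.

Lemma derivable_is_derive1 f k x : derivable (derive1n k f) x 1 ->
  is_derive x 1 (derive1n k f) (derive1n k.+1 f x).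
Proof. by move=> d; rewrite derive1nS derive1E; apply: DeriveDef. Qed.

Lemma ae_leb_outer (P : R -> Prop) : {ae mu, forall x, P x} ->
  exists2 N : set R, ((wlength idfun)^* N = 0)%mu & forall x, ~ N x -> P x.
Proof.
move=> [N [mN N0 PN]]; exists N; first exact: N0.
by move=> x Nx; apply: contrapT => nP; apply: Nx; exact: PN.
Qed.

Lemma ae_leb_imply2 (P Q S : R -> Prop) : (forall x, P x -> Q x -> S x) ->
  {ae mu, forall x, P x} -> {ae mu, forall x, Q x} -> {ae mu, forall x, S x}.
Proof.
move=> PQS [A [mA A0 PA]] [B [mB B0 QB]]; exists (A `|` B); split.
- exact: measurableU.
- by rewrite measureU0.
- move=> x nS; apply: contrapT => /not_orP[nA nB]; apply: nS; apply: PQS.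
    by apply: contrapT => nP; apply: nA; exact: PA.
  by apply: contrapT => nQ; apply: nB; exact: QB.
Qed.

(** The difference of u and V 0 satisfies the hypotheses of periodic_ode_unique.
    It is therefore constant on the open interval, and this constant is 0: by
    the equation if a is not 0, and by the mean value condition if a = 0. The
    continuous function perext u replaces u where a function continuous on the
    whole line is needed. *)
Lemma H4_unique (a b : R) u f (V : nat -> R -> R) : b != 0 ->
  periodic_jet V ->
  (forall x, V 4%N x - b * V 1%N x - a * V 0%N x = f x) ->
  H4 u ->
  {ae leb R, forall x, x \in I2pi R ->
     derive1n 4 u x - b * derive1n 1 u x - a * u x = f x} ->
  (a = 0 -> intI u = intI (V 0%N)) ->
  {in I2pi R, u =1 V 0%N}.
Proof.
move=> b0 jV eV Hu aeQ i0; have [cu [du [ac [ae3 [_ [_ [u02 lim]]]]]]] := Hu; have [pV cV dV] := jV.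
have tp := twopi_gt0 R.
have pI : 0 < (pi : R) < 2 * pi by have := pi_gt0 R; lra.
have oI x : 0 < x < 2 * pi -> x \in I2pi R.
  by move=> /andP[h1 h2]; rewrite in_I !ltW.
have du' k x : (k < 3)%N -> 0 < x < 2 * pi -> derivable (derive1n k u) x 1.
  by move=> k3 xI; apply: (du k k3); rewrite inE /= in_itv.
have V2 k : (k <= 4)%N -> V k (2 * pi) = V k 0 by move=> k4; rewrite -[2 * pi]add0r pV.
pose d k x := derive1n k u x - V k x.
pose q x := perext u x - V 0%N x.
have cq : continuous q.
  by move=> x; apply: cvgB; [exact: perext_continuous|exact: cV].
have qE x : x \in I2pi R -> q x = d 0%N x by move=> xI; rewrite /q perext_I.
have [D dD] := primitive_exists cq.
have cD x : {for x, continuous D} by exact: is_derive_continuous (dD x).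
have ae2 : {ae mu, forall x, x \in I2pi R -> derivable (derive1n 3 u) x 1 /\
    derive1n 4 u x - b * derive1n 1 u x - a * u x = f x}.
  by apply: (ae_leb_imply2 _ ae3 aeQ) => x h1 h2 xI; split; [exact: h1|exact: h2].
have [N N0 NP] := ae_leb_outer ae2.
have [K KP] := periodic_jet_bounded jV (leqnn 4).
have L := lipschitz_of_derive (fun x => dV 3%N x isT) KP.
have H := @periodic_ode_unique R a b d D N b0.
have [H0 H1] : (forall x, 0 < x < 2 * pi -> d 1%N x = 0) /\ (forall x, 0 < x < 2 * pi -> a * d 0%N x = 0).
  suff H' : forall x, 0 < x < 2 * pi -> d 1%N x = 0 /\ a * d 0%N x = 0.
    by split => x xI; have [] := H' x xI.
  apply: H.
  - move=> k x k3 xI; apply: is_derive_sub; last exact: dV (ltnW k3).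
    by apply: derivable_is_derive1; exact: du'.
  - apply: abs_cont_lipschitz ac _ => x y _ xy _.
    by apply: le_trans (L y x) _; rewrite ger0_norm ?subr_ge0.
  - exact: N0.
  - move=> x xI nN; have [h1 h2] := NP x nN (oI x xI).
    have -> : b * d 1%N x + a * d 0%N x = derive1n 4 u x - V 4%N x.
      by move: h2 (eV x); rewrite /d/= => <-; lra.
    apply: is_derive_sub; last exact: dV.
    by apply: derivable_is_derive1; exact: h1.
  - have VL k : (k <= 4)%N -> V k x @[x --> 0^'+] --> V k 0 /\ V k x @[x --> (2 * pi)^'-] --> V k 0.
      move=> k4; split; first by apply: cvg_at_right_filter; exact: cV.
      by rewrite -(V2 k k4); apply: cvg_at_left_filter; exact: cV.
    case=> [_|k k3].
      have [_ ur ul] := (continuous_within_itvP u tp).1 cu.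
      have [v1 v2] := VL 0%N isT.
      by exists (u 0 - V 0%N 0); split; apply: cvgB => //; rewrite u02.
    have [c [c1 c2]] := lim k.+1 k3; have [v1 v2] := VL k.+1 (leq_trans k3 (leqnSn 3)).
    by exists (c - V k.+1 0); split; apply: cvgB.
  - by move=> x xI; rewrite -qE ?oI.
  - by apply: cvg_at_right_filter; exact: cD.
  - by apply: cvg_at_left_filter; exact: cD.
have [c qc] : exists c, forall x, 0 < x < 2 * pi -> q x = c.
  have dd x : 0 < x < 2 * pi -> is_derive x 1 (d 0%N) (d 1%N x).
    move=> xI; apply: is_derive_sub; last exact: dV.
    by apply: derivable_is_derive1; exact: du'.
  exists (d 0%N pi) => x xI; rewrite qE ?oI//.
  have [/andP[x0 x1] /andP[p0 p1]] := (xI, pI).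
  have [xp|xp|->//] := ltgtP x pi.
    have [y /andP[y0 y1] /eqP] := mean_value_oo dd x0 xp p1.
    rewrite H0 ?mul0r ?subr_eq0; first by move=> /eqP.
    by rewrite (lt_trans x0 y0) (lt_trans y1 p1).
  have [y /andP[y0 y1] /eqP] := mean_value_oo dd p0 xp x1.
  rewrite H0 ?mul0r ?subr_eq0; first by move=> /eqP.
  by rewrite (lt_trans p0 y0) (lt_trans y1 x1).
have qcI := constant_closure_I cq qc.
suff c0 : c = 0.
  by move=> x xI; apply/eqP; rewrite -subr_eq0 -[u x - V 0%N x]/(d 0%N x) -qE// qcI// c0.
have [a0|a0] := eqVneq a 0; last first.
  have := H1 pi pI; rewrite -qE ?oI// qc// => /eqP; rewrite mulf_eq0 (negbTE a0)/=.
  by move=> /eqP.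
have : intI q = 0.
  rewrite (@eq_intI _ q (fun x => u x - V 0%N x)) ?intIB ?i0 ?subrr//.
  - apply: sqI_integrable; apply: bddmeas_sqI; apply: H4_bddmeas.
    exact: Hu.
  - exact: continuous_integrable_I (cV 0%N isT).
rewrite (eq_intI qcI) intI_cst => /eqP; rewrite mulf_eq0 (gt_eqF tp) orbF.
by move=> /eqP.
Qed.

End h4_uniqueness.

(** * A contraction principle in the L^2 norm *)

Section contraction.
Variable R : realType.
Implicit Types (q v : R -> R) (x y : R) (n m : nat).
Local Notation I := (I2pi R : set (lebesgueType R)).
Local Notation mu := (leb R).
Local Hint Resolve measurable_I : core.

(** The sequences s n - e n and s n + e n, with e the tail of the geometric
    series, are nondecreasing and nonincreasing; the limit is the supremum of
    the former. *)
Lemma geometric_limit (s : nat -> R) (K r : R) : 0 <= K -> 0 <= r < 1 ->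
  (forall n, `|s n.+1 - s n| <= K * r ^+ n) ->
  exists l, forall n, `|l - s n| <= K * r ^+ n / (1 - r).
Proof.
move=> K0 /andP[r0 r1] sK; have r1' : 1 - r != 0 by rewrite subr_eq0 gt_eqF.
pose e n := K * r ^+ n / (1 - r).
have eS n : e n = K * r ^+ n + e n.+1 by rewrite /e exprS; field.
have e0 n : 0 <= e n.
  by rewrite /e divr_ge0 ?subr_ge0 ?(ltW r1)// mulr_ge0// exprn_ge0.
have ai n m : (n <= m)%N -> s n - e n <= s m - e m.
  apply: (@homo_leq _ (fun k => s k - e k) (fun x y => x <= y)) => //.
    by move=> x y z; apply: le_trans.
  by move=> k; have := sK k; rewrite ler_norml (eS k) => /andP[h _]; lra.
have bd n m : (n <= m)%N -> s m + e m <= s n + e n.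
  move=> nm; rewrite -lerN2.
  apply: (@homo_leq _ (fun k => - (s k + e k)) (fun x y => x <= y)) nm => //.
    by move=> x y z; apply: le_trans.
  by move=> k; have := sK k; rewrite ler_norml (eS k) => /andP[_ h]; lra.
have ab n m : s n - e n <= s m + e m.
  apply: le_trans (ai n (maxn n m) (leq_maxl _ _)) _.
  apply: le_trans (bd m (maxn n m) (leq_maxr _ _)).
  by rewrite lerD2l ge0_cp// e0.
pose A := [set s n - e n | n in [set: nat]].
have uA m : ubound A (s m + e m) by move=> _ [n _ <-]; exact: ab.
exists (sup A) => n; rewrite ler_distl -/(e n); apply/andP; split.
  by apply: ub_le_sup; [exists (s 0%N + e 0%N); exact: uA|exists n].
by apply: ge_sup; [exists (s 0%N - e 0%N), 0%N|exact: uA].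
Qed.

Lemma geometric_squeeze (z B r : R) : 0 <= r < 1 ->
  (forall n, `|z| <= B * r ^+ n) -> z = 0.
Proof.
move=> /andP[r0 r1] zB; apply/eqP; rewrite -normr_le0.
have : (fun n => B * r ^+ n) @ \oo --> B * 0.
  by apply: (cvgM (cvg_cst _)); apply: cvg_expr; rewrite ger0_norm.
rewrite mulr0 => h; rewrite -(cvg_lim _ h)//.
by apply: limr_ge; [exact: cvgP h|apply: nearW => n; exact: zB].
Qed.

(** The increments of the iterates decrease geometrically in L^2, hence
    uniformly, because T maps L^2 bounds to uniform bounds. The uniform limit is
    a bounded measurable function, which satisfies the fixed point equation at
    every point. *)
Lemma L2_contraction (T : (R -> R) -> R -> R) (q C : R) :
  0 <= q < 1 -> 0 <= C ->
  (forall v, bddmeas v -> bddmeas (T v)) ->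
  (forall v w, bddmeas v -> bddmeas w ->
    intI (fun x => (T v x - T w x) ^+ 2) <= q * intI (fun x => (v x - w x) ^+ 2)) ->
  (forall v w x, bddmeas v -> bddmeas w ->
    `|T v x - T w x| ^+ 2 <= C * intI (fun x => (v x - w x) ^+ 2)) ->
  exists2 V, bddmeas V & forall x, T V x = V x.
Proof.
move=> /andP[q0 q1] C0 aT Tq TC.
pose v n := iter n T (cst 0).
have av n : bddmeas (v n).
  elim: n => [|n IH]; last exact: aT.
  by split; [exact: measurable_cst|exists 0 => x _; rewrite normr0].
pose de := intI (fun x => (v 1%N x - v 0%N x) ^+ 2).
have de0 : 0 <= de by apply: intI_ge0 => x _; exact: sqr_ge0.
have dq n : intI (fun x => (v n.+1 x - v n x) ^+ 2) <= q ^+ n * de.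
  elim: n => [|n IH]; first by rewrite mul1r.
  apply: le_trans (Tq _ _ (av n.+1) (av n)) _.
  by rewrite exprS -mulrA ler_wpM2l.
pose r := Num.sqrt q; pose K := Num.sqrt (C * de).
have r0 : 0 <= r by exact: sqrtr_ge0.
have r1 : r < 1 by rewrite -(@sqrtr1 R) ltr_sqrt.
have rr : 0 <= r < 1 by rewrite r0.
have K0 : 0 <= K by exact: sqrtr_ge0.
have vK x n : `|v n.+2 x - v n.+1 x| <= K * r ^+ n.
  rewrite -(@ler_pXn2r _ 2)// ?nnegrE// ?mulr_ge0 ?exprn_ge0//.
  apply: le_trans (TC _ _ x (av n.+1) (av n)) _.
  rewrite exprMn exprAC !sqr_sqrtr ?mulr_ge0// -mulrA ler_wpM2l// mulrC.
  exact: dq.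
have [V VP] := choice (fun x => geometric_limit K0 rr (vK x)).
have r1' : 0 < 1 - r by rewrite subr_gt0.
have cv x : v n.+1 x @[n --> \oo] --> V x.
  apply: (@squeeze_cvgr _ _ _ _ (fun n => V x - K / (1 - r) * r ^+ n)
    (fun n => V x + K / (1 - r) * r ^+ n)).
  - apply: nearW => n; have := VP x n; rewrite distrC ler_distl mulrAC.
    by [].
  - rewrite -[X in _ --> X]subr0; apply: cvgB; first exact: cvg_cst.
    by rewrite -[X in _ --> X](mulr0 (K / (1 - r))); apply: (cvgM (cvg_cst _)); apply: cvg_expr; rewrite ger0_norm.
  - rewrite -[X in _ --> X]addr0; apply: cvgD; first exact: cvg_cst.
    by rewrite -[X in _ --> X](mulr0 (K / (1 - r))); apply: (cvgM (cvg_cst _)); apply: cvg_expr; rewrite ger0_norm.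
have aV : bddmeas V.
  split; first by apply: (measurable_fun_cvg (fun m => (av m.+1).1)) => x _; exact: cv.
  have [M vM] := (av 1%N).2; exists (M + K / (1 - r)) => x xI.
  have := VP x 0%N; rewrite expr0 mulr1 => h.
  rewrite -[V x](subrK (v 1%N x)) addrC; apply: le_trans (ler_normD _ _) _.
  by apply: lerD => //; exact: vM.
exists V => // x; apply/eqP; rewrite -subr_eq0; apply/eqP.
pose S := Num.sqrt (C * (2 * pi)).
have S0 : 0 <= S by exact: sqrtr_ge0.
have tp := twopi_gt0 R; have tp0 := ltW tp.
have Kr0 m : 0 <= K / (1 - r) * r ^+ m.
  by rewrite mulr_ge0 ?exprn_ge0// divr_ge0 ?(ltW r1').
have sB w w' : bddmeas w -> bddmeas w' -> mu.-integrable I (EFin \o (fun x => (w x - w' x) ^+ 2)).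
  by move=> aw aw'; have [] := sqIB (bddmeas_sqI aw) (bddmeas_sqI aw').
apply: (@geometric_squeeze _ (S * (K / (1 - r)) + K / (1 - r)) r rr) => n.
rewrite -[_ - _](subrKA (v n.+2 x)) mulrDl; apply: le_trans (ler_normD _ _) _.
apply: lerD.
  rewrite -mulrA -(@ler_pXn2r _ 2)// ?nnegrE ?(mulr_ge0 S0 (Kr0 n))//.
  apply: le_trans (TC _ _ x aV (av n.+1)) _.
  rewrite [leRHS]exprMn sqr_sqrtr ?(mulr_ge0 C0 tp0)//.
  rewrite -mulrA ler_wpM2l// mulrC -intI_cst; apply: le_intI; first exact: sB.
    by apply: continuous_integrable_I; exact: cst_continuous.
  move=> y _; rewrite -(real_normK (num_real (_ - _))).
  rewrite lerXn2r ?nnegrE ?Kr0//.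
  by rewrite mulrAC; exact: VP.
rewrite distrC; apply: le_trans (VP x n.+1) _.
rewrite mulrAC ler_wpM2l ?divr_ge0 ?(ltW r1')// exprS.
by rewrite ler_piMl ?exprn_ge0// ltW.
Qed.

End contraction.

(** * The fixed point *)

Section fixed_point.
Variable R : realType.
Implicit Types (f u v : R -> R) (x y : R) (n : nat).

Lemma fourier_neq0 f (n : int) : sqI f -> fourier f n != 0 -> energy f `|n|%N != 0.
Proof.
move=> sf; apply: contra_neq => e0; have := normc_fourier n sf.
rewrite e0 mul0r normc_sqr; case: (fourier f n) => x y /= /eqP.
by rewrite paddr_eq0 ?sqr_ge0// !sqrf_eq0 => /andP[/eqP-> /eqP->].
Qed.

(** The map is v |-> U 0 * F (v, .), with U 0 the periodic resolvent of perext
    G. It is defined on all bounded measurable functions and takes values in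
    H^4, so that fixed points are automatically in H^4. The predicate X covers
    both cases of the theorem, with or without the condition of mean value zero. *)
Lemma resolvent_fixed_point (G : R -> R) (F : R -> R -> R) (k l : R) (h : R -> R) (a b : R)
    (X : (R -> R) -> Prop) :
  {within I2pi R, continuous G} -> G 0 = G (2 * pi) -> assumptionA F k l h ->
  b != 0 -> (a = 0 -> intI G = 0) ->
  ((2 * Num.sqrt pi)%:E * Nab G a b * l%:E < 1)%E ->
  (forall u, X u <-> H4 u /\ (a = 0 -> intI u = 0)) ->
  exists (tau : (R -> R) -> R -> R) (v : R -> R),
    defines_map X (solvesQ G F a b) tau /\
    (X v /\ {in I2pi R, tau v =1 v}) /\
    (forall w, X w -> {in I2pi R, tau w =1 w} -> {in I2pi R, w =1 v}) /\
    solvesP G F a b v /\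
    (forall w, X w -> solvesP G F a b w -> {in I2pi R, w =1 v}) /\
    ((exists n : int, fourier G n * fourier (F 0) n != 0) ->
      exists2 x, x \in I2pi R & v x != 0).
Proof.
move=> cG G2 A b0 G0 hN XE; have tp := twopi_gt0 R.
have l0 : 0 < l by have [_ [_ [_ []]]] := A.
have cP := perext_continuous cG G2; have pP x := perext_periodic G x.
have PG x : x \in I2pi R -> perext G x = G x by exact: perext_I.
have P0 : a = 0 -> intI (perext G) = 0 by move=> a0; rewrite (eq_intI PG) G0.
have [U [jU eU iU]] := periodic_resolvent b0 cP pP P0; have [pU cU dU] := jU.
have [N [N0 Nl GN]] := Nab_finite l0 hN.
have sG : sqI G by exact: eq_sqI PG (continuous_sqI cP).
have EG n : energy G n = ((n%:R ^+ 4 - a) ^+ 2 + (b * n%:R) ^+ 2) * energy (U 0%N) n.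
  by rewrite -(energy_resolvent n jU eU); apply: eq_energy => x xI; rewrite PG.
have UM := resolvent_energy_bound b0 sG EG iU GN.
have M0 : 0 <= 2 * pi * N ^+ 2 by rewrite mulr_ge0 ?sqr_ge0 ?(ltW tp).
have [L1 U1] := periodic_jet_bounded jU (isT : (1 <= 4)%N).
have L := lipschitz_of_derive (fun x => dU 0%N x isT) U1.
have [S US] := periodic_jet_bounded jU (isT : (0 <= 4)%N).
have bU : has_bound (U 0%N) by exists S.
pose T v := conv (U 0%N) (Nemytskii F v).
have jT v : bddmeas v -> periodic_jet (fun k => conv (U k) (Nemytskii F v)).
  by move=> av; exact: conv_jet jU (sqI_Nemytskii A av).
have T4 v : bddmeas v -> H4 (T v) by move=> av; have [] := periodic_jet_H4 (jT v av).
have aT v : bddmeas v -> bddmeas (T v) by move=> av; exact: H4_bddmeas (T4 v av).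
have TB v w x : bddmeas v -> bddmeas w ->
    T v x - T w x = conv (U 0%N) (fun y => Nemytskii F v y - Nemytskii F w y) x.
  by move=> av aw; rewrite convB//; [exact: cU|exact: sqI_Nemytskii A av|exact: sqI_Nemytskii A aw].
have Tq v w : bddmeas v -> bddmeas w -> intI (fun x => (T v x - T w x) ^+ 2) <=
    2 * pi * N ^+ 2 * l ^+ 2 * intI (fun x => (v x - w x) ^+ 2).
  move=> av aw; rewrite (@eq_intI _ _ (fun x => conv (U 0%N) (fun y => Nemytskii F v y - Nemytskii F w y) x ^+ 2)).
    apply: le_trans (conv_L2_le (cU 0%N isT) (fun x => pU 0%N x isT) L _ M0 UM) _.
      by apply: sqIB; [exact: sqI_Nemytskii A av|exact: sqI_Nemytskii A aw].
    by rewrite -[leRHS]mulrA ler_wpM2l// (Nemytskii_lipschitz A).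
  by move=> x _; rewrite TB.
have TC v w x : bddmeas v -> bddmeas w -> `|T v x - T w x| ^+ 2 <=
    S ^+ 2 * (2 * pi) * l ^+ 2 * intI (fun x => (v x - w x) ^+ 2).
  move=> av aw; rewrite TB//; apply: le_trans (conv_sup_le _ (cU 0%N isT) US _) _.
    by apply: sqIB; [exact: sqI_Nemytskii A av|exact: sqI_Nemytskii A aw].
  by rewrite -[leRHS]mulrA ler_wpM2l ?(Nemytskii_lipschitz A)// mulr_ge0 ?sqr_ge0 ?(ltW tp).
have q1 : 2 * pi * N ^+ 2 * l ^+ 2 < 1.
  apply: le_lt_trans Nl; rewrite ler_wpM2r ?sqr_ge0// ler_wpM2r ?sqr_ge0//.
  by rewrite ler_wpM2r ?(ltW (pi_gt0 R))// ler_nat.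
have q01 : 0 <= 2 * pi * N ^+ 2 * l ^+ 2 < 1 by rewrite mulr_ge0 ?sqr_ge0.
have C0 : 0 <= S ^+ 2 * (2 * pi) * l ^+ 2 by rewrite (mulr_ge0 (mulr_ge0 (sqr_ge0 _) (ltW tp)))?sqr_ge0.
have [V aV TV] := L2_contraction q01 C0 aT Tq TC.
have TVE : T V = V by apply/funext.
have T0 v : bddmeas v -> a = 0 -> intI (T v) = 0.
  move=> av a0; have [] := fourier_conv 0 (cU 0%N isT) (fun x => pU 0%N x isT) (sqI_Nemytskii A av).
  by rewrite !fcos0 !fsin0 iU// !mul0r subrr.
have fixed_unique w : bddmeas w -> {in I2pi R, T w =1 w} -> {in I2pi R, w =1 V}.
  move=> aw Tw x xI.
  have d0 : intI (fun x => (w x - V x) ^+ 2) = 0.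
    have dge : 0 <= intI (fun x => (w x - V x) ^+ 2) by apply: intI_ge0 => y _; exact: sqr_ge0.
    have := Tq w V aw aV; rewrite TVE (@eq_intI _ _ (fun x => (w x - V x) ^+ 2)).
      move=> dq; apply/eqP; rewrite eq_le dge andbT.
      by rewrite -(@pmulr_rle0 _ (1 - 2 * pi * N ^+ 2 * l ^+ 2)) ?subr_gt0// mulrBl mul1r subr_le0.
    by move=> y yI; rewrite Tw.
  have := TC w V x aw aV; rewrite d0 mulr0 TVE Tw// => e0.
  apply/eqP; rewrite -subr_eq0 -normr_eq0 -sqrf_eq0; apply/eqP/le_anti.
  by rewrite e0 sqr_ge0.
have TQ v : bddmeas v -> solvesQ G F a b v (T v).
  move=> av; apply: aeW => x _; rewrite convGF_conv.
  have [_ D] := periodic_jet_H4 (jT v av).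
  by rewrite -(conv_ode jU eU (sqI_Nemytskii A av)) !D.
have Qunique v u : bddmeas v -> X u -> solvesQ G F a b v u -> {in I2pi R, u =1 T v}.
  move=> av /XE[u4 u0] Qu.
  apply: (H4_unique b0 (jT v av) _ u4 Qu) => [x|a0].
    by rewrite convGF_conv; exact: conv_ode jU eU (sqI_Nemytskii A av) x.
  by rewrite u0//; exact/esym/T0.
exists T, V; split.
  move=> v /XE[v4 _]; have av := H4_bddmeas v4; split.
  - by apply/XE; split; [exact: T4|exact: T0].
  - exact: TQ.
  - by move=> u; exact: Qunique.
split.
  by split; [apply/XE; rewrite -TVE; split; [exact: T4|exact: T0]|rewrite TVE].
split; first by move=> w /XE[w4 _]; exact: fixed_unique (H4_bddmeas w4).
split.
  have Q := TQ V aV; rewrite TVE in Q.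
  apply: (ae_leb_imply2 _ Q Q) => x + _ xI => /(_ xI) <-.
  by ring.
split.
  move=> w Xw Pw; have [w4 w0] := (XE w).1 Xw; have aw := H4_bddmeas w4.
  apply: fixed_unique => // x xI; apply/esym; move: x xI; apply: Qunique => //.
  apply: (ae_leb_imply2 _ Pw Pw) => x + _ xI => /(_ xI) H; apply/eqP.
  by rewrite -subr_eq0 -[X in _ == X]oppr0 -H; apply/eqP; ring.
move=> [n]; rewrite mulf_eq0 negb_or => /andP[Gn Fn].
apply: contrapT => nV.
have V0 x : x \in I2pi R -> V x = 0.
  by move=> xI; apply/eqP/negPn/negP => Vx; apply: nV; exists x.
have a0 : bddmeas (cst (0 : R)).
  by split; [exact: measurable_cst|exists 0 => x _; rewrite normr0].
have sF : sqI (F 0) := sqI_Nemytskii A a0.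
have := energy_conv `|n|%N (cU 0%N isT) (fun x => pU 0%N x isT) (sqI_Nemytskii A aV).
have -> : energy (conv (U 0%N) (Nemytskii F V)) `|n|%N = 0.
  rewrite -/(T V) TVE (@eq_energy _ _ (cst 0))// /energy /fcos /fsin.
  rewrite (@eq_intI _ _ (fun=> 0)) ?intI_cst; last by move=> x _; rewrite mul0r.
  rewrite (@eq_intI _ _ (fun=> 0)) ?intI_cst; last by move=> x _; rewrite mul0r.
  by rewrite mul0r expr0n addr0.
rewrite (@eq_energy _ (Nemytskii F V) (F 0)); last by move=> x xI; rewrite /Nemytskii V0.
move=> /esym/eqP; rewrite mulf_eq0 (negbTE (fourier_neq0 sF Fn)) orbF => /eqP E0.
by have := fourier_neq0 sG Gn; rewrite EG E0 mulr0 eqxx.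
Qed.

End fixed_point.

Theorem theorem3 (R : realType) (G : R -> R) (F : R -> R -> R) (k l : R)
    (h : R -> R) (a b : R)
    (G_cont : {within I2pi R, continuous G})
    (G_per : G 0 = G (2 * pi))
    (F_A : assumptionA F k l h)
    (F_per : forall u, F u 0 = F u (2 * pi))
    (b_neq0 : b != 0) (a_ge0 : 0 <= a) :
  (0 < a ->
   ((2 * Num.sqrt pi)%:E * Nab G a b * l%:E < 1)%E ->
   exists (tau : (R -> R) -> R -> R) (v_ab : R -> R),
     defines_map (@H4 R) (solvesQ G F a b) tau /\
     (H4 v_ab /\ {in I2pi R, tau v_ab =1 v_ab}) /\
     (forall w, H4 w -> {in I2pi R, tau w =1 w} -> {in I2pi R, w =1 v_ab}) /\
     solvesP G F a b v_ab /\
     (forall w, H4 w -> solvesP G F a b w -> {in I2pi R, w =1 v_ab}) /\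
     ((exists n : int, fourier G n * fourier (F 0) n != 0) ->
      exists2 x, x \in I2pi R & v_ab x != 0))
  /\
  (a = 0 ->
   \int[leb R]_(x in I2pi R) G x = 0 ->
   ((2 * Num.sqrt pi)%:E * Nab G 0 b * l%:E < 1)%E ->
   exists (tau : (R -> R) -> R -> R) (v_0b : R -> R),
     defines_map (@H40 R) (solvesQ G F 0 b) tau /\
     (H40 v_0b /\ {in I2pi R, tau v_0b =1 v_0b}) /\
     (forall w, H40 w -> {in I2pi R, tau w =1 w} -> {in I2pi R, w =1 v_0b}) /\
     solvesP G F 0 b v_0b /\
     (forall w, H40 w -> solvesP G F 0 b w -> {in I2pi R, w =1 v_0b}) /\
     ((exists n : int, fourier G n * fourier (F 0) n != 0) ->
      exists2 x, x \in I2pi R & v_0b x != 0)).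
Proof.
split=> [a0 hN|a0 G0 hN].
  have a00 : a != 0 by rewrite gt_eqF.
  apply: (resolvent_fixed_point G_cont G_per F_A b_neq0 _ hN).
    by move=> /eqP; rewrite (negbTE a00).
  by move=> u; split=> [u4|[]//]; split=> // /eqP; rewrite (negbTE a00).
apply: (resolvent_fixed_point G_cont G_per F_A b_neq0 (fun=> G0) hN).
by move=> u; split=> [[u4 u0]|[u4 /(_ erefl) u0]]; split.
Qed.
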